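(* For $\alpha\in\left[-\frac{3}{50},\frac{3}{50}\right]$, let $F(\cdot;\alpha)$ denote the solution on $[0,\infty)$ of the initial value problem $F'''(x)+F(x)F''(x)=0$ for $x\in(0,\infty)$, $F(0)=\alpha$, $F'(0)=0$, $F''(0)=1$. For $(a,b,c)\in\mathbb{R}^3$ let $$F_0(x;\alpha)=\begin{cases}\alpha+\dfrac{x^2}{2}+x^3P\left(\tfrac25x;\tfrac{25}{3}\alpha+\tfrac12\right), & x\in[0,\tfrac52],\\[2mm] ax+b+\sqrt{\dfrac{a}{2t(x)}}\;q_0(t(x)), & x\in(\tfrac52,\infty),\end{cases}$$ with $P(y;\beta)$, $t(x)$, $q_0$ as given in the context. Let $$a_0(\alpha)=\tfrac{3221}{1946}-\tfrac{797}{603}\alpha+\tfrac{176}{289}\alpha^2,\quad b_0(\alpha)=-\tfrac{2763}{1765}+\tfrac{761}{284}\alpha-\tfrac{194}{237}\alpha^2,\quad c_0(\alpha)=\tfrac{377}{1613}+\tfrac{174}{1357}\alpha+\tfrac{937}{6822}\alpha^2.$$ Then for each $\alpha\in\left[-\frac{3}{50},\frac{3}{50}\right]$ there exists a unique triple $(a,b,c)\in\mathcal{S}_\alpha$, where $$\mathcal{S}_\alpha=\left\{(a,b,c)\in\mathbb{R}^3:\sqrt{(a-a_0(\alpha))^2+\tfrac14(b-b_0(\alpha))^2+\tfrac14(c-c_0(\alpha))^2}\le\rho_0:=5\times10^{-4}\right\},$$ with the property that $F(x;\alpha)=F_0(x;\alpha)+E(x;\alpha)$, where the error term $E$ satisfies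 $$\|E''\|_\infty\le4.90\times10^{-6},\quad\|E'\|_\infty\le3.75\times10^{-6},\quad\|E\|_\infty\le7.50\times10^{-6}\quad\text{on }[0,\tfrac52],$$ where primes denote $x$-derivatives and $\|E\|_\infty:=\sup\{|E(x;\alpha)|:x\in[0,\frac52],\ \alpha\in[-\frac3{50},\frac3{50}]\}$ (similarly for $E',E''$), and for $x\ge\frac52$, $$|E(x;\alpha)|\le1.76\times10^{-5}\,t(x)^{-2}e^{-3t(x)},\quad\left|\frac{\partial}{\partial x}E(x;\alpha)\right|\le9.82\times10^{-5}\,t(x)^{-3/2}e^{-3t(x)},$$ $$\left|\frac{\partial^2}{\partial x^2}E(x;\alpha)\right|\le5.50\times10^{-4}\,t(x)^{-1}e^{-3t(x)}.$$
   Context: Given $(a,b,c)$, set $t(x)=\frac a2\left(x+\frac ba\right)^2$, $$I_0(t)=1-\sqrt{\pi t}\,e^{t}\,\mathrm{erfc}(\sqrt t),\qquad J_0(t)=1-\sqrt{2\pi t}\,e^{2t}\,\mathrm{erfc}(\sqrt{2t}),$$ $$q_0(t)=2c\sqrt t\,e^{-t}I_0(t)+c^2e^{-2t}\left(2J_0(t)-I_0(t)-I_0(t)^2\right),$$ where $\mathrm{erfc}$ is the complementary error function. The polynomial $P$ is $$P(y;\beta)=\sum_{i=0}^{13}\sum_{j=0}^{5}\frac{p_{i,j}}{(i+1)(i+2)(i+3)}\,\beta^jy^i,$$ where the rows of the following $14\times 6$ matrix are indexed by $i=0,\dots,13$ (top to bottom), its columns by $j=0,\dots,5$ (left to right), and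 $p_{i,j}$ is the corresponding entry: $$\left[\begin{array}{cccccc} \frac{29589}{493148} & -\frac{9845}{82042} & -\frac{274}{40132715} & \frac{241}{11270972} & -\frac{422}{16143111} & \frac{308}{28130517}\\ \frac{15185}{1706376} & -\frac{17096}{473735} & \frac{36599}{968864} & -\frac{19441}{3418968} & \frac{6287}{892276} & -\frac{10649}{3570017}\\ -\frac{203116}{65155} & -\frac{3042}{970153} & -\frac{15440}{235863} & \frac{21239}{89058} & -\frac{114887}{372923} & \frac{5024}{37953}\\ -\frac{72804}{75433} & \frac{239497}{147253} & \frac{213995}{192583} & -\frac{110079}{28121} & \frac{1322305}{259224} & -\frac{80021}{35684}\\ \frac{106800}{43663} & -\frac{112122}{86717} & -\frac{155285}{19732} & \frac{525204}{17519} & -\frac{2029749}{49136} & \frac{391166}{20741}\\ -\frac{387344}{32609} & \frac{77473}{4402} & \frac{304475}{15867} & -\frac{3049469}{26658} & \frac{445437}{2501} & -\frac{568723}{6514}\\ \frac{3084825}{27611} & -\frac{1006071}{9319} & \frac{171511}{4286} & \frac{3723623}{24721} & -\frac{1097313}{2915} & \frac{1207261}{5453}\\ -\frac{2254258}{5883} & \frac{3595213}{9561} & -\frac{1049674}{2379} & \frac{2081034}{4399} & \frac{1013365}{19943} & -\frac{1249672}{5459}\\ \frac{1915077}{2126} & -\frac{3165632}{3527} & \frac{5196992}{3543} & -\frac{3429722}{1327} & \frac{3839299}{2153} & -\frac{2755673}{9363}\\ -\frac{2860297}{1927} & \frac{3706169}{2627} & -\frac{5245388}{1929} & \frac{1764108}{317}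 & -\frac{6522639}{1366} & \frac{1111693}{833}\\ \frac{281944}{179} & -\frac{3174435}{2257} & \frac{5003871}{1621} & -\frac{7633149}{1117} & \frac{6098777}{958} & -\frac{9281007}{4606}\\ -\frac{2506157}{2481} & \frac{2704059}{3157} & -\frac{8285683}{3873} & \frac{6455381}{1295} & -\frac{4186545}{863} & \frac{3106817}{1912}\\ \frac{2072736}{5813} & -\frac{1425478}{4881} & \frac{3778762}{4529} & -\frac{980233}{486} & \frac{3100252}{1537} & -\frac{4063417}{5821}\\ -\frac{1051227}{19699} & \frac{745495}{17357} & -\frac{1839247}{13071} & \frac{1844827}{5276} & -\frac{2241089}{6290} & \frac{3813801}{30274} \end{array}\right].$$ The function $F_0$ need not be continuous at $x=\frac52$: in the bounds on $[0,\frac52]$, $E$ and its derivatives are computed with the polynomial formula for $F_0$ (including at $x=\frac52$), and in the bounds for $x\ge\frac52$ they are computed with the formula $ax+b+\sqrt{a/(2t(x))}\,q_0(t(x))$ (including at $x=\frac52$). *)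

(* Defs.v *)
From Stdlib Require Import Reals List.
From Coquelicot Require Import Coquelicot.
Import ListNotations.
Open Scope R_scope.

(* Derivative relative to a set [D], so one-sided at the endpoints of an
   interval.  It only depends on the values of [f] on [D] when [D x] holds. *)
Definition is_derive_on (D : R -> Prop) (f : R -> R) (x l : R) : Prop :=
  filterdiff f (within D (locally x)) (fun h => scal h l).

(* [Derive_on D f x] is a junk value where the relative derivative does not
   exist; below it is only applied to functions that are twice differentiable
   on the non-degenerate interval [D]. *)
Definition Derive_on (D : R -> Prop) (f : R -> R) (x : R) : R :=
  iota (fun l : R => is_derive_on D f x l).

Definition erfc (x : R) : R :=
  2 / sqrt PI *
  RInt_gen (fun s => exp (- s ^ 2)) (at_point x) (Rbar_locally p_infty).

(* Classical solution on [0, oo): F is twice continuously differentiable up to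
   x = 0 (one-sidedly there) and three times differentiable on (0, oo).  Values
   of F at negative arguments are irrelevant. *)
Definition is_solution (alpha : R) (F : R -> R) : Prop :=
  exists F1 F2 F3 : R -> R,
    (forall x, 0 <= x -> is_derive_on (Rle 0) F x (F1 x)) /\
    (forall x, 0 <= x -> is_derive_on (Rle 0) F1 x (F2 x)) /\
    (forall x, 0 <= x ->
       filterlim F2 (within (Rle 0) (locally x)) (locally (F2 x))) /\
    (forall x, 0 < x -> is_derive F2 x (F3 x)) /\
    (forall x, 0 < x -> F3 x + F x * F2 x = 0) /\
    F 0 = alpha /\ F1 0 = 0 /\ F2 0 = 1.

Definition p_rows : list (list R) :=
  [ [29589/493148; -9845/82042; -274/40132715; 241/11270972; -422/16143111; 308/28130517];
    [15185/1706376; -17096/473735; 36599/968864; -19441/3418968; 6287/892276; -10649/3570017];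
    [-203116/65155; -3042/970153; -15440/235863; 21239/89058; -114887/372923; 5024/37953];
    [-72804/75433; 239497/147253; 213995/192583; -110079/28121; 1322305/259224; -80021/35684];
    [106800/43663; -112122/86717; -155285/19732; 525204/17519; -2029749/49136; 391166/20741];
    [-387344/32609; 77473/4402; 304475/15867; -3049469/26658; 445437/2501; -568723/6514];
    [3084825/27611; -1006071/9319; 171511/4286; 3723623/24721; -1097313/2915; 1207261/5453];
    [-2254258/5883; 3595213/9561; -1049674/2379; 2081034/4399; 1013365/19943; -1249672/5459];
    [1915077/2126; -3165632/3527; 5196992/3543; -3429722/1327; 3839299/2153; -2755673/9363];
    [-2860297/1927; 3706169/2627; -5245388/1929; 1764108/317; -6522639/1366; 1111693/833];
    [281944/179; -3174435/2257; 5003871/1621; -7633149/1117; 6098777/958; -9281007/4606];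
    [-2506157/2481; 2704059/3157; -8285683/3873; 6455381/1295; -4186545/863; 3106817/1912];
    [2072736/5813; -1425478/4881; 3778762/4529; -980233/486; 3100252/1537; -4063417/5821];
    [-1051227/19699; 745495/17357; -1839247/13071; 1844827/5276; -2241089/6290; 3813801/30274] ].

Definition p_coef (i j : nat) : R := nth j (nth i p_rows []) 0.

Definition P (y beta : R) : R :=
  sum_n (fun i => sum_n (fun j =>
    p_coef i j / ((INR i + 1) * (INR i + 2) * (INR i + 3)) * beta ^ j * y ^ i)
    5) 13.

Definition t_of (a b x : R) : R := a / 2 * (x + b / a) ^ 2.

Definition I0 (t : R) : R := 1 - sqrt (PI * t) * exp t * erfc (sqrt t).

Definition J0 (t : R) : R :=
  1 - sqrt (2 * PI * t) * exp (2 * t) * erfc (sqrt (2 * t)).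

Definition q0 (c t : R) : R :=
  2 * c * sqrt t * exp (- t) * I0 t
  + c ^ 2 * exp (- 2 * t) * (2 * J0 t - I0 t - I0 t ^ 2).

Definition F0_inner (alpha x : R) : R :=
  alpha + x ^ 2 / 2 + x ^ 3 * P (2 / 5 * x) (25 / 3 * alpha + 1 / 2).

Definition F0_outer (a b c x : R) : R :=
  a * x + b + sqrt (a / (2 * t_of a b x)) * q0 c (t_of a b x).

Definition alpha_range (alpha : R) : Prop := - 3 / 50 <= alpha <= 3 / 50.
Definition inner_range (x : R) : Prop := 0 <= x <= 5 / 2.
Definition outer_range (x : R) : Prop := 5 / 2 <= x.

(* The approximation F0 is [F0_inner] on [0, 5/2] and [F0_outer] beyond, and may
   jump at 5/2.  The error E = F - F0 therefore has two branches, each one taken,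
   together with its derivatives, on a closed interval containing 5/2. *)
Definition E_inner (F : R -> R -> R) (alpha x : R) : R :=
  F alpha x - F0_inner alpha x.

Definition E_outer (F : R -> R -> R) (a b c alpha x : R) : R :=
  F alpha x - F0_outer a b c x.

(* Joint supremum over both variables, valued in the extended reals. *)
Definition sup_norm (g : R -> R -> R) : Rbar :=
  Lub_Rbar (fun y => exists alpha x,
    alpha_range alpha /\ inner_range x /\ y = Rabs (g alpha x)).

Definition a0 (alpha : R) : R :=
  3221 / 1946 - 797 / 603 * alpha + 176 / 289 * alpha ^ 2.
Definition b0 (alpha : R) : R :=
  - 2763 / 1765 + 761 / 284 * alpha - 194 / 237 * alpha ^ 2.
Definition c0 (alpha : R) : R :=
  377 / 1613 + 174 / 1357 * alpha + 937 / 6822 * alpha ^ 2.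

Definition rho0 : R := 5 / 10 ^ 4.

Definition S_set (alpha a b c : R) : Prop :=
  sqrt ((a - a0 alpha) ^ 2 + 1 / 4 * (b - b0 alpha) ^ 2
        + 1 / 4 * (c - c0 alpha) ^ 2) <= rho0.

Definition inner_bounds (F : R -> R -> R) : Prop :=
  let E := E_inner F in
  let E' alpha := Derive_on inner_range (E alpha) in
  let E'' alpha := Derive_on inner_range (E' alpha) in
  Rbar_le (sup_norm E'') (4.90 / 10 ^ 6) /\
  Rbar_le (sup_norm E') (3.75 / 10 ^ 6) /\
  Rbar_le (sup_norm E) (7.50 / 10 ^ 6).

Definition outer_bounds (F : R -> R -> R) (alpha a b c : R) : Prop :=
  let t := t_of a b in
  let E := E_outer F a b c alpha in
  let E' := Derive_on outer_range E in
  let E'' := Derive_on outer_range E' in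
  forall x, outer_range x ->
    Rabs (E x) <= 1.76 / 10 ^ 5 * Rpower (t x) (- 2) * exp (- 3 * t x) /\
    Rabs (E' x) <= 9.82 / 10 ^ 5 * Rpower (t x) (- 3 / 2) * exp (- 3 * t x) /\
    Rabs (E'' x) <= 5.50 / 10 ^ 4 * Rpower (t x) (- 1) * exp (- 3 * t x).

(* Main.v *)
Require Import Defs.
From Stdlib Require Import Reals.
From Coquelicot Require Import Coquelicot.
From Stdlib Require Import List Lra Lia Psatz ZArith.
Import ListNotations.
Open Scope R_scope.

(** Write F = F0 + E.

    On [0, 5/2], F0 is replaced by a polynomial Phi with integer coefficients (up to a common
    denominator).  The residual R = Phi''' + Phi Phi'' is bounded on each strip
    [n/2, (n+1)/2] by the signs of Bernstein coefficients in both variables, checked by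
    computation.  The difference u = F'' - Phi'' solves u' + F u = - R - Phi'' (F - Phi), and
    as F >= -3/50 a Gronwall argument on the five successive strips bounds u and its integrals.

    For x >= 5/2, F is convex and F'' decays like a Gaussian, so that a = lim F' and
    b = lim (F - a x) exist.  With t = z^2 and kappa = F'' e^t / (2 a sqrt(a/2)), the quantity
    G = F - a x - b is nonnegative and kappa' = - G kappa; hence kappa decreases to a limit c > 0.
    Let c G1 be the part of F0 - a x - b of order c, and H1 the integral of G1 from x to oo.
    Inserting c G1 <= G <= kappa(5/2) G1 in this equation, and iterating once, gives
    0 <= kappa - c - c^2 H1 <= 0.64 c^3 H1^2.  As E'' is 2 a sqrt(a/2) e^{-t} times the
    middle term, and E and E' vanish at infinity, two integrations yield the signs and the
    bounds of E, E' and E''.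

    The values F, F', F'' at 5/2 are known to within 6e-6 from the first part.  Expressed
    through the Mills ratio of z, they determine a, b and c to first order in kappa(5/2), and
    comparison with explicit polynomials in alpha shows that (a, b, c) lies in S_alpha.
    Conversely the bounds for x >= 5/2 force a = lim F', b = lim (F - a x) and c = lim kappa. *)

(** Beyond 5/2 hardly anything is estimated by integration. A function with nonnegative second
    derivative that tends to 0 together with its slope is nonnegative and nonincreasing
    ([convex_decay]). Since G and its models have second derivatives with the same Gaussian weight,
    pointwise inequalities between [kappa], c and [H1] become inequalities for G, F' and E. The
    iterated integrals of the Gaussian enter only through their recurrence and their positivity,
    which together act as a truncated continued fraction and leave polynomial arithmetic. The first
    pass of the comparison has kappa(5/2) where c should stand, so it cannot leave an error of order
    c^3; this is what the second pass repairs. The matching is circular, because z and its Mills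
    ratio depend on the a and b that are sought. Convexity first confines a and 5/2 a + b to
    intervals of a few hundredths; the deviations from the approximating polynomials then satisfy
    linear inequalities whose coupling is weak enough for them to be solved. *)

(* Restores the carrier R that Coquelicot's lemmas display as a structure projection, which
   [ring] does not recognise. *)
Ltac eq_in_R := match goal with |- @eq _ ?a ?b => change (@eq R a b) end.

(** * Monotonicity and limits at infinity *)

Lemma derive_nonneg_le (f f' : R -> R) (p q : R) :
  p <= q ->
  (forall x, p <= x <= q -> continuous f x) ->
  (forall x, p < x < q -> is_derive f x (f' x)) ->
  (forall x, p < x < q -> 0 <= f' x) ->
  f p <= f q.
Proof.
  intros Hpq Hc Hd Hp.
  (* [MVT_gen] may return an endpoint, where [f'] is not controlled; the cut-off derivative is 0
     there. *)
  set (g := fun x => if Rlt_dec p x then if Rlt_dec x q then f' x else 0 else 0).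
  destruct (MVT_gen f p q g) as [c [_ Hc2]].
  - intros x; rewrite Rmin_left, Rmax_right by lra; intros Hx.
    unfold g; destruct (Rlt_dec p x); [ | lra]; destruct (Rlt_dec x q); [ | lra].
    apply Hd; lra.
  - intros x; rewrite Rmin_left, Rmax_right by lra; intros Hx.
    apply continuity_pt_filterlim, Hc, Hx.
  - assert (0 <= g c).
    { unfold g; destruct (Rlt_dec p c); [ | lra]; destruct (Rlt_dec c q); [ | lra].
      apply Hp; lra. }
    nra.
Qed.

Lemma derive_le_le (f f' g g' : R -> R) (p q : R) :
  p <= q ->
  (forall x, p <= x <= q -> continuous f x) ->
  (forall x, p <= x <= q -> continuous g x) ->
  (forall x, p < x < q -> is_derive f x (f' x)) ->
  (forall x, p < x < q -> is_derive g x (g' x)) ->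
  (forall x, p < x < q -> f' x <= g' x) ->
  f q - f p <= g q - g p.
Proof.
  intros Hpq Hf Hg Hf' Hg' Hle.
  cut (g p - f p <= g q - f q); [lra | ].
  apply (derive_nonneg_le (fun x => g x - f x) (fun x => g' x - f' x)); [easy | | | ].
  - intros x Hx; apply @continuous_minus; [apply Hg | apply Hf]; easy.
  - intros x Hx; apply @is_derive_minus; [apply Hg' | apply Hf']; easy.
  - intros x Hx; generalize (Hle x Hx); lra.
Qed.

Lemma is_derive_continuous (f : R -> R) (x l : R) : is_derive f x l -> continuous f x.
Proof. intros H; apply (ex_derive_continuous (V := R_NormedModule)); exists l; exact H. Qed.

Lemma derive_zero_const (f : R -> R) (p q : R) :
  p <= q ->
  (forall x, p <= x <= q -> continuous f x) ->
  (forall x, p < x < q -> is_derive f x 0) ->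
  f p = f q.
Proof.
  intros Hpq Hc Hd.
  assert (H1 : f p <= f q) by
    (apply (derive_nonneg_le f (fun _ => 0)); auto; intros; lra).
  assert (H2 : - f p <= - f q).
  { apply (derive_nonneg_le (fun x => - f x) (fun _ => 0)); auto; try (intros; lra).
    - intros x Hx; apply @continuous_opp; auto.
    - intros x Hx; replace 0 with (- 0) by ring.
      apply @is_derive_opp; auto. }
  lra.
Qed.

Lemma is_lim_infty_eventually (f : R -> R) (l : R) (eps : R) :
  is_lim f p_infty l -> 0 < eps ->
  exists X, forall x, X < x -> Rabs (f x - l) < eps.
Proof.
  intros H He; apply is_lim_spec in H.
  destruct (H (mkposreal eps He)) as [X HX]; exists X; exact HX.
Qed.

Lemma eventually_is_lim_infty (f : R -> R) (l : R) :
  (forall eps, 0 < eps -> exists X, forall x, X < x -> Rabs (f x - l) < eps) ->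
  is_lim f p_infty l.
Proof.
  intros H; apply is_lim_spec; intros eps.
  destruct (H eps (cond_pos eps)) as [X HX]; exists X; exact HX.
Qed.

Lemma lim_infty_le (f : R -> R) (x0 l v : R) :
  (forall x, x0 <= x -> v <= f x) -> is_lim f p_infty l -> v <= l.
Proof.
  intros Hf Hl; apply Rnot_lt_le; intros Hlt.
  destruct (is_lim_infty_eventually f l (v - l) Hl) as [X HX]; [lra | ].
  pose proof (Rmax_l X x0); pose proof (Rmax_r X x0).
  specialize (HX (Rmax X x0 + 1) ltac:(lra)).
  specialize (Hf (Rmax X x0 + 1) ltac:(lra)).
  apply Rabs_def2 in HX; lra.
Qed.

Lemma derive_nonneg_le_lim (f f' : R -> R) (x0 l : R) :
  (forall x, x0 <= x -> is_derive f x (f' x)) ->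
  (forall x, x0 <= x -> 0 <= f' x) ->
  is_lim f p_infty l ->
  forall x, x0 <= x -> f x <= l.
Proof.
  intros Hd Hp Hl x Hx; apply (lim_infty_le f x); [ | exact Hl].
  intros y Hy; apply (derive_nonneg_le f f'); [easy | | | ].
  - intros u Hu; apply (is_derive_continuous f u (f' u)), Hd; lra.
  - intros u Hu; apply Hd; lra.
  - intros u Hu; apply Hp; lra.
Qed.

Lemma derive_nonpos_ge_lim (f f' : R -> R) (x0 l : R) :
  (forall x, x0 <= x -> is_derive f x (f' x)) ->
  (forall x, x0 <= x -> f' x <= 0) ->
  is_lim f p_infty l ->
  forall x, x0 <= x -> l <= f x.
Proof.
  intros Hd Hp Hl x Hx; cut (- f x <= - l); [lra | ].
  apply (derive_nonneg_le_lim (fun x => - f x) (fun x => - f' x) x0); [ | | | easy].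
  - intros y Hy; apply @is_derive_opp; auto.
  - intros y Hy; generalize (Hp y Hy); lra.
  - apply (is_lim_opp f p_infty l Hl).
Qed.

Lemma incr_bounded_lim (f : R -> R) (x0 M : R) :
  (forall x y, x0 <= x -> x <= y -> f x <= f y) ->
  (forall x, x0 <= x -> f x <= M) ->
  exists l, is_lim f p_infty (Finite l) /\ forall x, x0 <= x -> f x <= l.
Proof.
  intros Hincr Hb.
  destruct (completeness (fun y => exists x, x0 <= x /\ y = f x)) as [l [Hu Hl]].
  - exists M; intros y [x [Hx ->]]; auto.
  - exists (f x0), x0; split; [lra | easy].
  - assert (Hfl : forall x, x0 <= x -> f x <= l) by (intros x Hx; apply Hu; exists x; easy).
    exists l; split; [ | exact Hfl].
    apply eventually_is_lim_infty; intros eps He.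
    destruct (Classical_Prop.classic (exists x, x0 <= x /\ l - eps < f x)) as [[x [Hx Hlx]] | Hn].
    + exists x; intros y Hy; apply Rabs_def1.
      * generalize (Hfl y ltac:(lra)); lra.
      * generalize (Hincr x y Hx ltac:(lra)); lra.
    + assert (l <= l - eps); [ | lra].
      apply Hl; intros y [x [Hx ->]].
      apply Rnot_lt_le; intros Hlt; apply Hn; exists x; easy.
Qed.

(** [f1] increases to 0, so it is nonpositive; then [f] decreases to 0, so it is nonnegative. *)
Lemma convex_decay (f f1 f2 : R -> R) (x0 : R) :
  (forall x, x0 <= x -> is_derive f x (f1 x)) ->
  (forall x, x0 <= x -> is_derive f1 x (f2 x)) ->
  (forall x, x0 <= x -> 0 <= f2 x) ->
  is_lim f p_infty 0 -> is_lim f1 p_infty 0 ->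
  forall x, x0 <= x -> 0 <= f x /\ f1 x <= 0.
Proof.
  intros H1 H2 Hp L L1.
  assert (H : forall x, x0 <= x -> f1 x <= 0)
    by (apply (derive_nonneg_le_lim f1 f2); auto).
  intros x Hx; split; [ | auto].
  apply (derive_nonpos_ge_lim f f1 x0); auto.
Qed.

Lemma is_derive_congr (f g : R -> R) (x l l' : R) :
  is_derive f x l -> (forall t, g t = f t) -> l' = l -> is_derive g x l'.
Proof.
  intros H E ->; revert H; apply is_derive_ext; intros t; symmetry; apply E.
Qed.

(** * One-sided derivatives and smooth extension of solutions *)

Lemma is_derive_on_eps (D : R -> Prop) (f : R -> R) (x l : R) :
  D x ->
  is_derive_on D f x l <->
  (forall eps : R, 0 < eps -> exists d, 0 < d /\ forall y, D y -> Rabs (y - x) < d ->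
     Rabs (f y - f x - (y - x) * l) <= eps * Rabs (y - x)).
Proof.
  intros HD; split.
  - intros [_ H] eps He.
    assert (Hlim : is_filter_lim (within D (locally x)) x).
    { intros Q HQ; unfold within; revert HQ; apply (filter_imp (F := locally x)); auto. }
    destruct (H x Hlim (mkposreal eps He)) as [d Hd].
    exists d; split; [apply cond_pos | intros y Hy Hyd].
    exact (Hd y Hyd Hy).
  - intros H; split; [exact (is_linear_scal_l (K := R_AbsRing) (V := R_NormedModule) l) | ].
    intros x0 Hx0 eps.
    (* Every neighbourhood of a limit [x0] belongs to the filter and hence contains [x], as [D x]
       holds. *)
    assert (E : x0 = x).
    { destruct (Req_dec x0 x) as [ | Hne]; [easy | exfalso].
      assert (Hr : 0 < Rabs (x - x0)) by (apply Rabs_pos_lt; lra).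
      assert (HQ : locally x0 (fun y => Rabs (y - x0) < Rabs (x - x0)))
        by (exists (mkposreal _ Hr); intros y Hy; exact Hy).
      apply Hx0 in HQ; apply locally_singleton in HQ; specialize (HQ HD); lra. }
    subst x0; destruct (H eps (cond_pos eps)) as [d [Hd Hy]].
    exists (mkposreal d Hd); intros y Hyd HDy; exact (Hy y HDy Hyd).
Qed.

Lemma is_derive_iff_on (f : R -> R) (x l : R) :
  is_derive f x l <-> is_derive_on (fun _ => True) f x l.
Proof.
  split; intros [H1 H2]; split; auto; intros x0 Hx0 eps.
  - assert (Hx : is_filter_lim (locally x) x0).
    { intros Q HQ; pose proof (Hx0 Q HQ) as K; unfold within in K.
      revert K; apply (filter_imp (F := locally x)); auto. }
    pose proof (H2 x0 Hx eps) as K; unfold within.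
    revert K; apply (filter_imp (F := locally x)); auto.
  - assert (Hx : is_filter_lim (within (fun _ => True) (locally x)) x0).
    { intros Q HQ; pose proof (Hx0 Q HQ) as K; unfold within.
      revert K; apply (filter_imp (F := locally x)); auto. }
    pose proof (H2 x0 Hx eps) as K; unfold within in K.
    revert K; apply (filter_imp (F := locally x)); auto.
Qed.

Lemma is_derive_eps (f : R -> R) (x l : R) :
  is_derive f x l <->
  (forall eps : R, 0 < eps -> exists d, 0 < d /\ forall y, Rabs (y - x) < d ->
     Rabs (f y - f x - (y - x) * l) <= eps * Rabs (y - x)).
Proof.
  rewrite is_derive_iff_on, is_derive_on_eps by easy.
  split; intros H eps He; destruct (H eps He) as [d [Hd Hy]]; exists d; auto.
Qed.

Lemma is_derive_is_derive_on (D : R -> Prop) (f g : R -> R) (x l : R) :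
  D x -> (forall y, D y -> f y = g y) -> is_derive g x l -> is_derive_on D f x l.
Proof.
  intros HD Hfg Hg; rewrite is_derive_on_eps by easy; intros eps He.
  apply is_derive_eps with (eps := eps) in Hg; [ | easy].
  destruct Hg as [d [Hd Hy]]; exists d; split; [easy | ].
  intros y HDy Hyd; rewrite !Hfg by easy; auto.
Qed.

Lemma is_derive_on_unique (D : R -> Prop) (f : R -> R) (x l m : R) :
  D x -> (forall d, 0 < d -> exists y, D y /\ y <> x /\ Rabs (y - x) < d) ->
  is_derive_on D f x l -> is_derive_on D f x m -> l = m.
Proof.
  intros HD Hacc Hl Hm; rewrite is_derive_on_eps in Hl, Hm by easy.
  destruct (Req_dec l m) as [ | Hne]; [easy | exfalso].
  (* With a third of the gap as tolerance, the two linear approximations at a common point of [D]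
     differ by at most two thirds of what the gap demands. *)
  assert (He : 0 < Rabs (l - m) / 3).
  { assert (0 < Rabs (l - m)) by (apply Rabs_pos_lt; lra); lra. }
  destruct (Hl _ He) as [d [Hd Hly]]; destruct (Hm _ He) as [d' [Hd' Hmy]].
  destruct (Hacc (Rmin d d')) as [y [HDy [Hyx Hy]]]; [apply Rmin_glb_lt; easy | ].
  specialize (Hly y HDy (Rlt_le_trans _ _ _ Hy (Rmin_l _ _))).
  specialize (Hmy y HDy (Rlt_le_trans _ _ _ Hy (Rmin_r _ _))).
  assert (Hyp : 0 < Rabs (y - x)) by (apply Rabs_pos_lt; lra).
  assert (T : Rabs (y - x) * Rabs (l - m) <= 2 / 3 * Rabs (l - m) * Rabs (y - x)).
  { rewrite <- Rabs_mult.
    replace ((y - x) * (l - m)) with ((f y - f x - (y - x) * m) - (f y - f x - (y - x) * l)) by ring.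
    pose proof (Rabs_triang (f y - f x - (y - x) * m) (- (f y - f x - (y - x) * l))) as T.
    rewrite Rabs_Ropp in T; unfold Rminus at 1; lra. }
  nra.
Qed.

Lemma Derive_on_eq (D : R -> Prop) (f g : R -> R) (x l : R) :
  D x -> (forall d, 0 < d -> exists y, D y /\ y <> x /\ Rabs (y - x) < d) ->
  (forall y, D y -> f y = g y) -> is_derive g x l -> Derive_on D f x = l.
Proof.
  intros HD Hacc Hfg Hg.
  assert (H : is_derive_on D f x l) by (apply (is_derive_is_derive_on D f g); auto).
  apply (iota_unique (V := R_CompleteNormedModule)); [ | exact H].
  intros m Hm; exact (is_derive_on_unique D f x m l HD Hacc Hm H).
Qed.

Lemma inner_range_accumulation (x d : R) :
  inner_range x -> 0 < d -> exists y, inner_range y /\ y <> x /\ Rabs (y - x) < d.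
Proof.
  unfold inner_range; intros Hx Hd.
  pose proof (Rmin_l d 1); pose proof (Rmin_r d 1).
  assert (0 < Rmin d 1) by (apply Rmin_glb_lt; lra).
  destruct (Rle_dec x 1).
  - exists (x + Rmin d 1 / 2); repeat split; try lra; apply Rabs_def1; lra.
  - exists (x - Rmin d 1 / 2); repeat split; try lra; apply Rabs_def1; lra.
Qed.

Lemma outer_range_accumulation (x d : R) :
  outer_range x -> 0 < d -> exists y, outer_range y /\ y <> x /\ Rabs (y - x) < d.
Proof.
  unfold outer_range; intros Hx Hd; exists (x + d / 2); repeat split; try lra.
  apply Rabs_def1; lra.
Qed.

(* A solution is only known on [0, oo); extending it to R as a C^2 function
   allows the use of two-sided derivatives at 0. *)
Definition smooth_solution (alpha : R) (f f1 f2 : R -> R) : Prop :=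
  (forall x, is_derive f x (f1 x)) /\ (forall x, is_derive f1 x (f2 x)) /\
  (forall x, continuous f2 x) /\ (forall x, 0 < x -> is_derive f2 x (- f x * f2 x)) /\
  f 0 = alpha /\ f1 0 = 0 /\ f2 0 = 1.

Definition glue0 (f g : R -> R) (x : R) : R := if Rle_dec 0 x then f x else g x.

Lemma glue0_nonneg (f g : R -> R) (x : R) : 0 <= x -> glue0 f g x = f x.
Proof. intros Hx; unfold glue0; destruct (Rle_dec 0 x); lra. Qed.

Lemma glue0_neg (f g : R -> R) (x : R) : x < 0 -> glue0 f g x = g x.
Proof. intros Hx; unfold glue0; destruct (Rle_dec 0 x); lra. Qed.

Lemma is_derive_glue0 (f f' g g' : R -> R) (x : R) :
  (forall x, 0 <= x -> is_derive_on (Rle 0) f x (f' x)) ->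
  (forall x, is_derive g x (g' x)) -> f 0 = g 0 -> f' 0 = g' 0 ->
  is_derive (glue0 f g) x (glue0 f' g' x).
Proof.
  intros Hf Hg E E'; rewrite is_derive_eps; intros eps He.
  destruct (Rle_dec 0 x) as [Hx | Hx]; [destruct (Req_dec x 0) as [-> | Hx0] | ].
  - specialize (Hf 0 (Rle_refl 0)); rewrite is_derive_on_eps in Hf by lra.
    specialize (Hg 0); rewrite is_derive_eps in Hg.
    destruct (Hf eps He) as [d [Hd H]]; destruct (Hg eps He) as [d' [Hd' H']].
    exists (Rmin d d'); split; [apply Rmin_glb_lt; easy | ].
    intros y Hy; pose proof (Rmin_l d d'); pose proof (Rmin_r d d').
    rewrite !(glue0_nonneg _ _ 0) by lra.
    destruct (Rle_dec 0 y).
    + rewrite glue0_nonneg by easy; apply H; lra.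
    + rewrite glue0_neg by lra; rewrite E, E'; apply H'; lra.
  - specialize (Hf x Hx); rewrite is_derive_on_eps in Hf by lra.
    destruct (Hf eps He) as [d [Hd H]].
    exists (Rmin d x); split; [apply Rmin_glb_lt; lra | ].
    intros y Hy; pose proof (Rmin_l d x); pose proof (Rmin_r d x).
    assert (0 < y) by (apply Rabs_def2 in Hy; lra).
    rewrite !glue0_nonneg by lra; apply H; lra.
  - specialize (Hg x); rewrite is_derive_eps in Hg.
    destruct (Hg eps He) as [d [Hd H]].
    exists (Rmin d (- x)); split; [apply Rmin_glb_lt; lra | ].
    intros y Hy; pose proof (Rmin_l d (- x)); pose proof (Rmin_r d (- x)).
    assert (y < 0) by (apply Rabs_def2 in Hy; lra).
    rewrite !glue0_neg by lra; apply H; lra.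
Qed.

(** To the left of 0 the solution is continued by its second-order Taylor polynomial, so that the
    value and the first two derivatives match at 0; the differential equation is kept for positive
    x. *)
Lemma solution_extension (alpha : R) (F : R -> R) :
  is_solution alpha F ->
  exists f f1 f2, smooth_solution alpha f f1 f2 /\ forall x, 0 <= x -> f x = F x.
Proof.
  intros (F1 & F2 & F3 & HF & HF1 & HF2 & HF3 & Hode & E0 & E1 & E2).
  exists (glue0 F (fun x => alpha + x ^ 2 / 2)), (glue0 F1 (fun x => x)), (glue0 F2 (fun _ => 1)).
  split; [refine (conj _ (conj _ (conj _ (conj _ (conj _ (conj _ _)))))) | ].
  - intros x; apply is_derive_glue0; auto.
    + intros y; auto_derive; [easy | field].
    + rewrite E0; field.
  - intros x; apply is_derive_glue0; auto.
    intros y; auto_derive; [easy | ring].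
  - intros x; apply filterlim_locally; intros eps.
    destruct (Rle_dec 0 x) as [Hx | Hx]; [destruct (Req_dec x 0) as [-> | Hx0] | ].
    + specialize (HF2 0 (Rle_refl 0)); rewrite filterlim_locally in HF2.
      pose proof (HF2 eps) as K; unfold within in K; revert K.
      apply (filter_imp (F := locally 0)); intros y Hy.
      rewrite (glue0_nonneg _ _ 0) by lra; destruct (Rle_dec 0 y) as [H | H].
      * rewrite glue0_nonneg by easy; auto.
      * rewrite glue0_neg, E2 by lra; apply ball_center.
    + assert (Hp : 0 < x) by lra; pose proof (is_derive_continuous _ _ _ (HF3 x Hp)) as Hc.
      rewrite glue0_nonneg by easy; unfold continuous in Hc; rewrite filterlim_locally in Hc.
      generalize (filter_and _ _ (Hc eps) (locally_interval (fun y => 0 < y) x 0 p_infty Hp I (fun y Hy _ => Hy))).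
      apply (filter_imp (F := locally x)); intros y [Hy Hy0]; rewrite glue0_nonneg by lra; easy.
    + generalize (locally_interval (fun y => y < 0) x m_infty 0 I ltac:(simpl; lra) (fun y _ Hy => Hy)).
      apply (filter_imp (F := locally x)); intros y Hy; rewrite !glue0_neg by lra; apply ball_center.
  - intros x Hx; rewrite !glue0_nonneg by lra.
    replace (- F x * F2 x) with (F3 x) by (specialize (Hode x Hx); lra).
    generalize (HF3 x Hx); apply is_derive_ext_loc.
    generalize (locally_interval (fun y => 0 < y) x 0 p_infty Hx I (fun y Hy _ => Hy)).
    apply filter_imp; intros y Hy; rewrite glue0_nonneg by lra; easy.
  - rewrite glue0_nonneg by lra; easy.
  - rewrite glue0_nonneg by lra; easy.
  - rewrite glue0_nonneg by lra; easy.
  - intros x Hx; apply glue0_nonneg; easy.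
Qed.

Lemma smooth_solution_is_solution (alpha : R) (f f1 f2 : R -> R) :
  smooth_solution alpha f f1 f2 -> is_solution alpha f.
Proof.
  intros (Hf & Hf1 & Hc & Hf2 & E0 & E1 & E2).
  exists f1, f2, (fun x => - f x * f2 x).
  refine (conj _ (conj _ (conj _ (conj Hf2 (conj _ (conj E0 (conj E1 E2))))))).
  - intros x Hx; apply (is_derive_is_derive_on _ f f); auto.
  - intros x Hx; apply (is_derive_is_derive_on _ f1 f1); auto.
  - intros x Hx; eapply filterlim_filter_le_1; [apply filter_le_within | apply Hc].
  - intros; ring.
Qed.

(** * Uniqueness and existence of solutions *)

Lemma is_derive_primitive (g : R -> R) (x : R) :
  (forall y, continuous g y) -> is_derive (fun y => RInt g 0 y) x (g x).
Proof.
  intros Hg; apply (is_derive_RInt g (fun y => RInt g 0 y) 0 x); [ | apply Hg].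
  apply filter_forall; intros y; apply (RInt_correct (V := R_CompleteNormedModule)).
  apply (ex_RInt_continuous (V := R_CompleteNormedModule)); auto.
Qed.

Lemma RInt_0_0 (g : R -> R) : RInt g 0 0 = 0.
Proof. apply (RInt_point (V := R_CompleteNormedModule)). Qed.

Lemma continuous_exp_opp (g : R -> R) (x : R) :
  continuous g x -> continuous (fun y => exp (- g y)) x.
Proof.
  intros Hg; apply (continuous_comp (fun y => - g y) exp).
  - apply (continuous_opp (V := R_NormedModule)); exact Hg.
  - apply is_derive_continuous with (exp (- g x)); apply is_derive_exp.
Qed.

Lemma exp_bound_step (f f' : R -> R) (c lam L x : R) :
  0 < lam -> f 0 = 0 ->
  (forall y, 0 <= y <= L -> continuous f y) ->
  (forall y, 0 < y < L -> is_derive f y (f' y)) ->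
  (forall y, 0 < y < L -> Rabs (f' y) <= c * exp (lam * y)) ->
  0 <= c -> 0 <= x <= L -> Rabs (f x) <= c / lam * exp (lam * x).
Proof.
  intros Hl H0 Hc Hd Hb Hcp Hx.
  set (g := fun y => c / lam * exp (lam * y)).
  assert (Hg : forall y, is_derive g y (c * exp (lam * y))).
  { intros y; unfold g; auto_derive; [easy | field; lra]. }
  assert (Hg0 : 0 <= g 0).
  { unfold g; apply Rmult_le_pos; [ | left; apply exp_pos].
    apply Rmult_le_pos; [easy | left; apply Rinv_0_lt_compat; easy]. }
  assert (H1 : f x - f 0 <= g x - g 0).
  { apply (derive_le_le f f' g (fun y => c * exp (lam * y))); try easy.
    - intros y Hy; apply Hc; lra.
    - intros y _; apply (is_derive_continuous _ _ _ (Hg y)).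
    - intros y Hy; apply Hd; lra.
    - intros y Hy; specialize (Hb y ltac:(lra)); apply Rabs_le_between in Hb; lra. }
  assert (H2 : (- f x) - (- f 0) <= g x - g 0).
  { apply (derive_le_le (fun y => - f y) (fun y => - f' y) g (fun y => c * exp (lam * y))); try easy.
    - intros y Hy; apply (continuous_opp (V := R_NormedModule)), Hc; lra.
    - intros y _; apply (is_derive_continuous _ _ _ (Hg y)).
    - intros y Hy; apply (is_derive_opp (V := R_NormedModule)), Hd; lra.
    - intros y Hy; specialize (Hb y ltac:(lra)); apply Rabs_le_between in Hb; lra. }
  apply Rabs_le; fold (g x); lra.
Qed.

Lemma triple_bound (D D1 D2 D3 : R -> R) (c lam L x : R) :
  0 < lam -> 0 <= c -> D 0 = 0 -> D1 0 = 0 -> D2 0 = 0 ->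
  (forall y, is_derive D y (D1 y)) -> (forall y, is_derive D1 y (D2 y)) ->
  (forall y, 0 <= y -> is_derive D2 y (D3 y)) ->
  (forall y, 0 < y < L -> Rabs (D3 y) <= c * exp (lam * y)) ->
  0 <= x <= L -> Rabs (D x) <= c / lam ^ 3 * exp (lam * x).
Proof.
  intros Hl Hc E0 E1 E2 H0 H1 H2 H3 Hx.
  assert (Hi : 0 < / lam) by (apply Rinv_0_lt_compat; easy).
  assert (Hc1 : 0 <= c / lam) by (apply Rmult_le_pos; lra).
  assert (Hc2 : 0 <= c / lam / lam) by (apply Rmult_le_pos; lra).
  replace (c / lam ^ 3) with (c / lam / lam / lam) by (field; lra).
  apply (exp_bound_step D D1 _ _ L); auto.
  - intros y _; apply (is_derive_continuous _ _ _ (H0 y)).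
  - intros y Hy; apply (exp_bound_step D1 D2 _ _ L); auto; try lra.
    + intros u _; apply (is_derive_continuous _ _ _ (H1 u)).
    + intros u Hu; apply (exp_bound_step D2 D3 _ _ L); auto; try lra.
      * intros v Hv; apply (is_derive_continuous _ _ _ (H2 v (proj1 Hv))).
      * intros v Hv; apply H2; lra.
Qed.

Lemma exp_opp_lipschitz (A a b : R) :
  - A <= a -> - A <= b -> Rabs (exp (- a) - exp (- b)) <= exp A * Rabs (a - b).
Proof.
  assert (W : forall a b, - A <= a -> a <= b -> Rabs (exp (- a) - exp (- b)) <= exp A * Rabs (a - b)).
  { clear a b; intros a b Ha Hab.
    assert (He : exp (- b) <= exp (- a))
      by (destruct Hab as [H | ->]; [left; apply exp_increasing; lra | lra]).
    rewrite Rabs_right, Rabs_left1 by lra.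
    (* Factoring out exp(-a) reduces the claim to 1 - exp(-d) <= d with d = b - a. *)
    assert (E : exp (- b) = exp (- a) * exp (- (b - a))) by (rewrite <- exp_plus; f_equal; ring).
    pose proof (exp_ineq1_le (- (b - a))) as H1.
    assert (H2 : exp (- a) <= exp A)
      by (destruct Ha as [H | H]; [left; apply exp_increasing; lra | right; f_equal; lra]).
    pose proof (exp_pos (- a)).
    rewrite E; nra. }
  intros Ha Hb; destruct (Rle_dec a b); [apply W; easy | ].
  rewrite Rabs_minus_sym, (Rabs_minus_sym a b); apply W; lra.
Qed.

(** The product of [f2] and the exponential of the integral of [f] is constant. The formula makes
    F'' positive and turns the problem into one for the integral of F. *)
Lemma smooth_solution_f2 (alpha : R) (f f1 f2 : R -> R) :
  smooth_solution alpha f f1 f2 ->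
  forall x, 0 <= x -> f2 x = exp (- RInt f 0 x).
Proof.
  intros (Hf & Hf1 & Hc & Hf2 & E0 & E1 & E2) x Hx.
  assert (Cf : forall y, continuous f y) by (intros y; apply (is_derive_continuous _ _ _ (Hf y))).
  set (h := fun y => f2 y * exp (RInt f 0 y)).
  assert (Hexp : forall y, is_derive (fun u => exp (RInt f 0 u)) y (f y * exp (RInt f 0 y))).
  { intros y; apply (is_derive_comp exp (fun u => RInt f 0 u));
      [apply is_derive_exp | apply is_derive_primitive; auto]. }
  assert (E : h 0 = h x).
  { apply derive_zero_const; [easy | | ].
    - intros y _; apply (continuous_mult (K := R_AbsRing)); [apply Hc | ].
      apply (is_derive_continuous _ _ _ (Hexp y)).
    - intros y Hy.
      pose proof (is_derive_mult _ _ _ _ _ (Hf2 y (proj1 Hy)) (Hexp y) Rmult_comm) as Hm.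
      apply (is_derive_congr _ _ _ _ _ Hm); [easy | ].
      unfold plus, mult; simpl; ring. }
  unfold h in E; rewrite RInt_0_0, exp_0, E2 in E.
  rewrite exp_Ropp; field_simplify_eq; [ | apply Rgt_not_eq, exp_pos]; lra.
Qed.

Lemma smooth_solution_pos (alpha : R) (f f1 f2 : R -> R) :
  smooth_solution alpha f f1 f2 ->
  forall x, 0 <= x -> 0 < f2 x /\ 0 <= f1 x /\ alpha <= f x.
Proof.
  intros S; pose proof (smooth_solution_f2 _ _ _ _ S) as E.
  destruct S as (Hf & Hf1 & Hc & Hf2 & E0 & E1 & E2).
  assert (P2 : forall x, 0 <= x -> 0 < f2 x) by (intros x Hx; rewrite E by easy; apply exp_pos).
  assert (P1 : forall x, 0 <= x -> 0 <= f1 x).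
  { intros x Hx; rewrite <- E1; apply (derive_nonneg_le f1 f2); auto.
    - intros y _; apply (is_derive_continuous _ _ _ (Hf1 y)).
    - intros y Hy; left; apply P2; lra. }
  intros x Hx; repeat split; auto.
  rewrite <- E0; apply (derive_nonneg_le f f1); auto.
  - intros y _; apply (is_derive_continuous _ _ _ (Hf y)).
  - intros y Hy; apply P1; lra.
Qed.

Lemma RInt_lower_linear (alpha : R) (f : R -> R) (x : R) :
  (forall y, continuous f y) -> (forall y, 0 <= y -> alpha <= f y) -> 0 <= x ->
  alpha * x <= RInt f 0 x.
Proof.
  intros Hc Hf Hx.
  assert (H : RInt f 0 0 - alpha * 0 <= RInt f 0 x - alpha * x).
  { assert (Hd : forall y, is_derive (fun y => RInt f 0 y - alpha * y) y (f y - alpha)).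
    { intros y; apply (is_derive_minus (V := R_NormedModule) (fun y => RInt f 0 y) (fun y => alpha * y)).
      - apply is_derive_primitive; auto.
      - auto_derive; [easy | ring]. }
    apply (derive_nonneg_le (fun y => RInt f 0 y - alpha * y) (fun y => f y - alpha)); auto.
    - intros y _; apply (is_derive_continuous _ _ _ (Hd y)).
    - intros y Hy; specialize (Hf y ltac:(lra)); lra. }
  rewrite RInt_0_0 in H; lra.
Qed.

Lemma linear_lower (alpha L x : R) : 0 <= x <= L -> - (Rabs alpha * L) <= alpha * x.
Proof.
  intros Hx; pose proof (Rabs_pos alpha); pose proof (Rle_abs (- alpha)) as H1.
  rewrite Rabs_Ropp in H1; nra.
Qed.

(** Twice the Lipschitz constant of u -> exp(-u) on [- |alpha| L, oo), a half-line that contains the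
    values of the integral of F on [0, L]. *)
Definition rate (alpha L : R) : R := 2 * exp (Rabs alpha * L).

Lemma rate_ge (alpha L : R) : 0 <= L -> 2 <= rate alpha L.
Proof.
  intros HL; unfold rate; pose proof (exp_ineq1_le (Rabs alpha * L)).
  pose proof (Rabs_pos alpha); nra.
Qed.

(* The rate is chosen so that the Picard map halves the e^{rate x}-weighted norm on [0, L]. *)
Lemma picard_contraction (alpha L c : R) (J K D D1 D2 : R -> R) :
  0 <= L -> 0 <= c -> D 0 = 0 -> D1 0 = 0 -> D2 0 = 0 ->
  (forall y, is_derive D y (D1 y)) -> (forall y, is_derive D1 y (D2 y)) ->
  (forall y, 0 <= y -> is_derive D2 y (exp (- J y) - exp (- K y))) ->
  (forall y, 0 <= y -> alpha * y <= J y) -> (forall y, 0 <= y -> alpha * y <= K y) ->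
  (forall y, 0 <= y <= L -> Rabs (J y - K y) <= c * exp (rate alpha L * y)) ->
  forall x, 0 <= x <= L -> Rabs (D x) <= c / 2 * exp (rate alpha L * x).
Proof.
  intros HL Hc E0 E1 E2 H0 H1 H2 HJ HK HJK x Hx.
  pose proof (rate_ge alpha L HL) as Hr; set (r := rate alpha L) in *.
  assert (Hexp : exp (Rabs alpha * L) = r / 2) by (unfold r, rate; field).
  assert (B : Rabs (D x) <= (r / 2 * c) / r ^ 3 * exp (r * x)).
  { apply (triple_bound D D1 D2 (fun y => exp (- J y) - exp (- K y)) _ _ L); auto; try nra.
    intros y Hy; specialize (HJ y ltac:(lra)); specialize (HK y ltac:(lra)).
    pose proof (linear_lower alpha L y ltac:(lra)).
    eapply Rle_trans; [apply (exp_opp_lipschitz (Rabs alpha * L)); lra | ].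
    rewrite Hexp, Rmult_assoc; apply Rmult_le_compat_l; [lra | apply HJK; lra]. }
  eapply Rle_trans; [exact B | ].
  apply Rmult_le_compat_r; [left; apply exp_pos | ].
  replace (r / 2 * c / r ^ 3) with (c / 2 * / (r * r)) by (field; lra).
  rewrite <- (Rmult_1_r (c / 2)) at 2; apply Rmult_le_compat_l; [lra | ].
  rewrite <- Rinv_1; apply Rinv_le_contravar; nra.
Qed.

Lemma half_pow_small (v w : R) :
  0 <= w -> (forall n : nat, v <= w * (1 / 2) ^ n) -> v <= 0.
Proof.
  intros Hw H; apply Rnot_lt_le; intros Hv.
  destruct (Req_dec w 0) as [-> | Hw0]; [specialize (H 0%nat); lra | ].
  destruct (pow_lt_1_zero (1 / 2) ltac:(rewrite Rabs_right; lra) (v / w)) as [N HN].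
  - apply Rmult_lt_0_compat; [easy | apply Rinv_0_lt_compat; lra].
  - specialize (HN N (le_n N)); specialize (H N).
    rewrite Rabs_right in HN by (apply Rle_ge, pow_le; lra).
    apply (Rmult_lt_compat_l w) in HN; [ | lra].
    replace (w * (v / w)) with v in HN by (field; lra); lra.
Qed.

(** The contraction is applied to the integrals of [f] and [g], which obey the lower bound alpha x
    that it requires. On [0, L] their weighted distance is finite and is halved by each application,
    so it is 0; at x > 0 the difference vanishes nearby, and its derivative f - g is 0. *)
Lemma smooth_solution_unique (alpha : R) (f f1 f2 g g1 g2 : R -> R) :
  smooth_solution alpha f f1 f2 -> smooth_solution alpha g g1 g2 ->
  forall x, 0 <= x -> f x = g x.
Proof.
  intros Sf Sg.
  pose proof (smooth_solution_f2 _ _ _ _ Sf) as Ef; pose proof (smooth_solution_f2 _ _ _ _ Sg) as Eg.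
  pose proof (smooth_solution_pos _ _ _ _ Sf) as Pf; pose proof (smooth_solution_pos _ _ _ _ Sg) as Pg.
  destruct Sf as (Hf & Hf1 & Hc & Hf2 & E0 & E1 & E2).
  destruct Sg as (Hg & Hg1 & Hcg & Hg2 & E0' & E1' & E2').
  assert (Cf : forall y, continuous f y) by (intros y; apply (is_derive_continuous _ _ _ (Hf y))).
  assert (Cg : forall y, continuous g y) by (intros y; apply (is_derive_continuous _ _ _ (Hg y))).
  set (D := fun x => RInt f 0 x - RInt g 0 x).
  assert (HD : forall y, is_derive D y (f y - g y)).
  { intros y; apply (is_derive_minus (V := R_NormedModule) (fun y => RInt f 0 y) (fun y => RInt g 0 y));
      apply is_derive_primitive; auto. }
  assert (HD1 : forall y, is_derive (fun y => f y - g y) y (f1 y - g1 y))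
    by (intros y; apply (is_derive_minus (V := R_NormedModule)); auto).
  assert (HD2 : forall y, is_derive (fun y => f1 y - g1 y) y (f2 y - g2 y))
    by (intros y; apply (is_derive_minus (V := R_NormedModule)); auto).
  assert (LI : forall y, 0 <= y -> alpha * y <= RInt f 0 y)
    by (intros y Hy; apply RInt_lower_linear; auto; intros; apply Pf; easy).
  assert (LJ : forall y, 0 <= y -> alpha * y <= RInt g 0 y)
    by (intros y Hy; apply RInt_lower_linear; auto; intros; apply Pg; easy).
  assert (Z : forall L x, 0 <= x <= L -> D x = 0).
  { intros L x Hx; assert (HL : 0 <= L) by lra.
    destruct (continuity_ab_maj (fun y => Rabs (D y)) 0 L HL) as [M [HM _]].
    { intros y _; apply continuity_pt_filterlim.
      apply (continuous_comp D Rabs); [apply (is_derive_continuous _ _ _ (HD y)) | apply continuous_Rabs]. }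
    set (k := Rabs (D M)) in *; assert (Hk : 0 <= k) by apply Rabs_pos.
    set (r := rate alpha L); pose proof (rate_ge alpha L HL) as Hr; fold r in Hr.
    assert (B : forall n y, 0 <= y <= L -> Rabs (D y) <= k * (1 / 2) ^ n * exp (r * y)).
    { induction n as [ | n IH]; intros y Hy.
      - rewrite pow_O, Rmult_1_r; apply Rle_trans with k; [exact (HM y Hy) | ].
        assert (0 <= r * y) by (apply Rmult_le_pos; lra).
        pose proof (exp_ineq1_le (r * y)); clearbody k; nra.
      - replace (k * (1 / 2) ^ S n) with (k * (1 / 2) ^ n / 2) by (simpl; field).
        apply (picard_contraction alpha L _ (fun y => RInt f 0 y) (fun y => RInt g 0 y) D
          (fun y => f y - g y) (fun y => f1 y - g1 y)); auto; try lra.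
        + apply Rmult_le_pos; [easy | apply pow_le; lra].
        + unfold D; rewrite !RInt_0_0; ring.
        + intros u Hu; rewrite <- Ef, <- Eg by easy; apply HD2. }
    apply Rabs_eq_0, Rle_antisym; [ | apply Rabs_pos].
    apply (half_pow_small _ (k * exp (r * x))).
    - apply Rmult_le_pos; [easy | left; apply exp_pos].
    - intros n; specialize (B n x Hx); lra. }
  intros x Hx; destruct (Req_dec x 0) as [-> | Hx0]; [congruence | ].
  assert (Hxp : 0 < x) by lra.
  assert (Hz : is_derive D x 0).
  { apply (is_derive_ext_loc (fun _ => 0)); [ | apply (is_derive_const (V := R_NormedModule))].
    generalize (locally_interval (fun y => 0 < y) x 0 p_infty Hxp I (fun y Hy _ => Hy)).
    apply (filter_imp (F := locally x)); intros y Hy; symmetry; apply (Z y); lra. }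
  pose proof (is_derive_unique _ _ _ (HD x)) as U1; pose proof (is_derive_unique _ _ _ Hz) as U2.
  rewrite U1 in U2; lra.
Qed.

Definition prim (g : R -> R) (x : R) : R := RInt g 0 x.

Lemma is_derive_prim (g : R -> R) (x : R) :
  (forall y, continuous g y) -> is_derive (prim g) x (g x).
Proof. intros Hg; exact (is_derive_primitive g x Hg). Qed.

(* The Picard map of I''' = exp(-I), I(0) = 0, I'(0) = alpha, I''(0) = 0, the
   equation satisfied by I = int_0^x F. *)
Definition picard2 (I : R -> R) : R -> R := prim (fun y => exp (- I y)).
Definition picard1 (alpha : R) (I : R -> R) (x : R) : R := alpha + prim (picard2 I) x.
Definition picard (alpha : R) (I : R -> R) : R -> R := prim (picard1 alpha I).

Section Picard_map.

Context (alpha : R) (I : R -> R) (HI : forall y, continuous I y).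

Lemma continuous_exp_opp_fun (y : R) : continuous (fun y => exp (- I y)) y.
Proof. apply continuous_exp_opp, HI. Qed.

Lemma is_derive_picard2 (x : R) : is_derive (picard2 I) x (exp (- I x)).
Proof. apply (is_derive_prim (fun y => exp (- I y))), continuous_exp_opp_fun. Qed.

Lemma is_derive_picard1 (x : R) : is_derive (picard1 alpha I) x (picard2 I x).
Proof.
  assert (H : is_derive (prim (picard2 I)) x (picard2 I x))
    by (apply is_derive_prim; intros y; apply (is_derive_continuous _ _ _ (is_derive_picard2 y))).
  pose proof (is_derive_plus _ _ _ _ _ (is_derive_const (V := R_NormedModule) alpha x) H) as Hp.
  apply (is_derive_congr _ _ _ _ _ Hp); [easy | unfold plus, zero; simpl; ring].
Qed.

Lemma is_derive_picard (x : R) : is_derive (picard alpha I) x (picard1 alpha I x).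
Proof.
  apply is_derive_prim; intros y; apply (is_derive_continuous _ _ _ (is_derive_picard1 y)).
Qed.

Lemma picard_0 : picard alpha I 0 = 0 /\ picard1 alpha I 0 = alpha /\ picard2 I 0 = 0.
Proof. unfold picard, picard1, picard2, prim; rewrite !RInt_0_0; repeat split; ring. Qed.

(** Positivity of exp(-I) makes [picard2] nonnegative and [picard1] at least alpha. All iterates
    therefore stay in the range where exp(-u) has the Lipschitz constant behind [rate]. *)
Lemma picard_ge (x : R) : 0 <= x -> alpha * x <= picard alpha I x.
Proof.
  intros Hx; apply RInt_lower_linear; [ | | easy].
  - intros y; apply (is_derive_continuous _ _ _ (is_derive_picard1 y)).
  - destruct picard_0 as [_ [E1 E2]].
    intros y Hy; rewrite <- E1 at 1.
    apply (derive_nonneg_le _ (picard2 I)); auto using is_derive_picard1.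
    + intros u _; apply (is_derive_continuous _ _ _ (is_derive_picard1 u)).
    + intros u Hu; rewrite <- E2; apply (derive_nonneg_le _ (fun y => exp (- I y))); [lra | | | ].
      * intros v _; apply (is_derive_continuous _ _ _ (is_derive_picard2 v)).
      * intros v _; apply is_derive_picard2.
      * intros; left; apply exp_pos.
Qed.

End Picard_map.

Lemma picard_map_contraction (alpha L c : R) (J K : R -> R) :
  0 <= L -> 0 <= c -> (forall y, continuous J y) -> (forall y, continuous K y) ->
  (forall y, 0 <= y -> alpha * y <= J y) -> (forall y, 0 <= y -> alpha * y <= K y) ->
  (forall y, 0 <= y <= L -> Rabs (J y - K y) <= c * exp (rate alpha L * y)) ->
  forall x, 0 <= x <= L ->
    Rabs (picard alpha J x - picard alpha K x) <= c / 2 * exp (rate alpha L * x).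
Proof.
  intros HL Hc CJ CK HJ HK HJK x Hx.
  destruct (picard_0 alpha J) as (J0 & J1 & J2); destruct (picard_0 alpha K) as (K0 & K1 & K2).
  apply (picard_contraction alpha L c J K (fun x => picard alpha J x - picard alpha K x)
    (fun x => picard1 alpha J x - picard1 alpha K x) (fun x => picard2 J x - picard2 K x)); auto; try lra.
  - intros y; apply (is_derive_minus (V := R_NormedModule)); apply is_derive_picard; auto.
  - intros y; apply (is_derive_minus (V := R_NormedModule)); apply is_derive_picard1; auto.
  - intros y _; apply (is_derive_minus (V := R_NormedModule)); apply is_derive_picard2; auto.
Qed.

Fixpoint iterate (alpha : R) (n : nat) : R -> R :=
  match n with
  | O => fun x => alpha * x
  | S n => picard alpha (iterate alpha n)
  end.

Lemma continuous_iterate (alpha : R) (n : nat) (y : R) : continuous (iterate alpha n) y.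
Proof.
  revert y; induction n as [ | n IH]; intros y; simpl.
  - apply is_derive_continuous with alpha; auto_derive; [easy | ring].
  - apply (is_derive_continuous _ _ _ (is_derive_picard alpha _ IH y)).
Qed.

Lemma iterate_ge (alpha : R) (n : nat) (x : R) : 0 <= x -> alpha * x <= iterate alpha n x.
Proof.
  intros Hx; destruct n; simpl; [lra | ].
  apply picard_ge; [apply continuous_iterate | easy].
Qed.

Lemma iterate_step (alpha L : R) (n : nat) (x : R) :
  0 <= x <= L ->
  Rabs (iterate alpha (S n) x - iterate alpha n x) <= (1 / 2) ^ n * exp (rate alpha L * x).
Proof.
  intros Hx; assert (HL : 0 <= L) by lra; revert x Hx.
  pose proof (rate_ge alpha L HL) as Hr.
  induction n as [ | n IH]; intros x Hx.
  - rewrite pow_O; simpl iterate.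
    set (I := fun x => alpha * x).
    assert (CI : forall y, continuous I y) by (intros y; apply (continuous_iterate alpha 0)).
    destruct (picard_0 alpha I) as (I0 & I1 & I2).
    (* The third derivative of [picard alpha I] is exp(- alpha x) <= exp(|alpha| L) = rate / 2;
       three integrations divide this by rate^3. *)
    apply Rle_trans with (rate alpha L / 2 / rate alpha L ^ 3 * exp (rate alpha L * x)).
    + apply (triple_bound (fun x => picard alpha I x - alpha * x) (fun x => picard1 alpha I x - alpha)
        (fun x => picard2 I x) (fun x => exp (- I x)) _ _ L); auto; try lra.
      * intros y; apply (is_derive_minus (V := R_NormedModule)); [apply is_derive_picard; auto | ].
        auto_derive; [easy | ring].
      * intros y.
        pose proof (is_derive_minus _ _ _ _ _ (is_derive_picard1 alpha I CI y)
          (is_derive_const (V := R_NormedModule) alpha y)) as Hp.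
        apply (is_derive_congr _ _ _ _ _ Hp); [easy | ].
        unfold minus, plus, opp, zero; simpl; ring.
      * intros y _; apply is_derive_picard2; auto.
      * intros y Hy; rewrite Rabs_right by (left; apply exp_pos).
        replace (rate alpha L / 2) with (exp (Rabs alpha * L)) by (unfold rate; field).
        pose proof (linear_lower alpha L y ltac:(lra)) as H.
        assert (He : exp (- I y) <= exp (Rabs alpha * L))
          by (unfold I; destruct H; [left; apply exp_increasing; lra | right; f_equal; lra]).
        pose proof (exp_pos (Rabs alpha * L)).
        assert (0 <= rate alpha L * y) by (apply Rmult_le_pos; lra).
        pose proof (exp_ineq1_le (rate alpha L * y)); nra.
    + apply Rmult_le_compat_r; [left; apply exp_pos | ].
      set (r := rate alpha L) in *.
      replace (r / 2 / r ^ 3) with (/ (2 * r * r)) by (field; lra).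
      rewrite <- Rinv_1; apply Rinv_le_contravar; nra.
  - replace ((1 / 2) ^ S n) with ((1 / 2) ^ n / 2) by (simpl; field).
    apply (picard_map_contraction alpha L ((1 / 2) ^ n) (iterate alpha (S n)) (iterate alpha n)); auto.
    + apply pow_le; lra.
    + apply continuous_iterate.
    + apply continuous_iterate.
    + intros; apply iterate_ge; easy.
    + intros; apply iterate_ge; easy.
Qed.

Lemma iterate_cauchy (alpha L : R) (n k : nat) (x : R) :
  0 <= x <= L ->
  Rabs (iterate alpha (n + k) x - iterate alpha n x) <= 2 * (1 / 2) ^ n * exp (rate alpha L * x).
Proof.
  intros Hx; set (e := exp (rate alpha L * x)).
  assert (He : 0 < e) by apply exp_pos.
  (* The exact geometric sum, rather than its bound, is what the induction on [k] reproduces. *)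
  apply Rle_trans with (2 * ((1 / 2) ^ n - (1 / 2) ^ (n + k)) * e).
  - induction k as [ | k IH].
    + rewrite Nat.add_0_r, Rminus_diag, Rabs_R0; lra.
    + rewrite Nat.add_succ_r.
      pose proof (iterate_step alpha L (n + k) x Hx) as H; fold e in H.
      replace (iterate alpha (S (n + k)) x - iterate alpha n x) with
        ((iterate alpha (S (n + k)) x - iterate alpha (n + k) x)
         + (iterate alpha (n + k) x - iterate alpha n x)) by ring.
      eapply Rle_trans; [apply Rabs_triang | ].
      replace ((1 / 2) ^ S (n + k)) with ((1 / 2) ^ (n + k) / 2) by (simpl; field); lra.
  - assert (0 <= (1 / 2) ^ (n + k)) by (apply pow_le; lra); nra.
Qed.

Lemma iterate_converges (alpha x : R) :
  0 <= x -> ex_finite_lim_seq (fun n => iterate alpha n x).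
Proof.
  intros Hx; apply ex_lim_seq_cauchy_corr; intros eps.
  set (e := exp (rate alpha x * x)); assert (He : 0 < e) by apply exp_pos.
  destruct (pow_lt_1_zero (1 / 2) ltac:(rewrite Rabs_right; lra) (eps / (4 * e))) as [N HN].
  { apply Rdiv_lt_0_compat; [apply cond_pos | lra]. }
  specialize (HN N (le_n N)); rewrite Rabs_right in HN by (apply Rle_ge, pow_le; lra).
  assert (HN' : 4 * e * (1 / 2) ^ N < eps).
  { apply (Rmult_lt_compat_l (4 * e)) in HN; [ | lra].
    replace (4 * e * (eps / (4 * e))) with (pos eps) in HN by (field; lra); easy. }
  exists N; intros n m Hn Hm.
  pose proof (iterate_cauchy alpha x N (n - N) x ltac:(lra)) as H1.
  pose proof (iterate_cauchy alpha x N (m - N) x ltac:(lra)) as H2.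
  fold e in H1, H2; rewrite Nat.add_comm, Nat.sub_add in H1, H2 by easy.
  apply Rabs_le_between in H1; apply Rabs_le_between in H2.
  apply Rabs_def1; lra.
Qed.

(** The constant continuation to the left of 0 makes the limit continuous on the whole line, as the
    derivative lemmas for [picard] require. *)
Definition limit_int (alpha x : R) : R := real (Lim_seq (fun n => iterate alpha n (Rmax 0 x))).

Lemma limit_int_close (alpha L x : R) (n : nat) :
  0 <= x <= L ->
  Rabs (limit_int alpha x - iterate alpha n x) <= 2 * (1 / 2) ^ n * exp (rate alpha L * x).
Proof.
  intros Hx; unfold limit_int; rewrite Rmax_right by lra.
  pose proof (Lim_seq_correct' _ (iterate_converges alpha x (proj1 Hx))) as Hl.
  set (l := real (Lim_seq (fun n => iterate alpha n x))) in *.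
  set (b := 2 * (1 / 2) ^ n * exp (rate alpha L * x)).
  assert (Hk : forall k, iterate alpha n x - b <= iterate alpha (k + n) x <= iterate alpha n x + b).
  { intros k; rewrite Nat.add_comm; pose proof (iterate_cauchy alpha L n k x Hx) as H.
    fold b in H; apply Rabs_le_between in H; lra. }
  apply (is_lim_seq_incr_n _ n) in Hl.
  apply Rabs_le_between; split.
  - cut (iterate alpha n x - b <= l); [lra | ].
    apply (is_lim_seq_le (fun _ => iterate alpha n x - b) (fun k => iterate alpha (k + n) x)
      (iterate alpha n x - b) l); [apply Hk | apply is_lim_seq_const | easy].
  - cut (l <= iterate alpha n x + b); [lra | ].
    apply (is_lim_seq_le (fun k => iterate alpha (k + n) x) (fun _ => iterate alpha n x + b)
      l (iterate alpha n x + b)); [apply Hk | easy | apply is_lim_seq_const].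
Qed.

Lemma limit_int_ge (alpha x : R) : 0 <= x -> alpha * x <= limit_int alpha x.
Proof.
  intros Hx; cut (alpha * x - limit_int alpha x <= 0); [lra | ].
  apply (half_pow_small _ (2 * exp (rate alpha x * x))).
  - pose proof (exp_pos (rate alpha x * x)); lra.
  - intros n; pose proof (limit_int_close alpha x x n ltac:(lra)) as H.
    apply Rabs_le_between in H; pose proof (iterate_ge alpha n x Hx); lra.
Qed.

Lemma continuous_Rmax_0 (x : R) : continuous (Rmax 0) x.
Proof.
  apply filterlim_locally; intros eps; exists eps; intros y Hy.
  change (Rabs (y - x) < eps) in Hy; change (Rabs (Rmax 0 y - Rmax 0 x) < eps).
  apply Rabs_def2 in Hy; pose proof (cond_pos eps).
  unfold Rmax; destruct (Rle_dec 0 y), (Rle_dec 0 x); apply Rabs_def1; lra.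
Qed.

(** The iterates converge uniformly on [0, Rabs x + 1]: one third of eps goes to a fixed iterate and
    one to each of the two approximations. *)
Lemma continuous_limit_int (alpha x : R) : continuous (limit_int alpha) x.
Proof.
  apply filterlim_locally; intros eps.
  set (L := Rabs x + 1); pose proof (Rabs_pos x) as Hax.
  set (w := 2 * exp (rate alpha L * L)).
  assert (Hw : 0 < w) by (unfold w; pose proof (exp_pos (rate alpha L * L)); lra).
  destruct (pow_lt_1_zero (1 / 2) ltac:(rewrite Rabs_right; lra) (eps / 3 / w)) as [N HN].
  { apply Rdiv_lt_0_compat; [apply Rdiv_lt_0_compat; [apply cond_pos | lra] | lra]. }
  specialize (HN N (le_n N)); rewrite Rabs_right in HN by (apply Rle_ge, pow_le; lra).
  assert (HN' : w * (1 / 2) ^ N < eps / 3).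
  { apply (Rmult_lt_compat_l w) in HN; [ | lra].
    replace (w * (eps / 3 / w)) with (eps / 3) in HN by (field; lra); easy. }
  assert (Hu : forall y, Rmax 0 y <= L -> Rabs (limit_int alpha y - iterate alpha N (Rmax 0 y)) < eps / 3).
  { intros y Hy; pose proof (Rmax_l 0 y).
    replace (limit_int alpha y) with (limit_int alpha (Rmax 0 y))
      by (unfold limit_int; rewrite (Rmax_right 0 (Rmax 0 y)) by easy; easy).
    eapply Rle_lt_trans; [apply (limit_int_close alpha L); lra | ].
    eapply Rle_lt_trans; [ | exact HN'].
    unfold w; rewrite Rmult_assoc, (Rmult_comm _ (exp _)), <- Rmult_assoc.
    apply Rmult_le_compat_r; [apply pow_le; lra | ].
    apply Rmult_le_compat_l; [lra | ].
    pose proof (rate_ge alpha L ltac:(unfold L; lra)).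
    destruct (Req_dec (Rmax 0 y) L) as [-> | Hne]; [lra | ].
    left; apply exp_increasing, Rmult_lt_compat_l; lra. }
  assert (Hc : continuous (fun y => iterate alpha N (Rmax 0 y)) x).
  { apply continuous_comp; [apply continuous_Rmax_0 | apply continuous_iterate]. }
  unfold continuous in Hc; rewrite filterlim_locally in Hc.
  assert (He3 : 0 < eps / 3) by (apply Rdiv_lt_0_compat; [apply cond_pos | lra]).
  generalize (filter_and _ _ (Hc (mkposreal _ He3)) (locally_ball x (mkposreal 1 Rlt_0_1))).
  apply (filter_imp (F := locally x)); intros y [H1 H2].
  change (Rabs (iterate alpha N (Rmax 0 y) - iterate alpha N (Rmax 0 x)) < eps / 3) in H1.
  change (Rabs (y - x) < 1) in H2.
  change (Rabs (limit_int alpha y - limit_int alpha x) < eps).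
  assert (Hx : Rmax 0 x <= L) by (apply Rmax_lub; unfold L; [lra | pose proof (Rle_abs x); lra]).
  assert (Hy : Rmax 0 y <= L).
  { apply Rmax_lub; unfold L; [lra | ].
    apply Rabs_def2 in H2; pose proof (Rle_abs x); lra. }
  pose proof (Hu x Hx) as Ux; pose proof (Hu y Hy) as Uy.
  apply Rabs_def2 in H1; apply Rabs_def2 in Ux; apply Rabs_def2 in Uy.
  apply Rabs_def1; lra.
Qed.

(** The map halves the distance between the limit and iterate n, so the image of the limit and the
    limit itself are both within O(2^-n) of iterate n + 1. *)
Lemma limit_int_fixpoint (alpha x : R) :
  0 <= x -> picard alpha (limit_int alpha) x = limit_int alpha x.
Proof.
  intros Hx; apply Rminus_diag_uniq, Rabs_eq_0, Rle_antisym; [ | apply Rabs_pos].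
  set (e := exp (rate alpha x * x)); assert (He : 0 < e) by apply exp_pos.
  apply (half_pow_small _ (2 * e)); [lra | ].
  intros n.
  assert (Hp : 0 <= (1 / 2) ^ n) by (apply pow_le; lra).
  pose proof (picard_map_contraction alpha x (2 * (1 / 2) ^ n) (limit_int alpha) (iterate alpha n)
    Hx ltac:(lra) (continuous_limit_int alpha) (continuous_iterate alpha n)
    (limit_int_ge alpha) (iterate_ge alpha n)
    (fun y Hy => limit_int_close alpha x y n Hy) x ltac:(lra)) as H1.
  pose proof (limit_int_close alpha x x (S n) ltac:(lra)) as H2; simpl iterate in H2.
  replace ((1 / 2) ^ S n) with ((1 / 2) ^ n / 2) in H2 by (simpl; field).
  fold e in H1, H2; apply Rabs_le_between in H1; apply Rabs_le_between in H2.
  apply Rabs_le_between; lra.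
Qed.

Lemma smooth_solution_exists (alpha : R) : exists f f1 f2, smooth_solution alpha f f1 f2.
Proof.
  set (I := limit_int alpha).
  pose proof (continuous_limit_int alpha) as CI; fold I in CI.
  exists (picard1 alpha I), (picard2 I), (fun x => exp (- I x)).
  destruct (picard_0 alpha I) as (I0 & I1 & I2).
  refine (conj _ (conj _ (conj _ (conj _ (conj I1 (conj I2 _)))))).
  - apply is_derive_picard1, CI.
  - apply is_derive_picard2, CI.
  - apply continuous_exp_opp_fun, CI.
  - intros x Hx.
    assert (HI : is_derive I x (picard1 alpha I x)).
    { apply (is_derive_ext_loc (picard alpha I)); [ | apply is_derive_picard; exact CI].
      generalize (locally_interval (fun y => 0 < y) x 0 p_infty Hx Logic.I (fun y Hy _ => Hy)).
      apply (filter_imp (F := locally x)); intros y Hy; apply limit_int_fixpoint; lra. }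
    pose proof (is_derive_opp _ _ _ HI) as Ho.
    pose proof (is_derive_comp exp (fun y => opp (I y)) x _ _ (is_derive_exp _) Ho) as He.
    apply (is_derive_congr _ _ _ _ _ He); [easy | ].
    unfold scal, opp; simpl; unfold mult; simpl; ring.
  - unfold I; rewrite <- limit_int_fixpoint by lra; fold I; rewrite I0, Ropp_0; apply exp_0.
Qed.

Lemma solution_exists_unique (alpha : R) :
  exists F, is_solution alpha F /\
    forall G, is_solution alpha G -> forall x, 0 <= x -> G x = F x.
Proof.
  destruct (smooth_solution_exists alpha) as (f & f1 & f2 & S).
  exists f; split; [exact (smooth_solution_is_solution _ _ _ _ S) | ].
  intros G HG x Hx; destruct (solution_extension _ _ HG) as (g & g1 & g2 & Sg & E).
  rewrite <- E by easy; apply (smooth_solution_unique alpha g g1 g2 f f1 f2); easy.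
Qed.

(** * Certified bounds for polynomials on boxes *)

Section Polynomials.

Context {A : Type} (add : A -> A -> A) (mul : A -> A -> A) (nil0 : A).

Fixpoint padd (l m : list A) : list A :=
  match l, m with
  | [], _ => m
  | _, [] => l
  | a :: l', b :: m' => add a b :: padd l' m'
  end.

Fixpoint pmul (l m : list A) : list A :=
  match l with
  | [] => []
  | a :: l' => padd (map (mul a) m) (nil0 :: pmul l' m)
  end.

Fixpoint pder (l : list A) : list A :=
  match l with
  | [] => []
  | a :: l' => padd l' (nil0 :: pder l')
  end.

(* Coefficients of p(1 + x). *)
Fixpoint pshift (l : list A) : list A :=
  match l with
  | [] => []
  | a :: l' => let s := pshift l' in padd (a :: s) s
  end.

(* The coefficients of (1 + v)^n p(1 / (1 + v)) are, up to positive factors, the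
   Bernstein coefficients of p on [0, 1]. *)
Definition bernstein_all (P : A -> bool) (l : list A) : bool :=
  P (hd nil0 l) && forallb P (pshift (rev l)).

Context (ev : A -> R).

Fixpoint peval (l : list A) (x : R) : R :=
  match l with
  | [] => 0
  | a :: l' => ev a + x * peval l' x
  end.

Context (ev_add : forall a b, ev (add a b) = ev a + ev b)
        (ev_mul : forall a b, ev (mul a b) = ev a * ev b)
        (ev_zero : ev nil0 = 0).

Lemma peval_padd (l m : list A) (x : R) :
  peval (padd l m) x = peval l x + peval m x.
Proof.
  revert m; induction l as [ | a l IH]; intros [ | b m]; simpl; try ring.
  rewrite IH, ev_add; ring.
Qed.

Lemma peval_map (f : A -> A) (k : R) (l : list A) (x : R) :
  (forall a, ev (f a) = k * ev a) -> peval (map f l) x = k * peval l x.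
Proof.
  intros Hf; induction l as [ | a l IH]; simpl; [ring | ].
  rewrite IH, Hf; ring.
Qed.

Lemma peval_pmul (l m : list A) (x : R) :
  peval (pmul l m) x = peval l x * peval m x.
Proof.
  induction l as [ | a l IH]; simpl; [ring | ].
  rewrite peval_padd, (peval_map _ (ev a)) by (intros; apply ev_mul); simpl.
  rewrite IH, ev_zero; ring.
Qed.

Lemma is_derive_peval (l : list A) (x : R) :
  is_derive (peval l) x (peval (pder l) x).
Proof.
  induction l as [ | a l IH]; simpl; [apply (is_derive_const (V := R_NormedModule)) | ].
  rewrite peval_padd; simpl; rewrite ev_zero.
  evar_last.
  - apply (is_derive_plus (V := R_NormedModule)); [apply (is_derive_const (V := R_NormedModule)) | ].
    apply (is_derive_mult (fun y => y) (peval l) x); [apply (is_derive_id (K := R_AbsRing)) | exact IH | ].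
    intros; apply Rmult_comm.
  - unfold plus, mult, zero, one; simpl; unfold plus, mult, one; simpl; ring.
Qed.

Lemma peval_pshift (l : list A) (x : R) : peval (pshift l) x = peval l (1 + x).
Proof.
  induction l as [ | a l IH]; [easy | ].
  change (peval (padd (a :: pshift l) (pshift l)) x = ev a + (1 + x) * peval l (1 + x)).
  rewrite peval_padd; simpl; rewrite IH; ring.
Qed.

Lemma peval_app (l m : list A) (x : R) :
  peval (l ++ m) x = peval l x + x ^ length l * peval m x.
Proof. induction l as [ | a l IH]; simpl; [ | rewrite IH]; ring. Qed.

(** The exponent is the length of [l], one more than the formal degree, whence the factor [x] on the
    right. *)
Lemma peval_rev (l : list A) (x : R) :
  x <> 0 -> peval (rev l) (/ x) * x ^ length l = x * peval l x.
Proof.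
  intros Hx; induction l as [ | a l IH]; simpl; [ring | ].
  rewrite peval_app, length_rev; simpl.
  replace ((peval (rev l) (/ x) + (/ x) ^ length l * (ev a + / x * 0)) * (x * x ^ length l))
    with (x * (peval (rev l) (/ x) * x ^ length l) + x * ev a * ((/ x) ^ length l * x ^ length l)) by ring.
  rewrite IH, <- Rpow_mult_distr, Rinv_l, pow1 by easy; ring.
Qed.

Lemma peval_nonneg (P : A -> bool) (l : list A) (x : R) :
  (forall a, P a = true -> 0 <= ev a) -> forallb P l = true -> 0 <= x -> 0 <= peval l x.
Proof.
  intros HP Hl Hx; induction l as [ | a l IH]; simpl in *; [lra | ].
  apply andb_prop in Hl; destruct Hl as [Ha Hl].
  apply Rplus_le_le_0_compat; [auto | apply Rmult_le_pos; auto].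
Qed.

(** With x = 1 / (1 + v), positivity on (0, 1] becomes positivity of the shifted reversed polynomial
    for v >= 0, which nonnegative coefficients ensure. The point 0 corresponds to v = oo and is
    covered by the constant coefficient. *)
Lemma bernstein_all_nonneg (P : A -> bool) (l : list A) (x : R) :
  (forall a, P a = true -> 0 <= ev a) -> bernstein_all P l = true ->
  0 <= x <= 1 -> 0 <= peval l x.
Proof.
  intros HP Hl Hx; apply andb_prop in Hl; destruct Hl as [Hh Hl].
  destruct (Req_dec x 0) as [-> | Hx0].
  - apply HP in Hh; destruct l as [ | a l]; simpl in *; lra.
  - assert (Hv : 0 <= / x - 1).
    { assert (1 <= / x); [ | lra].
      rewrite <- Rinv_1; apply Rinv_le_contravar; lra. }
    pose proof (peval_nonneg P _ _ HP Hl Hv) as H.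
    rewrite peval_pshift in H; replace (1 + (/ x - 1)) with (/ x) in H by ring.
    pose proof (peval_rev l x Hx0) as E.
    assert (Hpow : 0 < x ^ length l) by (apply pow_lt; lra).
    assert (0 <= x * peval l x) by (rewrite <- E; apply Rmult_le_pos; lra).
    apply Rmult_le_reg_l with x; lra.
Qed.

End Polynomials.

(* Row i, column j: the coefficient of y^i beta^j in alpha + x^2 / 2 + x^3 P(y; beta), with
   x = 5 y / 2 and alpha = (6 beta - 3) / 50, times 25 * 2^32 and rounded to an integer. *)
Definition Phi_coefs : list (list Z) :=
  [[-6442450944; 12884901888; 0; 0; 0; 0];
   [0; 0; 0; 0; 0; 0];
   [335544320000; 0; 0; 0; 0; 0];
   [16777284041; -33554295670; -1909065; 5978942; -7309604; 3061552];
   [622083549; -2522712106; 2640675611; -397495502; 492552925; -208519751];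
   [-87169595709; -87677392; -1830442637; 6668524831; -8614307398; 3701452375];
   [-13493745373; 22739168304; 15535467556; -54728351293; 71317331095; -31352277434];
   [19541517323; -10329687716; -62872249731; 239507608122; -330022187193; 150671811155];
   [-59311645214; 87878159763; 95815867494; -571185636429; 889310081133; -435946962914];
   [371909913889; -359375675534; 133207651591; 501405425610; -1253087289377; 736978864313];
   [-892878099461; 876211011560; -1028128498645; 1102332503642; 118403028435; -533421288829];
   [1526538217815; -1521036616248; 2485796643667; -4379985751559; 3021987108033; -498766595209];
   [-1886580671524; 1793127252123; -3456140231232; 7073133773857; -6069020552876; 1696234274318];
   [1539970630642; -1375110164207; 3018044942010; -6681180105572; 6224147229370; -1970034260781];
   [-775976862228; 657974167524; -1643418148449; 3829299835918; -3726595282595; 1248231237678];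
   [219129534616; -179477065584; 512748581479; -1239510753202; 1239596603879; -428993826867];
   [-26646056550; 21446216707; -70260600977; 174594869522; -177905378096; 62902635255]]%Z.
Definition Zadd2 := padd Z.add.
Definition Zmul2 := pmul Z.add Z.mul 0%Z.
Definition Dscale : Z := (25 * 2 ^ 32)%Z.

Definition nonneg01 : list Z -> bool := bernstein_all Z.add 0%Z (Z.leb 0).
(** A tensor-product test: Bernstein in y, with coefficients that are polynomials in beta and are
    themselves judged by the Bernstein test. *)
Definition nonneg01_2 : list (list Z) -> bool := bernstein_all Zadd2 [] nonneg01.

Definition Phi2_coefs := pder Zadd2 [] (pder Zadd2 [] Phi_coefs).
Definition Phi3_coefs := pder Zadd2 [] Phi2_coefs.

(** In the variable y = 2 x / 5, with D = [Dscale], the terms Phi''' and Phi Phi'' carry the factors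
    8 / (125 D) and 4 / (25 D^2). Taking out 4 / (125 D^2) leaves the multipliers 2 D and 5. *)
Definition residual_coefs : list (list Z) :=
  padd Zadd2 (map (map (Z.mul (2 * Dscale))) Phi3_coefs)
    (pmul Zadd2 Zmul2 [] (map (map (Z.mul 5)) Phi_coefs) Phi2_coefs).

(* For c = 1, n = length l and p the polynomial of l: the coefficients of k^(n-1) p(x / k), and k^n. *)
Fixpoint rescale (k : Z) (c : Z) (l : list (list Z)) : list (list Z) * Z :=
  match l with
  | [] => ([], c)
  | r :: l' => let '(m, d) := rescale k c l' in (map (Z.mul d) r :: m, (k * d)%Z)
  end.

Definition within01_2 (B : Z) (l : list (list Z)) : bool :=
  nonneg01_2 (padd Zadd2 [[B]] l) && nonneg01_2 (padd Zadd2 [[B]] (map (map Z.opp) l)).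

(** Successive shifts by 1 bring the intervals [n, n + 1] to [0, 1]. After [rescale 5] these
    intervals are the strips of length 1/2 in x. *)
Fixpoint boxes_within (Bs : list Z) (l : list (list Z)) : bool :=
  match Bs with
  | [] => true
  | B :: Bs' => within01_2 B l && boxes_within Bs' (pshift Zadd2 l)
  end.

Definition eval1 (b : R) (r : list Z) : R := peval IZR r b.
Definition eval2 (l : list (list Z)) (y b : R) : R := peval (eval1 b) l y.

Lemma eval1_add (b : R) (r s : list Z) : eval1 b (Zadd2 r s) = eval1 b r + eval1 b s.
Proof. apply peval_padd, plus_IZR. Qed.

Lemma eval1_mul (b : R) (r s : list Z) : eval1 b (Zmul2 r s) = eval1 b r * eval1 b s.
Proof. apply peval_pmul; [apply plus_IZR | apply mult_IZR | easy]. Qed.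

Lemma eval1_scal (b : R) (k : Z) (r : list Z) : eval1 b (map (Z.mul k) r) = IZR k * eval1 b r.
Proof. apply peval_map, mult_IZR. Qed.

Lemma eval2_scal (k : Z) (l : list (list Z)) (y b : R) :
  eval2 (map (map (Z.mul k)) l) y b = IZR k * eval2 l y b.
Proof. apply peval_map; intros; apply eval1_scal. Qed.

Lemma nonneg01_2_correct (l : list (list Z)) (y b : R) :
  nonneg01_2 l = true -> 0 <= y <= 1 -> 0 <= b <= 1 -> 0 <= eval2 l y b.
Proof.
  intros Hl Hy Hb.
  apply (bernstein_all_nonneg Zadd2 [] (eval1 b) (eval1_add b) nonneg01); auto.
  intros r Hr; apply (bernstein_all_nonneg Z.add 0%Z IZR plus_IZR (Z.leb 0)); auto.
  intros z Hz; apply IZR_le, Z.leb_le, Hz.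
Qed.

Lemma within01_2_correct (B : Z) (l : list (list Z)) (y b : R) :
  within01_2 B l = true -> 0 <= y <= 1 -> 0 <= b <= 1 -> Rabs (eval2 l y b) <= IZR B.
Proof.
  intros Hl Hy Hb; apply andb_prop in Hl; destruct Hl as [H1 H2].
  apply (nonneg01_2_correct _ y b) in H1; [ | easy | easy].
  apply (nonneg01_2_correct _ y b) in H2; [ | easy | easy].
  unfold eval2 in *; rewrite peval_padd in H1, H2 by apply eval1_add.
  rewrite (peval_map _ _ (-1)) in H2.
  - unfold eval1 in *; simpl in H1, H2; apply Rabs_le; lra.
  - intros r; unfold eval1; rewrite (peval_map IZR Z.opp (-1)); [easy | ].
    intros z; rewrite opp_IZR; ring.
Qed.

(** The extra factor k on the left turns the power k^(n-1) into k^n, so that the induction can start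
    at the empty list. *)
Lemma rescale_correct (k : Z) (l : list (list Z)) (x b : R) :
  IZR k * eval2 (fst (rescale k 1 l)) (IZR k * x) b = IZR (snd (rescale k 1 l)) * eval2 l x b.
Proof.
  induction l as [ | r l IH]; [unfold eval2; simpl; ring | ].
  simpl; destruct (rescale k 1 l) as [m d]; unfold eval2 in *; simpl in *.
  rewrite eval1_scal, mult_IZR.
  transitivity (IZR k * IZR d * eval1 b r + IZR k * x * (IZR k * peval (eval1 b) m (IZR k * x)));
    [ring | rewrite IH; ring].
Qed.

Lemma boxes_within_correct (Bs : list Z) (l : list (list Z)) (y b : R) (n : nat) :
  boxes_within Bs l = true -> (n < length Bs)%nat ->
  INR n <= y <= INR n + 1 -> 0 <= b <= 1 -> Rabs (eval2 l y b) <= IZR (nth n Bs 0%Z).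
Proof.
  revert l y n; induction Bs as [ | B Bs IH]; intros l y n Hl Hn Hy Hb; simpl in Hn; [lia | ].
  apply andb_prop in Hl; destruct Hl as [H1 H2]; destruct n as [ | n].
  - simpl in *; apply within01_2_correct; auto; lra.
  - rewrite S_INR in Hy.
    replace (eval2 l y b) with (eval2 (pshift Zadd2 l) (y - 1) b).
    + simpl; apply IH; auto; [lia | lra].
    + unfold eval2; rewrite peval_pshift by apply eval1_add; f_equal; ring.
Qed.

Lemma Dscale_eq : IZR Dscale = 107374182400.
Proof. reflexivity. Qed.

Definition y_of (x : R) : R := 2 / 5 * x.
Definition beta_of (alpha : R) : R := 25 / 3 * alpha + 1 / 2.

Definition Fhat (alpha x : R) : R := eval2 Phi_coefs (y_of x) (beta_of alpha) / IZR Dscale.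
Definition Fhat1 (alpha x : R) : R :=
  2 / 5 * (eval2 (pder Zadd2 [] Phi_coefs) (y_of x) (beta_of alpha) / IZR Dscale).
Definition Fhat2 (alpha x : R) : R :=
  4 / 25 * (eval2 Phi2_coefs (y_of x) (beta_of alpha) / IZR Dscale).
Definition Fhat3 (alpha x : R) : R :=
  8 / 125 * (eval2 Phi3_coefs (y_of x) (beta_of alpha) / IZR Dscale).

Lemma is_derive_eval2_scaled (l : list (list Z)) (b k d x : R) :
  is_derive (fun x => k * (eval2 l (y_of x) b / d)) x
    (k * (2 / 5 * (eval2 (pder Zadd2 [] l) (y_of x) b / d))).
Proof.
  pose proof (is_derive_peval Zadd2 [] (eval1 b) (eval1_add b) eq_refl l (y_of x)) as H.
  assert (Hy : is_derive y_of x (2 / 5)) by (unfold y_of; auto_derive; [easy | ring]).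
  pose proof (is_derive_comp _ _ _ _ _ H Hy) as Hc.
  pose proof (is_derive_scal _ _ (k / d) _ Hc) as Hs.
  apply (is_derive_congr _ _ _ _ _ Hs).
  - intros t; unfold eval2, scal; simpl; unfold mult; simpl; unfold Rdiv; ring.
  - unfold eval2, scal; simpl; unfold mult; simpl; unfold Rdiv; ring.
Qed.

Lemma is_derive_Fhat (alpha x : R) : is_derive (Fhat alpha) x (Fhat1 alpha x).
Proof.
  pose proof (is_derive_eval2_scaled Phi_coefs (beta_of alpha) 1 (IZR Dscale) x) as H.
  rewrite Rmult_1_l in H; revert H; apply is_derive_ext; intros t; apply Rmult_1_l.
Qed.

Lemma is_derive_Fhat1 (alpha x : R) : is_derive (Fhat1 alpha) x (Fhat2 alpha x).
Proof.
  evar_last; [apply is_derive_eval2_scaled | ].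
  unfold Fhat2, Phi2_coefs, Rdiv; field; rewrite Dscale_eq; lra.
Qed.

Lemma is_derive_Fhat2 (alpha x : R) : is_derive (Fhat2 alpha) x (Fhat3 alpha x).
Proof.
  evar_last; [apply is_derive_eval2_scaled | ].
  unfold Fhat3, Phi3_coefs, Rdiv; field; rewrite Dscale_eq; lra.
Qed.

(* In units of 1e-8 and 1e-2, one entry for each x-interval [n/2, (n+1)/2]. *)
Definition residual_bounds : list Z := [55; 35; 101; 130; 290]%Z.
Definition second_bounds : list Z := [102; 102; 95; 65; 33]%Z.

(** The residual is 4 / (125 D^2) times the value of [residual_coefs], and rescaling multiplies that
    by 5^32, one power less than the length 33 of the list. For Phi'' the factors are 4 / (25 D) and
    5^16, as [pder] keeps the length 17. Both divisions are exact. *)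
Definition scaled_residual_bounds : list Z :=
  map (fun r => (r * (Dscale ^ 2 * 5 ^ 32 * 125 / (4 * 10 ^ 8)))%Z) residual_bounds.
Definition scaled_second_bounds : list Z :=
  map (fun r => (r * (Dscale * 5 ^ 16 * 25 / (4 * 10 ^ 2)))%Z) second_bounds.

Lemma residual_check :
  boxes_within scaled_residual_bounds (fst (rescale 5 1 residual_coefs)) = true.
Proof. vm_cast_no_check (eq_refl true). Qed.

Lemma second_check :
  boxes_within scaled_second_bounds (fst (rescale 5 1 Phi2_coefs)) = true.
Proof. vm_cast_no_check (eq_refl true). Qed.

Lemma snd_rescale (k c : Z) (l : list (list Z)) :
  snd (rescale k c l) = (k ^ Z.of_nat (length l) * c)%Z.
Proof.
  induction l as [ | r l IH]; simpl length; [change (c = 1 * c)%Z; ring | ].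
  simpl rescale; destruct (rescale k c l) as [m d]; simpl snd in *; subst d.
  rewrite Nat2Z.inj_succ, Z.pow_succ_r by lia; ring.
Qed.

Lemma length_residual : length residual_coefs = 33%nat.
Proof. vm_compute; reflexivity. Qed.

Lemma y_beta_range (alpha x : R) :
  alpha_range alpha -> inner_range x -> 0 <= y_of x <= 1 /\ 0 <= beta_of alpha <= 1.
Proof. unfold alpha_range, inner_range, y_of, beta_of; intros; lra. Qed.

Lemma box_bound (l : list (list Z)) (Bs : list Z) (alpha x : R) (n : nat) :
  boxes_within Bs (fst (rescale 5 1 l)) = true -> length Bs = 5%nat ->
  alpha_range alpha -> (n < 5)%nat -> INR n / 2 <= x <= INR n / 2 + 1 / 2 ->
  5 ^ length l * Rabs (eval2 l (y_of x) (beta_of alpha)) <= 5 * IZR (nth n Bs 0%Z).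
Proof.
  intros Hc HB Ha Hn Hx.
  assert (Hb : 0 <= beta_of alpha <= 1) by (unfold beta_of, alpha_range in *; lra).
  pose proof (boxes_within_correct _ _ (5 * y_of x) (beta_of alpha) n Hc ltac:(lia)
    ltac:(unfold y_of; lra) Hb) as H.
  pose proof (rescale_correct 5 l (y_of x) (beta_of alpha)) as E.
  rewrite snd_rescale, Z.mul_1_r, <- pow_IZR in E.
  replace (5 ^ length l * Rabs (eval2 l (y_of x) (beta_of alpha)))
    with (Rabs (5 ^ length l * eval2 l (y_of x) (beta_of alpha))).
  - rewrite <- E, Rabs_mult, (Rabs_right 5) by lra; lra.
  - rewrite Rabs_mult, (Rabs_right (5 ^ length l)); [easy | ].
    apply Rle_ge, pow_le; lra.
Qed.

Lemma Fhat_residual (alpha x : R) (n : nat) :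
  alpha_range alpha -> (n < 5)%nat -> INR n / 2 <= x <= INR n / 2 + 1 / 2 ->
  Rabs (Fhat3 alpha x + Fhat alpha x * Fhat2 alpha x)
    <= IZR (nth n residual_bounds 0%Z) / 10 ^ 8.
Proof.
  intros Ha Hn Hx.
  pose proof (box_bound _ _ _ _ _ residual_check eq_refl Ha Hn Hx) as H.
  rewrite length_residual in H.
  replace (Fhat3 alpha x + Fhat alpha x * Fhat2 alpha x) with
    (4 / (125 * IZR Dscale ^ 2) * eval2 residual_coefs (y_of x) (beta_of alpha)).
  - rewrite Rabs_mult, Rabs_right.
    + set (v := Rabs (eval2 _ _ _)) in *; clearbody v.
      do 5 (destruct n as [ | n]; [rewrite Dscale_eq; vm_compute nth in H; simpl nth; lra | ]); lia.
    + apply Rle_ge; rewrite Dscale_eq; lra.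
  - unfold Fhat, Fhat2, Fhat3, residual_coefs, eval2.
    rewrite peval_padd by apply eval1_add.
    rewrite peval_pmul by (apply eval1_add || apply eval1_mul || easy).
    fold (eval2 (map (map (Z.mul (2 * Dscale))) Phi3_coefs) (y_of x) (beta_of alpha)).
    fold (eval2 (map (map (Z.mul 5)) Phi_coefs) (y_of x) (beta_of alpha)).
    rewrite !eval2_scal, mult_IZR; unfold eval2; field; rewrite Dscale_eq; lra.
Qed.

Lemma Fhat2_bound (alpha x : R) (n : nat) :
  alpha_range alpha -> (n < 5)%nat -> INR n / 2 <= x <= INR n / 2 + 1 / 2 ->
  Rabs (Fhat2 alpha x) <= IZR (nth n second_bounds 0%Z) / 10 ^ 2.
Proof.
  intros Ha Hn Hx.
  pose proof (box_bound _ _ _ _ _ second_check eq_refl Ha Hn Hx) as H.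
  change (length Phi2_coefs) with 17%nat in H.
  unfold Fhat2; rewrite Rabs_mult, (Rabs_right (4 / 25)) by lra.
  unfold Rdiv at 2; rewrite Rabs_mult, (Rabs_right (/ IZR Dscale)).
  - set (v := Rabs (eval2 _ _ _)) in *; clearbody v.
    do 5 (destruct n as [ | n]; [rewrite Dscale_eq; vm_compute nth in H; simpl nth; lra | ]); lia.
  - apply Rle_ge; rewrite Dscale_eq; lra.
Qed.

(** * Comparison of the integer coefficients with P *)

(** Since x^3 = (125 / 8) y^3, row i of P lands in row i + 3 of [Phi_coefs]. Rows 0 to 2 are exact,
    which explains the three empty rows of [rounding_coefs]. *)
Definition rounding_error (i j : nat) : R :=
  125 / 8 * (p_coef i j / ((INR i + 1) * (INR i + 2) * (INR i + 3)))
  - IZR (nth j (nth (i + 3) Phi_coefs []) 0%Z) / IZR Dscale.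

Definition rounding_coefs : list (list R) :=
  [] :: [] :: [] :: map (fun i => map (rounding_error i) (seq 0 6)) (seq 0 14).

Definition Radd2 : list R -> list R -> list R := padd Rplus.
Definition evalR1 (b : R) (r : list R) : R := peval (fun c => c) r b.

Lemma evalR1_add (b : R) (r s : list R) : evalR1 b (Radd2 r s) = evalR1 b r + evalR1 b s.
Proof. apply peval_padd; easy. Qed.

Lemma rounding_error_bound (i j : nat) :
  (i < 14)%nat -> (j < 6)%nat -> Rabs (rounding_error i j) <= / IZR Dscale.
Proof.
  intros Hi Hj; unfold rounding_error; rewrite Dscale_eq, INR_IZR_INZ.
  do 14 (destruct i as [ | i];
    [ clear Hi; do 6 (destruct j as [ | j];
        [ unfold p_coef, p_rows; simpl; apply Rabs_le; lra | ]); lia | ]); lia.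
Qed.

Lemma sum_n_peval {A : Type} (ev : A -> R) (c : nat -> A) (n : nat) (x : R) :
  sum_n (fun i => ev (c i) * x ^ i) n = peval ev (map c (seq 0 (S n))) x.
Proof.
  induction n as [ | n IH].
  - rewrite sum_O; simpl; ring.
  - rewrite sum_Sn, IH, (seq_S (S n)), map_app, peval_app, length_map, length_seq.
    simpl; unfold plus; simpl; ring.
Qed.

(** The three polynomials are written as y^3 times double sums in i and j, apart from the common
    part alpha + x^2 / 2; there the identity holds term by term. *)
Lemma F0_inner_rounding (alpha x : R) :
  F0_inner alpha x
  = Fhat alpha x + peval (evalR1 (beta_of alpha)) rounding_coefs (y_of x).
Proof.
  set (b := beta_of alpha); set (y := y_of x).
  assert (EP : x ^ 3 * P (2 / 5 * x) (25 / 3 * alpha + 1 / 2)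
    = y ^ 3 * sum_n (fun i => (125 / 8 * sum_n (fun j =>
        p_coef i j / ((INR i + 1) * (INR i + 2) * (INR i + 3)) * b ^ j) 5) * y ^ i) 13).
  { fold (beta_of alpha) (y_of x); fold b y; unfold P.
    replace (x ^ 3) with (y ^ 3 * (125 / 8)) by (unfold y, y_of; field).
    rewrite Rmult_assoc; f_equal.
    rewrite <- (sum_n_mult_l (K := R_Ring)); apply sum_n_ext; intros i.
    transitivity (125 / 8 * (sum_n (fun j : nat =>
      p_coef i j / ((INR i + 1) * (INR i + 2) * (INR i + 3)) * b ^ j) 5 * y ^ i)); [ | unfold mult; simpl; eq_in_R; ring].
    rewrite <- (sum_n_mult_r (K := R_Ring)); reflexivity. }
  assert (ED : peval (evalR1 b) rounding_coefs y
    = y ^ 3 * sum_n (fun i => sum_n (fun j => rounding_error i j * b ^ j) 5 * y ^ i) 13).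
  { transitivity (y ^ 3 * peval (evalR1 b) (map (fun i => map (rounding_error i) (seq 0 6)) (seq 0 14)) y).
    - unfold rounding_coefs; set (q := map _ (seq 0 14)); cbn [peval]; unfold evalR1 at 1 2 3; cbn [peval]; ring.
    - f_equal; rewrite <- sum_n_peval; apply sum_n_ext; intros i; f_equal.
      unfold evalR1; rewrite <- (sum_n_peval (fun c => c)); easy. }
  assert (EF : Fhat alpha x = alpha + x ^ 2 / 2
    + y ^ 3 * sum_n (fun i => sum_n (fun j =>
        IZR (nth j (nth (i + 3) Phi_coefs []) 0%Z) / IZR Dscale * b ^ j) 5 * y ^ i) 13).
  { transitivity (alpha + x ^ 2 / 2 + / IZR Dscale * (y ^ 3 * peval (eval1 b) (map (fun i => map (fun j => nth j (nth (i + 3) Phi_coefs []) 0%Z) (seq 0 6)) (seq 0 14)) y)).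
    - change (map (fun i => map (fun j => nth j (nth (i + 3) Phi_coefs []) 0%Z) (seq 0 6)) (seq 0 14))
        with (tl (tl (tl Phi_coefs))).
      unfold Fhat; fold b y; unfold eval2.
      change Phi_coefs with (hd [] Phi_coefs :: hd [] (tl Phi_coefs) :: hd [] (tl (tl Phi_coefs))
        :: tl (tl (tl Phi_coefs))) at 1.
      set (q := tl (tl (tl Phi_coefs))).
      cbn [peval hd]; unfold eval1 at 1 2 3; simpl hd; cbn [peval].
      rewrite Dscale_eq; unfold b, beta_of, y, y_of; field.
    - rewrite <- sum_n_peval, <- Rmult_assoc, (Rmult_comm (/ IZR Dscale)), Rmult_assoc.
      f_equal; f_equal; rewrite <- (sum_n_mult_l (K := R_Ring)); apply sum_n_ext; intros i.
      unfold eval1; rewrite <- (sum_n_peval IZR).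
      unfold mult; simpl; rewrite <- Rmult_assoc; f_equal.
      rewrite <- (sum_n_mult_l (K := R_Ring)); apply sum_n_ext; intros j.
      unfold mult; simpl; unfold Rdiv; eq_in_R; ring. }
  unfold F0_inner; rewrite EP, ED, EF.
  rewrite (Rplus_assoc (alpha + x ^ 2 / 2)); f_equal.
  rewrite <- Rmult_plus_distr_l; f_equal.
  rewrite <- (sum_n_plus (G := R_AbelianGroup)); apply sum_n_ext; intros i.
  unfold plus; simpl; rewrite <- Rmult_plus_distr_r; f_equal.
  rewrite <- (sum_n_plus (G := R_AbelianGroup)).
  rewrite <- (sum_n_mult_l (K := R_Ring)); apply sum_n_ext; intros j.
  unfold plus, mult, rounding_error; simpl; eq_in_R; ring.
Qed.

Lemma peval_bound {A : Type} (ev : A -> R) (l : list A) (x e : R) :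
  0 <= x <= 1 -> (forall a, In a l -> Rabs (ev a) <= e) ->
  Rabs (peval ev l x) <= INR (length l) * e.
Proof.
  intros Hx; induction l as [ | a l IH]; intros Hl.
  - simpl; rewrite Rabs_R0; lra.
  - simpl length; rewrite S_INR; simpl peval.
    pose proof (Hl a (or_introl eq_refl)) as Ha.
    specialize (IH (fun c Hc => Hl c (or_intror Hc))).
    pose proof (Rabs_triang (ev a) (x * peval ev l x)) as T.
    rewrite Rabs_mult, (Rabs_right x) in T by lra.
    pose proof (Rabs_pos (peval ev l x)); nra.
Qed.

Lemma padd_bound {A : Type} (add : A -> A -> A) (ev : A -> R) (l m : list A) (d e : R) :
  (forall a b, ev (add a b) = ev a + ev b) -> 0 <= d -> 0 <= e ->
  (forall a, In a l -> Rabs (ev a) <= d) -> (forall a, In a m -> Rabs (ev a) <= e) ->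
  forall a, In a (padd add l m) -> Rabs (ev a) <= d + e.
Proof.
  intros Hadd Hd He; revert m; induction l as [ | b l IH]; intros [ | c m] Hl Hm a; simpl.
  - easy.
  - intros H; specialize (Hm a H); lra.
  - intros H; specialize (Hl a H); lra.
  - intros [<- | H].
    + rewrite Hadd; pose proof (Rabs_triang (ev b) (ev c)).
      specialize (Hl b (or_introl eq_refl)); specialize (Hm c (or_introl eq_refl)); lra.
    + apply (IH m); auto; intros; [apply Hl | apply Hm]; right; easy.
Qed.

(** For p = a + x q one has p' = q + x q', and each level of this recursion adds one copy of the
    bound. *)
Lemma pder_bound {A : Type} (add : A -> A -> A) (nil0 : A) (ev : A -> R) (l : list A) (e : R) :
  (forall a b, ev (add a b) = ev a + ev b) -> ev nil0 = 0 -> 0 <= e ->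
  (forall a, In a l -> Rabs (ev a) <= e) ->
  forall a, In a (pder add nil0 l) -> Rabs (ev a) <= INR (length l) * e.
Proof.
  intros Hadd H0 He; induction l as [ | b l IH]; intros Hl; [easy | ].
  simpl length; rewrite S_INR; simpl pder; intros a Ha.
  replace ((INR (length l) + 1) * e) with (e + INR (length l) * e) by ring.
  assert (0 <= INR (length l) * e) by (apply Rmult_le_pos; [apply pos_INR | easy]).
  refine (padd_bound add ev _ _ _ _ Hadd He H _ _ a Ha).
  - intros c Hc; apply Hl; right; easy.
  - intros c [<- | Hc]; [rewrite H0, Rabs_R0; easy | ].
    apply IH; auto; intros; apply Hl; right; easy.
Qed.

(** The k-th x-derivative of [F0_inner] minus Phi; each differentiation in y brings a factor 2/5. *)
Definition rounding (k : nat) (alpha x : R) : R :=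
  (2 / 5) ^ k * peval (evalR1 (beta_of alpha)) (Nat.iter k (pder Radd2 []) rounding_coefs) (y_of x).

Lemma is_derive_rounding (k : nat) (alpha x : R) :
  is_derive (rounding k alpha) x (rounding (S k) alpha x).
Proof.
  pose proof (is_derive_peval Radd2 [] (evalR1 (beta_of alpha)) (evalR1_add _) eq_refl
    (Nat.iter k (pder Radd2 []) rounding_coefs) (y_of x)) as H.
  assert (Hy : is_derive y_of x (2 / 5)) by (unfold y_of; auto_derive; [easy | ring]).
  pose proof (is_derive_scal _ _ ((2 / 5) ^ k) _ (is_derive_comp _ _ _ _ _ H Hy)) as Hs.
  apply (is_derive_congr _ _ _ _ _ Hs); [easy | ].
  unfold rounding, scal; simpl; unfold mult; simpl; ring.
Qed.

Lemma rounding_coefs_bound (alpha : R) (Ha : alpha_range alpha) (r : list R) :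
  In r rounding_coefs -> Rabs (evalR1 (beta_of alpha) r) <= 6 / IZR Dscale.
Proof.
  assert (Hb : 0 <= beta_of alpha <= 1) by (unfold beta_of, alpha_range in *; lra).
  assert (Hnil : Rabs (evalR1 (beta_of alpha) []) <= 6 / IZR Dscale).
  { unfold evalR1; simpl; rewrite Rabs_R0, Dscale_eq; lra. }
  intros [<- | [<- | [<- | H]]]; auto.
  apply in_map_iff in H; destruct H as [i [<- Hi]]; apply in_seq in Hi.
  apply Rle_trans with (INR (length (map (rounding_error i) (seq 0 6))) * / IZR Dscale).
  - apply peval_bound; [easy | ].
    intros c Hc; apply in_map_iff in Hc; destruct Hc as [j [<- Hj]]; apply in_seq in Hj.
    apply rounding_error_bound; lia.
  - rewrite length_map, length_seq; simpl; rewrite Dscale_eq; lra.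
Qed.

(** The second derivative is the worst: 17 rows of size at most 6 / D, a factor 17 from each of two
    uses of [pder_bound], and 4/25 give about 4.4e-8. *)
Lemma rounding_bound (alpha x : R) :
  alpha_range alpha -> inner_range x ->
  Rabs (rounding 0 alpha x) <= 5 / 10 ^ 8 /\ Rabs (rounding 1 alpha x) <= 5 / 10 ^ 8 /\
  Rabs (rounding 2 alpha x) <= 5 / 10 ^ 8.
Proof.
  intros Ha Hx; destruct (y_beta_range alpha x Ha Hx) as [Hy Hb].
  set (ev := evalR1 (beta_of alpha)).
  pose proof (rounding_coefs_bound alpha Ha) as B0; fold ev in B0.
  assert (L0 : length rounding_coefs = 17%nat) by reflexivity.
  assert (He : 0 <= 6 / IZR Dscale) by (rewrite Dscale_eq; lra).
  pose proof (pder_bound Radd2 [] ev rounding_coefs _ (evalR1_add _) eq_refl He B0) as B1.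
  rewrite L0 in B1; simpl INR in B1.
  assert (L1 : length (pder Radd2 [] rounding_coefs) = 17%nat) by reflexivity.
  assert (He1 : 0 <= (1 + 1 + 1 + 1 + 1 + 1 + 1 + 1 + 1 + 1 + 1 + 1 + 1 + 1 + 1 + 1 + 1) * (6 / IZR Dscale))
    by (rewrite Dscale_eq; lra).
  pose proof (pder_bound Radd2 [] ev _ _ (evalR1_add _) eq_refl He1 B1) as B2.
  rewrite L1 in B2; simpl INR in B2.
  assert (L2 : length (pder Radd2 [] (pder Radd2 [] rounding_coefs)) = 17%nat) by reflexivity.
  pose proof (peval_bound ev _ (y_of x) _ Hy B0) as P0.
  pose proof (peval_bound ev _ (y_of x) _ Hy B1) as P1.
  pose proof (peval_bound ev _ (y_of x) _ Hy B2) as P2.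
  rewrite L0 in P0; rewrite L1 in P1; rewrite L2 in P2; simpl INR in *; rewrite Dscale_eq in *.
  unfold rounding; fold ev; change (Nat.iter 0 (pder Radd2 []) rounding_coefs) with rounding_coefs.
  change (Nat.iter 1 (pder Radd2 []) rounding_coefs) with (pder Radd2 [] rounding_coefs).
  change (Nat.iter 2 (pder Radd2 []) rounding_coefs) with (pder Radd2 [] (pder Radd2 [] rounding_coefs)).
  rewrite !Rabs_mult, !(Rabs_right ((2 / 5) ^ _)) by (apply Rle_ge, pow_le; lra).
  set (v0 := Rabs (peval ev rounding_coefs _)) in *.
  set (v1 := Rabs (peval ev (pder Radd2 [] rounding_coefs) _)) in *.
  set (v2 := Rabs (peval ev (pder Radd2 [] (pder Radd2 [] rounding_coefs)) _)) in *.
  clearbody v0 v1 v2; clear - P0 P1 P2; repeat split; simpl; lra.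
Qed.

(** * Error on [0, 5/2] *)

Lemma abs_increment_le (f f' g g' : R -> R) (p q : R) :
  p <= q ->
  (forall x, p <= x <= q -> continuous f x) ->
  (forall x, is_derive g x (g' x)) ->
  (forall x, p < x < q -> is_derive f x (f' x)) ->
  (forall x, p < x < q -> Rabs (f' x) <= g' x) ->
  Rabs (f q) <= Rabs (f p) + (g q - g p).
Proof.
  intros Hpq Hc Hg Hf Hle.
  assert (Cg : forall x, p <= x <= q -> continuous g x)
    by (intros x _; apply (is_derive_continuous _ _ _ (Hg x))).
  assert (H1 : f q - f p <= g q - g p).
  { apply (derive_le_le f f' g g'); auto.
    intros x Hx; specialize (Hle x Hx); apply Rabs_le_between in Hle; lra. }
  assert (H2 : - f q - - f p <= g q - g p).
  { apply (derive_le_le (fun x => - f x) (fun x => - f' x) g g'); auto.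
    - intros x Hx; apply (continuous_opp (V := R_NormedModule)); auto.
    - intros x Hx; apply (is_derive_opp (V := R_NormedModule)); auto.
    - intros x Hx; specialize (Hle x Hx); apply Rabs_le_between in Hle; lra. }
  pose proof (Rle_abs (f p)); pose proof (Rle_abs (- f p)) as H3; rewrite Rabs_Ropp in H3.
  apply Rabs_le; lra.
Qed.

(** The integrating factor exp(phi), phi' = f, removes the term f u. The majorant w of |u| is
    propagated as exp(phi) w, so only the lower bound -mu of f enters. *)
Lemma linear_ode_bound (f u h : R -> R) (mu p q g : R) :
  p <= q -> 0 <= g -> 0 <= mu ->
  (forall x, continuous f x) ->
  (forall x, p <= x <= q -> continuous u x) ->
  (forall x, p < x < q -> is_derive u x (- f x * u x + h x)) ->
  (forall x, p < x < q -> - mu <= f x) ->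
  (forall x, p < x < q -> Rabs (h x) <= g) ->
  Rabs (u q) <= exp (mu * (q - p)) * (Rabs (u p) + g * (q - p)).
Proof.
  intros Hpq Hg Hmu Cf Cu Hu Hf Hh.
  set (phi := fun x => RInt f p x).
  assert (Hphi : forall x, is_derive phi x (f x)).
  { intros x; apply (is_derive_RInt f phi p x); [ | apply Cf].
    apply filter_forall; intros y; apply (RInt_correct (V := R_CompleteNormedModule)).
    apply (ex_RInt_continuous (V := R_CompleteNormedModule)); auto. }
  assert (Hphip : phi p = 0) by apply (RInt_point (V := R_CompleteNormedModule)).
  assert (Hexp : forall x, is_derive (fun x => exp (phi x)) x (f x * exp (phi x))).
  { intros x; apply (is_derive_comp exp phi); [apply is_derive_exp | apply Hphi]. }
  set (w := fun x => exp (mu * (x - p)) * (Rabs (u p) + g * (x - p))).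
  set (w' := fun x => mu * w x + exp (mu * (x - p)) * g).
  assert (Hw : forall x, is_derive w x (w' x))
    by (intros x; unfold w', w; generalize (Rabs (u p)); intros c; auto_derive; [easy | unfold Rminus; ring]).
  assert (Hprod : forall x, is_derive (fun x => exp (phi x) * w x) x
    (f x * exp (phi x) * w x + exp (phi x) * w' x)).
  { intros x; apply (is_derive_mult (fun x => exp (phi x)) w x _ _ (Hexp x) (Hw x) Rmult_comm). }
  assert (B : Rabs (exp (phi q) * u q) <= Rabs (exp (phi p) * u p)
    + (exp (phi q) * w q - exp (phi p) * w p)).
  { apply (abs_increment_le (fun x => exp (phi x) * u x) (fun x => exp (phi x) * h x)
      (fun x => exp (phi x) * w x) (fun x => f x * exp (phi x) * w x + exp (phi x) * w' x)); auto.
    - intros x Hx; apply (continuous_mult (K := R_AbsRing)); auto.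
      apply (is_derive_continuous _ _ _ (Hexp x)).
    - intros x Hx.
      pose proof (is_derive_mult _ _ _ _ _ (Hexp x) (Hu x Hx) Rmult_comm) as Hm.
      apply (is_derive_congr _ _ _ _ _ Hm); [easy | unfold plus, mult; simpl; ring].
    - intros x Hx; rewrite Rabs_mult, (Rabs_right (exp _)) by (left; apply exp_pos).
      pose proof (exp_pos (phi x)) as Hp; specialize (Hf x Hx); specialize (Hh x Hx).
      assert (Hw0 : 0 <= w x).
      { apply Rmult_le_pos; [left; apply exp_pos | ].
        pose proof (Rabs_pos (u p)); assert (0 <= g * (x - p)) by (apply Rmult_le_pos; lra); lra. }
      assert (1 <= exp (mu * (x - p))).
      { assert (0 <= mu * (x - p)) by (apply Rmult_le_pos; lra).
        pose proof (exp_ineq1_le (mu * (x - p))); lra. }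
      (* From f >= -mu, w >= 0 and exp(mu (x - p)) >= 1; this differential inequality is what makes
         w a majorant. *)
      assert (g <= f x * w x + w' x) by (unfold w'; nra).
      nra. }
  pose proof (exp_pos (phi q)) as Hq.
  assert (Ewp : w p = Rabs (u p)) by (unfold w; rewrite Rminus_diag, Rmult_0_r, exp_0; ring).
  rewrite Hphip, exp_0, !Rmult_1_l, Rabs_mult, (Rabs_right (exp (phi q))), Ewp in B by lra.
  fold (w q); apply Rmult_le_reg_l with (exp (phi q)); lra.
Qed.

(** 6/100 bounds -F, since F >= alpha >= -3/50, and 1/2 is the length of a strip; 1 / 0.97 <
    1.031. *)
Lemma exp_006_le (x : R) : 0 <= x <= 1 / 2 -> exp (6 / 100 * x) <= 1031 / 1000.
Proof.
  intros Hx; assert (H : exp (6 / 100 * x) <= / (1 - 6 / 100 * x)).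
  { rewrite <- (Rinv_inv (exp (6 / 100 * x))), <- exp_Ropp.
    apply Rinv_le_contravar; [lra | ].
    pose proof (exp_ineq1_le (- (6 / 100 * x))); lra. }
  eapply Rle_trans; [exact H | ].
  apply Rmult_le_reg_l with (1 - 6 / 100 * x); [lra | ].
  rewrite Rinv_r by lra; lra.
Qed.

Section Inner_error.

Context (alpha : R) (f f1 f2 : R -> R) (Hrange : alpha_range alpha)
  (S : smooth_solution alpha f f1 f2).

Let e0 x := f x - Fhat alpha x.
Let e1 x := f1 x - Fhat1 alpha x.
Let e2 x := f2 x - Fhat2 alpha x.
Let h x := - (Fhat3 alpha x + Fhat alpha x * Fhat2 alpha x) - Fhat2 alpha x * e0 x.

Lemma is_derive_e0 (x : R) : is_derive e0 x (e1 x).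
Proof. apply (is_derive_minus (V := R_NormedModule)); [apply S | apply is_derive_Fhat]. Qed.

Lemma is_derive_e1 (x : R) : is_derive e1 x (e2 x).
Proof. apply (is_derive_minus (V := R_NormedModule)); [apply S | apply is_derive_Fhat1]. Qed.

Lemma is_derive_e2 (x : R) : 0 < x -> is_derive e2 x (- f x * e2 x + h x).
Proof.
  intros Hx; destruct S as (_ & _ & _ & Hf2 & _).
  pose proof (is_derive_minus _ _ _ _ _ (Hf2 x Hx) (is_derive_Fhat2 alpha x)) as Hm.
  apply (is_derive_congr _ _ _ _ _ Hm); [easy | ].
  unfold h, e0, e2, minus, plus, opp; simpl; ring.
Qed.

Lemma continuous_e2 (x : R) : continuous e2 x.
Proof.
  destruct S as (_ & _ & Hc & _).
  apply (continuous_minus (V := R_NormedModule)); [apply Hc | ].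
  apply (is_derive_continuous _ _ _ (is_derive_Fhat2 alpha x)).
Qed.

Definition error_bounds (x U V W : R) : Prop :=
  Rabs (e2 x) <= U /\ Rabs (e1 x) <= V /\ Rabs (e0 x) <= W.

(* [m] bounds |e2| on the box: it satisfies the self-consistent inequality of the last
   hypothesis, so it dominates the maximum. *)
Lemma error_step (n : nat) (U V W m U' V' W' : R) :
  let r := IZR (nth n residual_bounds 0%Z) / 10 ^ 8 in
  let k := IZR (nth n second_bounds 0%Z) / 10 ^ 2 in
  let g := r + k * (W + V / 2 + m / 8) in
  (n < 5)%nat -> 0 <= r -> 0 <= k <= 2 -> 0 <= m ->
  error_bounds (INR n / 2) U V W ->
  1031 / 1000 * (U + g / 2) <= m ->
  m <= U' -> V + 1031 / 1000 * (U / 2 + g / 8) <= V' ->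
  W + V / 2 + 1031 / 1000 * (U / 8 + g / 48) <= W' ->
  forall x, INR n / 2 <= x <= INR n / 2 + 1 / 2 -> error_bounds x U' V' W'.
Proof.
  intros r k g Hn Hr Hk Hm0 (HU & HV & HW) Hm HU' HV' HW'.
  set (p := INR n / 2) in *; set (q := p + 1 / 2).
  assert (Hp : 0 <= p) by (unfold p; pose proof (pos_INR n); lra).
  assert (PU : 0 <= U) by (eapply Rle_trans; [apply Rabs_pos | exact HU]).
  assert (PV : 0 <= V) by (eapply Rle_trans; [apply Rabs_pos | exact HV]).
  assert (PW : 0 <= W) by (eapply Rle_trans; [apply Rabs_pos | exact HW]).
  destruct (continuity_ab_maj (fun y => Rabs (e2 y)) p q ltac:(unfold q; lra)) as [X [HX HXr]].
  { intros y _; apply continuity_pt_filterlim.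
    apply (continuous_comp e2 Rabs); [apply continuous_e2 | apply continuous_Rabs]. }
  cbv beta in HX; set (M := Rabs (e2 X)) in *; assert (PM : 0 <= M) by apply Rabs_pos.
  (* Two integrations of |e2| <= c over a length of at most 1/2. *)
  assert (H0 : forall c, (forall y, p <= y <= q -> Rabs (e2 y) <= c) -> forall x, p <= x <= q ->
    Rabs (e0 x) <= W + V / 2 + c / 8).
  { intros c Hc x Hx.
    assert (Pc : 0 <= c) by (eapply Rle_trans; [apply Rabs_pos | apply (Hc x Hx)]).
    assert (B : Rabs (e0 x) <= Rabs (e0 p) + (V * (x - p) + c * (x - p) ^ 2 / 2 - (V * (p - p) + c * (p - p) ^ 2 / 2))).
    { apply (abs_increment_le e0 e1 (fun x => V * (x - p) + c * (x - p) ^ 2 / 2) (fun x => V + c * (x - p)));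
        [lra | | | | ].
      - intros y _; apply (is_derive_continuous _ _ _ (is_derive_e0 y)).
      - intros y; auto_derive; [easy | field].
      - intros y _; apply is_derive_e0.
      - intros y Hy.
        assert (B : Rabs (e1 y) <= Rabs (e1 p) + (c * (y - p) - c * (p - p))).
        { apply (abs_increment_le e1 e2 (fun x => c * (x - p)) (fun _ => c)); [lra | | | | ].
          - intros v _; apply (is_derive_continuous _ _ _ (is_derive_e1 v)).
          - intros v; auto_derive; [easy | ring].
          - intros v _; apply is_derive_e1.
          - intros v Hv; apply Hc; lra. }
        lra. }
    assert (0 <= (x - p) <= 1 / 2) by (unfold q in Hx; lra).
    assert (V * (x - p) <= V / 2) by nra.
    assert (Hsq : (x - p) ^ 2 <= 1 / 4) by (simpl; nra).
    apply (Rmult_le_compat_l c) in Hsq; [lra | easy]. }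
  (* One turn of the loop: a bound c on |e2| over the strip bounds e0, hence the source [h], and
     Gronwall returns a new bound on |e2|. *)
  assert (H2 : forall c, 0 <= c -> (forall y, p <= y <= q -> Rabs (e2 y) <= c) -> forall x, p <= x <= q ->
    Rabs (e2 x) <= 1031 / 1000 * (U + (r + k * (W + V / 2 + c / 8)) * (x - p))).
  { intros c Pc Hc x Hx.
    set (gc := r + k * (W + V / 2 + c / 8)).
    assert (Pg : 0 <= gc).
    { assert (0 <= k * (W + V / 2 + c / 8)) by (apply Rmult_le_pos; lra); unfold gc; lra. }
    assert (B : Rabs (e2 x) <= exp (6 / 100 * (x - p)) * (Rabs (e2 p) + gc * (x - p))).
    { apply (linear_ode_bound f e2 h); [lra | easy | lra | | | | | ].
      - intros y; destruct S as (Hf & _); apply (is_derive_continuous _ _ _ (Hf y)).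
      - intros y _; apply continuous_e2.
      - intros y Hy; apply is_derive_e2; lra.
      - intros y Hy; destruct (smooth_solution_pos _ _ _ _ S y ltac:(lra)) as (_ & _ & Ha).
        unfold alpha_range in Hrange; lra.
      - intros y Hy; assert (Hy' : p <= y <= p + 1 / 2) by (unfold q in Hx; lra).
        pose proof (Fhat_residual alpha y n Hrange Hn Hy') as R1; fold r in R1.
        pose proof (Fhat2_bound alpha y n Hrange Hn Hy') as R2; fold k in R2.
        pose proof (H0 c Hc y ltac:(unfold q in *; lra)) as R3.
        unfold h, gc; eapply Rle_trans; [apply Rabs_triang | ].
        rewrite !Rabs_Ropp, Rabs_mult.
        apply Rplus_le_compat; [easy | ].
        apply Rmult_le_compat; auto using Rabs_pos. }
    eapply Rle_trans; [exact B | ].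
    assert (0 <= gc * (x - p)) by (apply Rmult_le_pos; lra).
    pose proof (Rabs_pos (e2 p)).
    apply Rmult_le_compat; [left; apply exp_pos | lra | | lra].
    apply exp_006_le; unfold q in Hx; lra. }
  (* The returned bound is affine in c with slope at most 1031 k / 16000 <= 1031 / 8000 < 1. As [M]
     does not exceed its own image while [m] is at least its image, M <= m. *)
  assert (HMm : M <= m).
  { pose proof (H2 M PM HX X HXr) as B; fold M in B.
    unfold q in HXr.
    assert (0 <= k * (W + V / 2 + M / 8)) by (apply Rmult_le_pos; lra).
    assert (B' : M <= 1031 / 1000 * (U + (r + k * (W + V / 2 + M / 8)) / 2)) by nra.
    unfold g in Hm; nra. }
  assert (Hm2 : forall y, p <= y <= q -> Rabs (e2 y) <= m) by (intros y Hy; specialize (HX y Hy); lra).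
  pose proof (H2 m Hm0 Hm2) as H2m; fold g in H2m.
  assert (Pg : 0 <= g).
  { assert (0 <= k * (W + V / 2 + m / 8)) by (apply Rmult_le_pos; lra); unfold g; lra. }
  assert (H1m : forall x, p <= x <= q ->
    Rabs (e1 x) <= V + 1031 / 1000 * (U * (x - p) + g * (x - p) ^ 2 / 2)).
  { intros x Hx.
    assert (B : Rabs (e1 x) <= Rabs (e1 p) + (1031 / 1000 * (U * (x - p) + g * (x - p) ^ 2 / 2)
      - 1031 / 1000 * (U * (p - p) + g * (p - p) ^ 2 / 2))).
    { apply (abs_increment_le e1 e2 (fun x => 1031 / 1000 * (U * (x - p) + g * (x - p) ^ 2 / 2))
        (fun x => 1031 / 1000 * (U + g * (x - p)))); [lra | | | | ].
      - intros v _; apply (is_derive_continuous _ _ _ (is_derive_e1 v)).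
      - intros v; auto_derive; [easy | field].
      - intros v _; apply is_derive_e1.
      - intros v Hv; apply H2m; lra. }
    lra. }
  intros x Hx; assert (Hd : 0 <= x - p <= 1 / 2) by (unfold q in *; lra).
  set (d := x - p) in *.
  assert (Hgd : 0 <= g * d <= g / 2) by (split; nra).
  assert (Hd2 : 0 <= d ^ 2 <= 1 / 4) by (simpl; split; nra).
  assert (Hd3 : 0 <= d ^ 3 <= 1 / 8) by (simpl in *; split; nra).
  repeat split.
  - specialize (Hm2 x Hx); lra.
  - specialize (H1m x Hx); fold d in H1m.
    assert (U * d <= U / 2) by nra.
    assert (g * d ^ 2 <= g * (1 / 4)) by (apply Rmult_le_compat_l; lra); lra.
  - assert (B : Rabs (e0 x) <= Rabs (e0 p)
      + (V * d + 1031 / 1000 * (U * d ^ 2 / 2 + g * d ^ 3 / 6)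
         - (V * (p - p) + 1031 / 1000 * (U * (p - p) ^ 2 / 2 + g * (p - p) ^ 3 / 6)))).
    { apply (abs_increment_le e0 e1
        (fun x => V * (x - p) + 1031 / 1000 * (U * (x - p) ^ 2 / 2 + g * (x - p) ^ 3 / 6))
        (fun x => V + 1031 / 1000 * (U * (x - p) + g * (x - p) ^ 2 / 2))); [lra | | | | ].
      - intros v _; apply (is_derive_continuous _ _ _ (is_derive_e0 v)).
      - intros v; auto_derive; [easy | field].
      - intros v _; apply is_derive_e0.
      - intros v Hv; apply H1m; lra. }
    assert (V * d <= V / 2) by nra.
    assert (U * d ^ 2 <= U * (1 / 4)) by (apply Rmult_le_compat_l; lra).
    assert (g * d ^ 3 <= g * (1 / 8)) by (apply Rmult_le_compat_l; lra).
    lra.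
Qed.

(** The coefficients of y^0, y^1 and y^2 in Phi are exact, so Phi has the initial values of F. *)
Lemma error_bounds_0 : error_bounds 0 0 0 0.
Proof.
  destruct S as (_ & _ & _ & _ & E0 & E1 & E2).
  unfold error_bounds, e0, e1, e2, Fhat, Fhat1, Fhat2, eval2, y_of; rewrite E0, E1, E2, Rmult_0_r.
  rewrite Dscale_eq.
  assert (H : forall l, peval (eval1 (beta_of alpha)) l 0 = eval1 (beta_of alpha) (hd [] l))
    by (intros [ | r l]; simpl; [easy | ring]).
  rewrite !H; repeat split;
    (match goal with |- Rabs ?a <= 0 => replace a with 0; [rewrite Rabs_R0; lra | ] end);
    unfold eval1; vm_compute hd; cbn [peval]; unfold beta_of; field.
Qed.

Lemma error_bounds_weaken (x U V W U' V' W' : R) :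
  U <= U' -> V <= V' -> W <= W' -> error_bounds x U V W -> error_bounds x U' V' W'.
Proof. unfold error_bounds; intros; lra. Qed.

Lemma inner_error (x : R) :
  inner_range x -> error_bounds x (4.4 / 10 ^ 6) (3.5 / 10 ^ 6) (2.3 / 10 ^ 6).
Proof.
  intros Hx; unfold inner_range in Hx.
  pose proof error_bounds_0 as B0.
  replace 0 with (INR 0 / 2) in B0 at 1 by (simpl; field).
  (* The last four numbers are m, U', V' and W', with m = U'. Each strip starts from the bounds at
     the right end of the previous one. *)
  pose proof (error_step 0 0 0 0 (306 / 10 ^ 9) (306 / 10 ^ 9) (78 / 10 ^ 9) (14 / 10 ^ 9)) as S0.
  simpl nth in S0; specialize (S0 ltac:(lia) ltac:(lra) ltac:(lra) ltac:(lra) B0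
    ltac:(lra) ltac:(lra) ltac:(lra) ltac:(lra)).
  pose proof (S0 (INR 1 / 2) ltac:(simpl; lra)) as B1.
  pose proof (fun a b c d => error_step 1 _ _ _ (563 / 10 ^ 9) (563 / 10 ^ 9) (300 / 10 ^ 9) (105 / 10 ^ 9) a b c d B1) as S1.
  simpl nth in S1; specialize (S1 ltac:(lia) ltac:(lra) ltac:(lra) ltac:(lra)
    ltac:(lra) ltac:(lra) ltac:(lra) ltac:(lra)).
  pose proof (S1 (INR 2 / 2) ltac:(simpl; lra)) as B2.
  pose proof (fun a b c d => error_step 2 _ _ _ (1310 / 10 ^ 9) (1310 / 10 ^ 9) (776 / 10 ^ 9) (360 / 10 ^ 9) a b c d B2) as S2.
  simpl nth in S2; specialize (S2 ltac:(lia) ltac:(lra) ltac:(lra) ltac:(lra)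
    ltac:(lra) ltac:(lra) ltac:(lra) ltac:(lra)).
  pose proof (S2 (INR 3 / 2) ltac:(simpl; lra)) as B3.
  pose proof (fun a b c d => error_step 3 _ _ _ (2380 / 10 ^ 9) (2380 / 10 ^ 9) (1720 / 10 ^ 9) (970 / 10 ^ 9) a b c d B3) as S3.
  simpl nth in S3; specialize (S3 ltac:(lia) ltac:(lra) ltac:(lra) ltac:(lra)
    ltac:(lra) ltac:(lra) ltac:(lra) ltac:(lra)).
  pose proof (S3 (INR 4 / 2) ltac:(simpl; lra)) as B4.
  pose proof (fun a b c d => error_step 4 _ _ _ (4370 / 10 ^ 9) (4370 / 10 ^ 9) (3450 / 10 ^ 9) (2250 / 10 ^ 9) a b c d B4) as S4.
  simpl nth in S4; specialize (S4 ltac:(lia) ltac:(lra) ltac:(lra) ltac:(lra)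
    ltac:(lra) ltac:(lra) ltac:(lra) ltac:(lra)).
  simpl INR in S0, S1, S2, S3, S4.
  destruct (Rle_dec x (1 / 2)).
  { eapply error_bounds_weaken; [ | | | apply S0]; lra. }
  destruct (Rle_dec x 1).
  { eapply error_bounds_weaken; [ | | | apply S1]; lra. }
  destruct (Rle_dec x (3 / 2)).
  { eapply error_bounds_weaken; [ | | | apply S2]; lra. }
  destruct (Rle_dec x 2).
  { eapply error_bounds_weaken; [ | | | apply S3]; lra. }
  eapply error_bounds_weaken; [ | | | apply S4]; lra.
Qed.

End Inner_error.

(** * The Gaussian tail and q_0 *)

Definition gauss (z : R) : R := exp (- z ^ 2).

Definition gauss_tail (z : R) : R := RInt_gen gauss (at_point z) (Rbar_locally p_infty).

Lemma gauss_pos (z : R) : 0 < gauss z.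
Proof. apply exp_pos. Qed.

Lemma is_derive_gauss (z : R) : is_derive gauss z (- 2 * z * gauss z).
Proof.
  unfold gauss; auto_derive; [easy | ].
  simpl; ring_simplify (z * (z * 1)); ring.
Qed.

Lemma continuous_gauss (z : R) : continuous gauss z.
Proof. apply (is_derive_continuous _ _ _ (is_derive_gauss z)). Qed.

(** The integrals increase and stay bounded, because (u - 1)^2 >= 0 gives - u^2 <= 1 - 2 u. *)
Lemma gauss_integral_converges : exists l : R, is_lim (fun x => RInt gauss 0 x) p_infty l.
Proof.
  destruct (incr_bounded_lim (fun x => RInt gauss 0 x) 0 (exp 1)) as [l [Hl _]].
  - intros x y Hx Hxy; apply (derive_nonneg_le _ gauss); auto.
    + intros u _; apply (is_derive_continuous _ _ _ (is_derive_primitive gauss u continuous_gauss)).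
    + intros u _; apply is_derive_primitive, continuous_gauss.
    + intros u _; left; apply gauss_pos.
  - intros x Hx.
    assert (H : RInt gauss 0 x - RInt gauss 0 0
      <= - (exp (1 - 2 * x) / 2) - - (exp (1 - 2 * 0) / 2)).
    { apply (derive_le_le (fun x => RInt gauss 0 x) gauss (fun x => - (exp (1 - 2 * x) / 2))
        (fun x => exp (1 - 2 * x))); auto.
      - intros u _; apply (is_derive_continuous _ _ _ (is_derive_primitive gauss u continuous_gauss)).
      - intros u _; apply (ex_derive_continuous (V := R_NormedModule)); auto_derive; easy.
      - intros u _; apply is_derive_primitive, continuous_gauss.
      - intros u _; auto_derive; [easy | unfold Rminus; field].
      - intros u _; unfold gauss.
        destruct (Req_dec u 1) as [-> | Hu]; [right; f_equal; ring | ].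
        left; apply exp_increasing; assert (0 < (u - 1) ^ 2) by (apply pow2_gt_0; lra); lra. }
    rewrite RInt_0_0 in H; replace (1 - 2 * 0) with 1 in H by ring.
    pose proof (exp_pos 1); pose proof (exp_pos (1 - 2 * x)); lra.
  - exists l; exact Hl.
Qed.

Lemma gauss_tail_spec :
  exists l : R, is_lim (fun x => RInt gauss 0 x) p_infty l /\
    forall z, gauss_tail z = l - RInt gauss 0 z.
Proof.
  destruct gauss_integral_converges as [l Hl]; exists l; split; [exact Hl | ].
  intros z; apply is_RInt_gen_unique; intros Q HQ.
  assert (Hlim : is_lim (fun x => RInt gauss 0 x - RInt gauss 0 z) p_infty (l - RInt gauss 0 z)).
  { apply (is_lim_minus _ _ p_infty l (RInt gauss 0 z)); [exact Hl | apply is_lim_const | easy]. }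
  specialize (Hlim Q HQ); unfold filtermap in Hlim.
  apply (Filter_prod _ _ _ (fun x => x = z) (fun x => Q (RInt gauss 0 x - RInt gauss 0 z)));
    [easy | exact Hlim | ].
  intros x y -> Hy; exists (RInt gauss 0 y - RInt gauss 0 z); split; [simpl | exact Hy].
  assert (Hex : forall u, is_RInt gauss 0 u (RInt gauss 0 u)).
  { intros u; apply (RInt_correct (V := R_CompleteNormedModule)).
    apply (ex_RInt_continuous (V := R_CompleteNormedModule)); intros; apply continuous_gauss. }
  pose proof (is_RInt_Chasles _ _ _ _ _ _ (is_RInt_swap _ _ _ _ (Hex z)) (Hex y)) as H.
  replace (RInt gauss 0 y - RInt gauss 0 z) with (plus (opp (RInt gauss 0 z)) (RInt gauss 0 y))
    by (unfold plus, opp; simpl; ring).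
  exact H.
Qed.

Lemma is_derive_gauss_tail (z : R) : is_derive gauss_tail z (- gauss z).
Proof.
  destruct gauss_tail_spec as [l [_ E]].
  pose proof (is_derive_minus _ _ _ _ _ (is_derive_const (V := R_NormedModule) l z)
    (is_derive_primitive gauss z continuous_gauss)) as H.
  apply (is_derive_congr _ _ _ _ _ H); [exact E | ].
  unfold minus, plus, opp, zero; simpl; ring.
Qed.

Lemma is_lim_gauss_tail : is_lim gauss_tail p_infty 0.
Proof.
  destruct gauss_tail_spec as [l [Hl E]].
  apply (is_lim_ext (fun z => l - RInt gauss 0 z)); [intros; symmetry; apply E | ].
  replace (Finite 0) with (Finite (l - l)) by (f_equal; ring).
  apply (is_lim_minus _ _ p_infty l l); [apply is_lim_const | exact Hl | easy].
Qed.

Lemma erfc_gauss_tail (z : R) : erfc z = 2 / sqrt PI * gauss_tail z.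
Proof. reflexivity. Qed.

(* Iterated integrals of the Gaussian tail, by the three-term recurrence they satisfy. *)
Fixpoint iter_tail (n : nat) (z : R) : R :=
  match n with
  | O => gauss_tail z
  | S p => match p with
           | O => (gauss z - 2 * z * gauss_tail z) / 2
           | S q => (iter_tail q z - 2 * z * iter_tail p z) / (2 * INR n)
           end
  end.

Lemma iter_tail_rec (n : nat) (z : R) :
  iter_tail n z = 2 * z * iter_tail (S n) z + 2 * (INR n + 2) * iter_tail (S (S n)) z.
Proof.
  change (iter_tail (S (S n)) z)
    with ((iter_tail n z - 2 * z * iter_tail (S n) z) / (2 * INR (S (S n)))).
  rewrite !S_INR; pose proof (pos_INR n); field; lra.
Qed.

Lemma iter_tail_rec0 (z : R) : gauss z = 2 * z * iter_tail 0 z + 2 * iter_tail 1 z.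
Proof. simpl; field. Qed.

(** Differentiating the recurrence at level n + 2 takes the derivatives at levels n and n + 1, so
    two consecutive levels go through the induction; the recurrence one level down then simplifies
    the result. *)
Lemma is_derive_iter_tail (n : nat) (z : R) :
  is_derive (iter_tail (S n)) z (- iter_tail n z).
Proof.
  revert z; cut (forall z, is_derive (iter_tail (S n)) z (- iter_tail n z) /\
    is_derive (iter_tail (S (S n))) z (- iter_tail (S n) z)); [intros C z; apply C | ].
  assert (step : forall n (d : R) z, is_derive (iter_tail n) z d ->
    is_derive (iter_tail (S n)) z (- iter_tail n z) ->
    d = - 2 * z * iter_tail n z - 2 * (INR n + 1) * iter_tail (S n) z ->
    is_derive (iter_tail (S (S n))) z (- iter_tail (S n) z)).
  { clear n; intros n d z Hn HSn Ed.
    assert (H : is_derive (fun z => / (2 * INR (S (S n))) * (iter_tail n z - 2 * z * iter_tail (S n) z)) z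
      (/ (2 * INR (S (S n))) * (d - (2 * iter_tail (S n) z + 2 * z * (- iter_tail n z))))).
    { apply (is_derive_scal (fun z => iter_tail n z - 2 * z * iter_tail (S n) z)).
      apply (is_derive_minus (V := R_NormedModule)); [exact Hn | ].
      apply (is_derive_mult (fun z => 2 * z) (iter_tail (S n)) z 2 (- iter_tail n z));
        [ | easy | apply Rmult_comm].
      auto_derive; [easy | ring]. }
    assert (0 <= INR n) by apply pos_INR.
    apply (is_derive_congr _ _ _ _ _ H).
    - intros t; change (iter_tail (S (S n)) t)
        with ((iter_tail n t - 2 * t * iter_tail (S n) t) / (2 * INR (S (S n)))).
      unfold Rdiv; ring.
    - rewrite Ed, !S_INR; field; lra. }
  assert (D0 : forall z, is_derive (iter_tail 0) z (- gauss z)) by apply is_derive_gauss_tail.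
  assert (D1 : forall z, is_derive (iter_tail 1) z (- iter_tail 0 z)).
  { intros z.
    assert (H : is_derive (fun z => / 2 * (gauss z - 2 * z * gauss_tail z)) z
      (/ 2 * (- 2 * z * gauss z - (2 * gauss_tail z + 2 * z * (- gauss z))))).
    { apply (is_derive_scal (fun z => gauss z - 2 * z * gauss_tail z)).
      apply (is_derive_minus (V := R_NormedModule)); [apply is_derive_gauss | ].
      apply (is_derive_mult (fun z => 2 * z) gauss_tail z 2 (- gauss z)); [ | apply D0 | apply Rmult_comm].
      auto_derive; [easy | ring]. }
    apply (is_derive_congr _ _ _ _ _ H); [intros; simpl; field | simpl; field]. }
  induction n as [ | n IH]; intros z.
  - split; [apply D1 | ].
    apply (step 0%nat (- gauss z)); auto.
    rewrite iter_tail_rec0; simpl INR; ring.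
  - destruct (IH z) as [H1 H2]; split; [exact H2 | ].
    apply (step (S n) (- iter_tail n z)); auto.
    rewrite (iter_tail_rec n z), S_INR; ring.
Qed.

(** A mere limit 0 would not survive the factor z in the recurrence for [iter_tail]; decay faster
    than every power does. *)
Definition rapid (f : R -> R) : Prop :=
  forall k : nat, exists C, forall z, 1 <= z -> z ^ k * Rabs (f z) <= C.

Lemma exp_INR_mult (n : nat) (w : R) : exp (INR n * w) = exp w ^ n.
Proof.
  induction n as [ | n IH]; [simpl; rewrite Rmult_0_l; apply exp_0 | ].
  rewrite S_INR, Rmult_plus_distr_r, Rmult_1_l, exp_plus, IH; simpl; ring.
Qed.

(** exp z is the (k + 1)-th power of exp w >= w, where w = z / (k + 1). *)
Lemma pow_exp_bound (k : nat) (z : R) : 1 <= z -> z ^ k * exp (- z) <= INR (S k) ^ S k.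
Proof.
  intros Hz; set (w := z / INR (S k)).
  assert (Hk : 1 <= INR (S k)) by (rewrite S_INR; pose proof (pos_INR k); lra).
  assert (Hw : 0 < w) by (apply Rdiv_lt_0_compat; lra).
  assert (E : exp z = exp w ^ S k).
  { rewrite <- exp_INR_mult; f_equal; unfold w; field; lra. }
  assert (H1 : w ^ S k <= exp z).
  { rewrite E; apply pow_incr; pose proof (exp_ineq1_le w); lra. }
  assert (H2 : z ^ k <= INR (S k) ^ S k * w ^ S k).
  { rewrite <- Rpow_mult_distr; unfold w; replace (INR (S k) * (z / INR (S k))) with z by (field; lra).
    simpl; pose proof (pow_lt z k ltac:(lra)); nra. }
  assert (Hp : 0 < INR (S k) ^ S k) by (apply pow_lt; lra).
  rewrite exp_Ropp; pose proof (exp_pos z).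
  apply Rmult_le_reg_r with (exp z); [easy | ].
  rewrite Rmult_assoc, Rinv_l, Rmult_1_r by lra; nra.
Qed.

Lemma rapid_gauss : rapid gauss.
Proof.
  intros k; exists (INR (S k) ^ S k); intros z Hz.
  eapply Rle_trans; [ | apply (pow_exp_bound k z Hz)].
  apply Rmult_le_compat_l; [apply pow_le; lra | ].
  rewrite Rabs_right by (left; apply gauss_pos); unfold gauss.
  destruct (Req_dec z 1) as [-> | Hz1]; [right; f_equal; ring | ].
  left; apply exp_increasing; simpl; nra.
Qed.

Lemma rapid_le (f g : R -> R) :
  rapid g -> (forall z, 1 <= z -> Rabs (f z) <= Rabs (g z)) -> rapid f.
Proof.
  intros Hg Hfg k; destruct (Hg k) as [C HC]; exists C; intros z Hz.
  eapply Rle_trans; [ | apply (HC z Hz)].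
  apply Rmult_le_compat_l; [apply pow_le; lra | auto].
Qed.

Lemma rapid_plus (f g : R -> R) : rapid f -> rapid g -> rapid (fun z => f z + g z).
Proof.
  intros Hf Hg k; destruct (Hf k) as [C HC], (Hg k) as [D HD]; exists (C + D); intros z Hz.
  specialize (HC z Hz); specialize (HD z Hz).
  pose proof (Rabs_triang (f z) (g z)); pose proof (pow_le z k ltac:(lra)); nra.
Qed.

Lemma rapid_scal (c : R) (f : R -> R) : rapid f -> rapid (fun z => c * f z).
Proof.
  intros Hf k; destruct (Hf k) as [C HC]; exists (Rabs c * C); intros z Hz.
  specialize (HC z Hz); rewrite Rabs_mult; pose proof (Rabs_pos c); nra.
Qed.

Lemma rapid_mult_id (f : R -> R) : rapid f -> rapid (fun z => z * f z).
Proof.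
  intros Hf k; destruct (Hf (S k)) as [C HC]; exists C; intros z Hz.
  specialize (HC z Hz); rewrite Rabs_mult, (Rabs_right z) by lra; simpl in HC; lra.
Qed.

Lemma rapid_is_lim (f : R -> R) : rapid f -> is_lim f p_infty 0.
Proof.
  intros Hf; destruct (Hf 1%nat) as [C HC]; apply eventually_is_lim_infty; intros eps He.
  exists (Rmax 1 (C / eps)); intros x Hx.
  pose proof (Rmax_l 1 (C / eps)); pose proof (Rmax_r 1 (C / eps)).
  specialize (HC x ltac:(lra)); rewrite pow_1 in HC; rewrite Rminus_0_r.
  assert (C < x * eps).
  { replace C with (C / eps * eps) by (field; lra); apply Rmult_lt_compat_r; lra. }
  apply Rmult_lt_reg_l with x; lra.
Qed.

Lemma iter_tail_0_nonneg (z : R) : 0 <= iter_tail 0 z.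
Proof.
  apply (derive_nonpos_ge_lim gauss_tail (fun z => - gauss z) z).
  - intros; apply is_derive_gauss_tail.
  - intros x _; pose proof (gauss_pos x); lra.
  - exact is_lim_gauss_tail.
  - lra.
Qed.

Lemma rapid_iter_tail (n : nat) : rapid (iter_tail n).
Proof.
  assert (R0 : rapid (iter_tail 0)).
  { apply (rapid_le _ gauss rapid_gauss); intros z Hz.
    rewrite Rabs_right by (apply Rle_ge, iter_tail_0_nonneg).
    rewrite Rabs_right by (left; apply gauss_pos).
    (* For z >= 1 the difference has derivative (1 - 2 z) gauss z <= 0 and limit 0. *)
    cut (0 <= gauss z - gauss_tail z); [simpl; lra | ].
    apply (derive_nonpos_ge_lim (fun z => gauss z - gauss_tail z)
      (fun z => - 2 * z * gauss z - - gauss z) 1); [ | | | easy].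
    - intros x _; apply (is_derive_minus (V := R_NormedModule));
        [apply is_derive_gauss | apply is_derive_gauss_tail].
    - intros x Hx; pose proof (gauss_pos x); nra.
    - replace (Finite 0) with (Finite (0 - 0)) by (f_equal; ring).
      apply (is_lim_minus _ _ p_infty 0 0); [apply rapid_is_lim, rapid_gauss | apply is_lim_gauss_tail | easy]. }
  cut (rapid (iter_tail n) /\ rapid (iter_tail (S n))); [easy | ].
  induction n as [ | n [IH1 IH2]]; split; auto.
  - apply (rapid_le _ (fun z => / 2 * (gauss z + (-2) * (z * iter_tail 0 z)))).
    + apply rapid_scal, rapid_plus; [apply rapid_gauss | apply rapid_scal, rapid_mult_id, R0].
    + intros z _; right; f_equal; simpl; field.
  - apply (rapid_le _ (fun z => / (2 * INR (S (S n))) * (iter_tail n z + (-2) * (z * iter_tail (S n) z)))).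
    + apply rapid_scal, rapid_plus; [exact IH1 | apply rapid_scal, rapid_mult_id, IH2].
    + intros z _; right; f_equal.
      change (iter_tail (S (S n)) z)
        with ((iter_tail n z - 2 * z * iter_tail (S n) z) / (2 * INR (S (S n)))).
      unfold Rdiv; ring.
Qed.

Lemma iter_tail_nonneg (n : nat) (z : R) : 0 <= iter_tail n z.
Proof.
  revert z; induction n as [ | n IH]; intros z; [apply iter_tail_0_nonneg | ].
  apply (derive_nonpos_ge_lim (iter_tail (S n)) (fun z => - iter_tail n z) z); [ | | | lra].
  - intros; apply is_derive_iter_tail.
  - intros x _; specialize (IH x); lra.
  - apply rapid_is_lim, rapid_iter_tail.
Qed.

Lemma gauss_inv (z : R) : exp (z ^ 2) * gauss z = 1.
Proof. unfold gauss; rewrite <- exp_plus, Rplus_opp_r; apply exp_0. Qed.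

Lemma sqrt_PI_pos : 0 < sqrt PI.
Proof. apply sqrt_lt_R0, PI_RGT_0. Qed.

Lemma I0_eq (z : R) : 0 <= z -> I0 (z ^ 2) = 2 * exp (z ^ 2) * iter_tail 1 z.
Proof.
  intros Hz; unfold I0; rewrite erfc_gauss_tail.
  rewrite sqrt_mult_alt by (left; apply PI_RGT_0); rewrite sqrt_pow2 by easy.
  pose proof sqrt_PI_pos; pose proof (gauss_inv z) as E.
  replace 1 with (exp (z ^ 2) * gauss z) at 1; simpl iter_tail; field; lra.
Qed.

Lemma J0_eq (z : R) :
  0 <= z -> J0 (z ^ 2) = 1 - 2 * sqrt 2 * z * exp (z ^ 2) ^ 2 * gauss_tail (sqrt 2 * z).
Proof.
  intros Hz; unfold J0; rewrite erfc_gauss_tail.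
  replace (2 * PI * z ^ 2) with (PI * (2 * z ^ 2)) by ring.
  rewrite (sqrt_mult_alt PI) by (left; apply PI_RGT_0).
  rewrite (sqrt_mult_alt 2), sqrt_pow2 by (easy || lra).
  replace (exp (2 * z ^ 2)) with (exp (z ^ 2) ^ 2) by (replace (2 * z ^ 2) with (z ^ 2 + z ^ 2) by ring; rewrite exp_plus; ring).
  pose proof sqrt_PI_pos; field; lra.
Qed.

(** The coefficient of c^2 in q0(z^2) / (2 z). Its second derivative is 8 [gauss z] [iter_tail 2 z],
    so that c^2 [G2] accounts for the part c^2 [H1] of kappa. *)
Definition second_order (z : R) : R :=
  3 * gauss z * gauss_tail z - 2 * sqrt 2 * gauss_tail (sqrt 2 * z) - 2 * z * gauss_tail z ^ 2.

Definition second_order1 (z : R) : R :=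
  gauss z ^ 2 - 2 * z * gauss z * gauss_tail z - 2 * gauss_tail z ^ 2.

Lemma gauss_sqrt2 (z : R) : gauss (sqrt 2 * z) = gauss z ^ 2.
Proof.
  unfold gauss; replace (- (sqrt 2 * z) ^ 2) with (- z ^ 2 + - z ^ 2); [rewrite exp_plus; ring | ].
  rewrite Rpow_mult_distr, pow2_sqrt by lra; ring.
Qed.

Lemma is_derive_second_order (z : R) : is_derive second_order z (second_order1 z).
Proof.
  assert (Hs : is_derive (fun z => gauss_tail (sqrt 2 * z)) z (- (sqrt 2 * gauss z ^ 2))).
  { assert (Hl : is_derive (fun z => sqrt 2 * z) z (sqrt 2)) by (auto_derive; [easy | ring]).
    pose proof (is_derive_comp _ _ _ _ _ (is_derive_gauss_tail (sqrt 2 * z)) Hl) as H.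
    apply (is_derive_congr _ _ _ _ _ H); [easy | ].
    rewrite gauss_sqrt2; unfold scal; simpl; unfold mult; simpl; ring. }
  pose proof (is_derive_gauss z) as Hg; pose proof (is_derive_gauss_tail z) as Ht.
  unfold second_order, second_order1.
  assert (Eg : Derive gauss z = - 2 * z * gauss z) by (apply is_derive_unique; easy).
  assert (Et : Derive gauss_tail z = - gauss z) by (apply is_derive_unique; easy).
  assert (Es : Derive (fun z => gauss_tail (sqrt 2 * z)) z = - (sqrt 2 * gauss z ^ 2))
    by (apply is_derive_unique; easy).
  set (k := fun z => gauss_tail (sqrt 2 * z)) in *.
  assert (Xk : ex_derive k z) by (eexists; exact Hs).
  assert (Xg : ex_derive gauss z) by (eexists; exact Hg).
  assert (Xt : ex_derive gauss_tail z) by (eexists; exact Ht).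
  apply (is_derive_ext (fun z => 3 * gauss z * gauss_tail z - 2 * sqrt 2 * k z - 2 * z * gauss_tail z ^ 2));
    [easy | ].
  auto_derive; [repeat split; assumption | ].
  change (Derive (fun x => k x)) with (Derive k).
  change (Derive (fun x => gauss x)) with (Derive gauss).
  change (Derive (fun x => gauss_tail x)) with (Derive gauss_tail).
  rewrite Eg, Et, Es; pose proof (sqrt_sqrt 2 ltac:(lra)) as E2.
  replace (2 * sqrt 2 * (1 * - (sqrt 2 * gauss z ^ 2))) with (- 2 * (sqrt 2 * sqrt 2) * gauss z ^ 2) by ring.
  rewrite E2; ring.
Qed.

Lemma is_derive_second_order1 (z : R) :
  is_derive second_order1 z (8 * gauss z * iter_tail 2 z).
Proof.
  pose proof (is_derive_gauss z) as Hg; pose proof (is_derive_gauss_tail z) as Ht.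
  assert (Eg : Derive gauss z = - 2 * z * gauss z) by (apply is_derive_unique; easy).
  assert (Et : Derive gauss_tail z = - gauss z) by (apply is_derive_unique; easy).
  assert (Xg : ex_derive gauss z) by (eexists; exact Hg).
  assert (Xt : ex_derive gauss_tail z) by (eexists; exact Ht).
  unfold second_order1; auto_derive; [repeat split; assumption | ].
  change (Derive (fun x => gauss x)) with (Derive gauss).
  change (Derive (fun x => gauss_tail x)) with (Derive gauss_tail).
  rewrite Eg, Et; simpl iter_tail; field.
Qed.

Lemma q0_eq (c z : R) :
  0 < z -> q0 c (z ^ 2) / (2 * z) = 2 * c * iter_tail 1 z + c ^ 2 * second_order z.
Proof.
  intros Hz; unfold q0; rewrite I0_eq, J0_eq, sqrt_pow2 by lra.
  pose proof (gauss_inv z) as E.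
  replace (exp (- z ^ 2)) with (gauss z) by easy.
  replace (exp (- 2 * z ^ 2)) with (gauss z ^ 2)
    by (unfold gauss; replace (- 2 * z ^ 2) with (- z ^ 2 + - z ^ 2) by ring; rewrite exp_plus; ring).
  unfold second_order; simpl iter_tail.
  set (m2 := gauss_tail (sqrt 2 * z)); set (m := gauss_tail z); set (g := gauss z) in *.
  set (w := exp (z ^ 2)) in *; clearbody m2 m w; clearbody g.
  assert (Hg : g <> 0) by (intros ->; rewrite Rmult_0_r in E; lra).
  replace w with (/ g) by (field_simplify_eq; lra).
  field; lra.
Qed.

(** * Limits at infinity and the linear asymptote *)

Lemma is_lim_affine (h : R -> R) (l s r : R) :
  0 < s -> is_lim h p_infty l -> is_lim (fun x => h (s * (x + r))) p_infty l.
Proof.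
  intros Hs Hl; apply eventually_is_lim_infty; intros eps He.
  destruct (is_lim_infty_eventually h l eps Hl He) as [X HX].
  exists (X / s - r); intros x Hx; apply HX.
  apply Rmult_lt_reg_r with (/ s); [apply Rinv_0_lt_compat; easy | ].
  replace (s * (x + r) * / s) with (x + r) by (field; lra); unfold Rdiv in Hx; lra.
Qed.

Lemma is_lim_lin0 (f g : R -> R) (c d : R) :
  is_lim f p_infty 0 -> is_lim g p_infty 0 -> is_lim (fun x => c * f x + d * g x) p_infty 0.
Proof.
  intros Hf Hg; replace (Finite 0) with (Finite (c * 0 + d * 0)) by (f_equal; ring).
  apply (is_lim_plus _ _ p_infty (c * 0) (d * 0)); [ | | easy].
  - apply (is_lim_scal_l f c p_infty 0 Hf).
  - apply (is_lim_scal_l g d p_infty 0 Hg).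
Qed.

Lemma is_lim_mult0 (f g : R -> R) :
  is_lim f p_infty 0 -> is_lim g p_infty 0 -> is_lim (fun x => f x * g x) p_infty 0.
Proof.
  intros Hf Hg; replace (Finite 0) with (Finite (0 * 0)) by (f_equal; ring).
  apply (is_lim_mult f g p_infty 0 0 Hf Hg); easy.
Qed.

Lemma is_lim_exp_decay (k x0 : R) : 0 < k -> is_lim (fun x => exp (- k * (x - x0))) p_infty 0.
Proof.
  intros Hk; apply eventually_is_lim_infty; intros eps He.
  exists (Rmax x0 (x0 + / (k * eps))); intros x Hx.
  pose proof (Rmax_l x0 (x0 + / (k * eps))); pose proof (Rmax_r x0 (x0 + / (k * eps))).
  rewrite Rminus_0_r, Rabs_right by (left; apply exp_pos).
  replace (- k * (x - x0)) with (- (k * (x - x0))) by ring; rewrite exp_Ropp.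
  assert (Hd : / (k * eps) < x - x0) by lra.
  assert (Hke : 0 < k * eps) by (apply Rmult_lt_0_compat; easy).
  apply (Rmult_lt_compat_r (k * eps)) in Hd; [ | easy].
  rewrite Rinv_l in Hd by lra.
  assert (Hkx : 0 < k * (x - x0)) by (apply Rmult_lt_0_compat; lra).
  pose proof (exp_ineq1_le (k * (x - x0))) as H1.
  apply Rmult_lt_reg_l with (exp (k * (x - x0))); [apply exp_pos | ].
  rewrite Rinv_r by (apply Rgt_not_eq, exp_pos); nra.
Qed.

Section Asymptote.

Context (f f1 f2 : R -> R) (x0 : R).
Context (Hf : forall x, x0 <= x -> is_derive f x (f1 x))
        (Hf1 : forall x, x0 <= x -> is_derive f1 x (f2 x))
        (Hf2 : forall x, x0 <= x -> is_derive f2 x (- f x * f2 x))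
        (P0 : 0 < f x0) (P1 : forall x, x0 <= x -> 0 <= f1 x) (P2 : forall x, x0 <= x -> 0 < f2 x).

Let k := f x0.
Let B x := f2 x0 * exp (- k * (x - x0)).

Lemma f_ge_start (x : R) : x0 <= x -> k <= f x.
Proof.
  intros Hx; apply (derive_nonneg_le f f1); [easy | | | ].
  - intros y Hy; apply (is_derive_continuous _ _ _ (Hf y (proj1 Hy))).
  - intros y Hy; apply Hf; lra.
  - intros y Hy; apply P1; lra.
Qed.

(** As f >= k beyond x0, the product of f2 and exp(k (x - x0)) is nonincreasing. *)
Lemma f2_decay (x : R) : x0 <= x -> f2 x <= B x.
Proof.
  intros Hx; pose (w := fun x => f2 x * exp (k * (x - x0))).
  assert (Hw : forall y, x0 <= y -> is_derive w y ((k - f y) * (f2 y * exp (k * (y - x0))))).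
  { intros y Hy.
    assert (He : is_derive (fun x => exp (k * (x - x0))) y (k * exp (k * (y - x0))))
      by (auto_derive; [easy | unfold Rminus; ring]).
    pose proof (is_derive_mult _ _ _ _ _ (Hf2 y Hy) He Rmult_comm) as Hm.
    apply (is_derive_congr _ _ _ _ _ Hm); [easy | unfold plus, mult; simpl; ring]. }
  assert (H : - w x0 <= - w x).
  { apply (derive_nonneg_le (fun x => - w x) (fun y => - ((k - f y) * (f2 y * exp (k * (y - x0))))));
      [easy | | | ].
    - intros y Hy; apply (continuous_opp (V := R_NormedModule)).
      apply (is_derive_continuous _ _ _ (Hw y (proj1 Hy))).
    - intros y Hy; apply (is_derive_opp (V := R_NormedModule)), Hw; lra.
    - intros y Hy; pose proof (f_ge_start y ltac:(lra)); pose proof (P2 y ltac:(lra)).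
      pose proof (exp_pos (k * (y - x0))).
      assert (0 < f2 y * exp (k * (y - x0))) by (apply Rmult_lt_0_compat; easy); nra. }
  unfold w in H; rewrite Rminus_diag, Rmult_0_r, exp_0 in H.
  unfold B; replace (- k * (x - x0)) with (- (k * (x - x0))) by ring; rewrite exp_Ropp.
  apply Rmult_le_reg_r with (exp (k * (x - x0))); [apply exp_pos | ].
  rewrite Rmult_assoc, Rinv_l by (apply Rgt_not_eq, exp_pos); lra.
Qed.

Lemma is_derive_B (c x : R) : is_derive (fun x => c * B x) x (- (k * c) * B x).
Proof. unfold B; auto_derive; [easy | unfold Rminus; ring]. Qed.

Lemma is_lim_B (c : R) : is_lim (fun x => c * B x) p_infty 0.
Proof.
  pose proof (is_lim_exp_decay k x0 P0) as H.
  apply (is_lim_ext (fun x => (c * f2 x0) * exp (- k * (x - x0)) + 0 * exp (- k * (x - x0)))).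
  - intros x; unfold B; ring.
  - apply is_lim_lin0; exact H.
Qed.

Lemma B_x0 : B x0 = f2 x0.
Proof. unfold B; rewrite Rminus_diag, Rmult_0_r, exp_0; ring. Qed.

(** From f2 <= B, f1 increases while f1 + B / k decreases, and the limit a lies between them.
    Likewise a x - f increases while a x - f + B / k^2 decreases. The resulting bounds at x0 are the
    a priori information on which the matching rests. *)
Lemma asymptote_exists :
  exists a b, is_lim (fun x => f x - a * x - b) p_infty 0 /\ is_lim (fun x => f1 x - a) p_infty 0 /\
    f1 x0 <= a <= f1 x0 + f2 x0 / f x0 /\
    f x0 - f2 x0 / f x0 ^ 2 <= a * x0 + b <= f x0.
Proof.
  assert (Hk : 0 < k) by exact P0.
  assert (Hik : 0 < / k) by (apply Rinv_0_lt_compat; easy).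
  assert (BP : forall x, 0 < B x) by (intros x; apply Rmult_lt_0_compat; [apply P2; lra | apply exp_pos]).
  assert (Hup : forall x, x0 <= x -> is_derive (fun x => f1 x + / k * B x) x (f2 x - B x)).
  { intros x Hx; pose proof (is_derive_plus _ _ _ _ _ (Hf1 x Hx) (is_derive_B (/ k) x)) as H.
    apply (is_derive_congr _ _ _ _ _ H); [easy | ].
    unfold plus; simpl; rewrite Rinv_r by lra; ring. }
  destruct (incr_bounded_lim f1 x0 (f1 x0 + / k * B x0)) as [a [La Ha]].
  - intros x y Hx Hxy; apply (derive_nonneg_le f1 f2); [easy | | | ].
    + intros u Hu; apply (is_derive_continuous f1 u (f2 u)), Hf1; lra.
    + intros u Hu; apply Hf1; lra.
    + intros u Hu; left; apply P2; lra.
  - intros x Hx.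
    assert (H : - (f1 x0 + / k * B x0) <= - (f1 x + / k * B x)).
    { apply (derive_nonneg_le (fun x => - (f1 x + / k * B x)) (fun x => - (f2 x - B x))); [easy | | | ].
      - intros u Hu; apply (continuous_opp (V := R_NormedModule)).
        apply (is_derive_continuous _ _ _ (Hup u (proj1 Hu))).
      - intros u Hu; apply (is_derive_opp (V := R_NormedModule)), Hup; lra.
      - intros u Hu; pose proof (f2_decay u ltac:(lra)); lra. }
    assert (0 < / k * B x) by (apply Rmult_lt_0_compat; easy); lra.
  - assert (Ha' : forall x, x0 <= x -> a <= f1 x + / k * B x).
    { apply (derive_nonpos_ge_lim _ (fun x => f2 x - B x)); [exact Hup | | ].
      - intros x Hx; pose proof (f2_decay x Hx); lra.
      - replace (Finite a) with (Finite (a + 0)) by (f_equal; ring).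
        apply (is_lim_plus _ _ p_infty a 0); [exact La | apply is_lim_B | easy]. }
    assert (Hlin : forall x, is_derive (fun x => a * x) x a) by (intros; auto_derive; [easy | ring]).
    assert (Hd : forall x, x0 <= x -> is_derive (fun x => a * x - f x) x (a - f1 x)).
    { intros x Hx; apply (is_derive_minus (V := R_NormedModule)); auto. }
    assert (Hd' : forall x, x0 <= x -> is_derive (fun x => (a * x - f x) + / k * (/ k * B x)) x (a - f1 x - / k * B x)).
    { intros x Hx.
      pose proof (is_derive_plus _ _ _ _ _ (Hd x Hx) (is_derive_B (/ k * / k) x)) as H.
      apply (is_derive_congr _ _ _ _ _ H); [intros; unfold plus; simpl; ring | ].
      unfold plus; simpl; field; lra. }
    destruct (incr_bounded_lim (fun x => a * x - f x) x0 ((a * x0 - f x0) + / k * (/ k * B x0)))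
      as [b' [Lb Hb]].
    + intros x y Hx Hxy; apply (derive_nonneg_le (fun x => a * x - f x) (fun x => a - f1 x)); [easy | | | ].
      * intros u Hu; apply (is_derive_continuous _ _ _ (Hd u ltac:(lra))).
      * intros u Hu; apply Hd; lra.
      * intros u Hu; pose proof (Ha u ltac:(lra)); lra.
    + intros x Hx.
      assert (H : - ((a * x0 - f x0) + / k * (/ k * B x0)) <= - ((a * x - f x) + / k * (/ k * B x))).
      { apply (derive_nonneg_le (fun x => - ((a * x - f x) + / k * (/ k * B x)))
          (fun x => - (a - f1 x - / k * B x))); [easy | | | ].
        - intros u Hu; apply (continuous_opp (V := R_NormedModule)).
          apply (is_derive_continuous _ _ _ (Hd' u (proj1 Hu))).
        - intros u Hu; apply (is_derive_opp (V := R_NormedModule)), Hd'; lra.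
        - intros u Hu; pose proof (Ha' u ltac:(lra)); lra. }
      assert (0 < / k * (/ k * B x)) by (apply Rmult_lt_0_compat; [easy | apply Rmult_lt_0_compat; easy]); lra.
    + assert (Hb' : forall x, x0 <= x -> b' <= (a * x - f x) + / k * (/ k * B x)).
      { apply (derive_nonpos_ge_lim _ (fun x => a - f1 x - / k * B x)); [exact Hd' | | ].
        - intros x Hx; pose proof (Ha' x Hx); lra.
        - replace (Finite b') with (Finite (b' + 0)) by (f_equal; ring).
          apply (is_lim_plus _ _ p_infty b' 0); [exact Lb | | easy].
          apply (is_lim_ext (fun x => (/ k * / k) * B x)); [intros; ring | apply is_lim_B]. }
      (* The limit b' was taken for a x - f, whence the sign. *)
      exists a, (- b'); repeat split.
      * apply (is_lim_ext (fun x => (-1) * (a * x - f x - b') + 0 * (a * x - f x - b'))); [intros; ring | ].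
        assert (L0 : is_lim (fun x => a * x - f x - b') p_infty 0).
        { replace (Finite 0) with (Finite (b' - b')) by (f_equal; ring).
          apply (is_lim_minus _ _ p_infty b' b'); [exact Lb | apply is_lim_const | easy]. }
        apply is_lim_lin0; exact L0.
      * replace (Finite 0) with (Finite (a - a)) by (f_equal; ring).
        apply (is_lim_minus _ _ p_infty a a); [exact La | apply is_lim_const | easy].
      * apply Ha; lra.
      * specialize (Ha' x0 ltac:(lra)); rewrite B_x0 in Ha'; unfold k in Ha'; unfold Rdiv; lra.
      * specialize (Hb' x0 ltac:(lra)); rewrite B_x0 in Hb'; unfold k in Hb'.
        replace (f2 x0 / f x0 ^ 2) with (/ f x0 * (/ f x0 * f2 x0)) by (field; lra); lra.
      * specialize (Hb x0 ltac:(lra)); lra.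
Qed.

End Asymptote.

(** * Inequalities for the iterated tails, and the weights of the outer bounds *)

(** By the recurrence [gauss] is a combination of [iter_tail 2] and [iter_tail 3] with positive
    coefficients, and [iter_tail 3] is at least z [iter_tail 2] / (2 z^2 + 4). The resulting bound
    on the ratio is largest at z = 1.4, where 57/1000 just suffices. *)
Lemma tail_ratio (z : R) : 14 / 10 <= z -> 2 * z * iter_tail 2 z <= 57 / 1000 * gauss z.
Proof.
  intros Hz.
  pose proof (iter_tail_rec0 z) as err0; pose proof (iter_tail_rec 0 z) as err1.
  pose proof (iter_tail_rec 1 z) as err2; pose proof (iter_tail_rec 2 z) as E3.
  pose proof (iter_tail_rec 3 z) as E4.
  pose proof (iter_tail_nonneg 2 z) as N2; pose proof (iter_tail_nonneg 3 z) as N3.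
  pose proof (iter_tail_nonneg 4 z) as N4; pose proof (iter_tail_nonneg 5 z) as N5.
  simpl INR in *.
  set (u0 := iter_tail 0 z) in *; set (u1 := iter_tail 1 z) in *; set (u2 := iter_tail 2 z) in *.
  set (u3 := iter_tail 3 z) in *; set (u4 := iter_tail 4 z) in *; set (u5 := iter_tail 5 z) in *.
  clearbody u0 u1 u2 u3 u4 u5.
  assert (H3 : z * u2 <= (2 * z ^ 2 + 4) * u3).
  { assert (2 * z * u4 <= u3) by lra.
    assert (z * u2 = 2 * z ^ 2 * u3 + 4 * (2 * z * u4)) by (rewrite E3; ring). lra. }
  assert (E : gauss z = (8 * z ^ 2 + 12) * (z * u2) + (24 * z ^ 2 + 12) * u3).
  { rewrite err0, err1, err2; ring. }
  rewrite E; replace (2 * z * u2) with (2 * (z * u2)) by ring.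
  assert (Hzu : 0 <= z * u2) by nra.
  assert (Hz2 : 196 / 100 <= z ^ 2) by nra.
  assert (H : 2 * (z * u2) * (2 * z ^ 2 + 4) <= 57 / 1000 * ((8 * z ^ 2 + 12) * (z * u2) * (2 * z ^ 2 + 4)
    + (24 * z ^ 2 + 12) * (z * u2))).
  { set (v := z * u2) in *; set (t := z ^ 2) in *; clearbody v t.
    assert (0 <= 57 / 1000 * ((8 * t + 12) * (2 * t + 4) + (24 * t + 12)) - 2 * (2 * t + 4)) by nra.
    nra. }
  set (v := z * u2) in *; set (t := z ^ 2) in *; clearbody v t.
  assert (Ht : 0 < 2 * t + 4) by lra.
  apply Rmult_le_reg_r with (2 * t + 4); [easy | ].
  assert ((24 * t + 12) * v <= (24 * t + 12) * ((2 * t + 4) * u3)) by (apply Rmult_le_compat_l; lra).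
  lra.
Qed.

(** A Turan-type inequality in which [gauss] plays the tail of index -1. Expanded by the recurrence,
    the difference is u3 (8 z u1 + 24 u2 - 96 u4) - 32 z u2 u4, and the tails shrink fast enough for
    the first term to dominate. *)
Lemma tail_log_concave (z : R) : 1 <= z -> gauss z * iter_tail 2 z <= iter_tail 0 z * iter_tail 1 z.
Proof.
  intros Hz.
  pose proof (iter_tail_rec0 z) as err0; pose proof (iter_tail_rec 0 z) as err1.
  pose proof (iter_tail_rec 1 z) as err2; pose proof (iter_tail_rec 2 z) as E3.
  pose proof (iter_tail_rec 3 z) as E4.
  pose proof (iter_tail_nonneg 2 z) as N2; pose proof (iter_tail_nonneg 3 z) as N3.
  pose proof (iter_tail_nonneg 4 z) as N4; pose proof (iter_tail_nonneg 5 z) as N5.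
  pose proof (iter_tail_nonneg 1 z) as N1.
  simpl INR in *.
  set (u0 := iter_tail 0 z) in *; set (u1 := iter_tail 1 z) in *; set (u2 := iter_tail 2 z) in *.
  set (u3 := iter_tail 3 z) in *; set (u4 := iter_tail 4 z) in *; set (u5 := iter_tail 5 z) in *.
  clearbody u0 u1 u2 u3 u4 u5.
  assert (E : u0 * u1 - gauss z * u2 = u3 * (8 * z * u1 + 24 * u2 - 96 * u4) - 32 * z * u2 * u4).
  { rewrite err0, err1.
    replace (2 * z * (2 * z * u1 + 2 * (0 + 2) * u2) + 2 * u1) with (2 * z * (2 * z * u1 + 4 * u2) + 2 * u1) by ring.
    assert (K : u1 * u1 = u1 * (2 * z * u2 + 6 * u3)) by (rewrite err2 at 2; ring).
    assert (K2 : u1 * u2 = u1 * (2 * z * u3 + 8 * u4)) by (rewrite E3 at 1; ring).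
    assert (K3 : u1 * u4 = (2 * z * u2 + 6 * u3) * u4) by (rewrite err2; ring).
    nra. }
  assert (H4 : 2 * z * u4 <= u3) by lra.
  assert (H5 : 8 * u4 <= u2) by nra.
  assert (H6 : 2 * z * u2 <= u1) by lra.
  assert (H7 : 2 * u2 <= u1) by nra.
  assert (H8 : 16 * u2 * (2 * z * u4) <= 16 * u2 * u3) by (apply Rmult_le_compat_l; lra).
  assert (H9 : 0 <= 8 * z * u1 + 8 * u2 - 96 * u4) by nra.
  nra.
Qed.

Lemma exp_le_inv (y : R) : y < 1 -> exp y <= / (1 - y).
Proof.
  intros Hy; rewrite <- (Rinv_inv (exp y)), <- exp_Ropp.
  apply Rinv_le_contravar; [lra | ].
  pose proof (exp_ineq1_le (- y)); lra.
Qed.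

Lemma exp_le_linear (y : R) : 0 <= y <= 1 / 300 -> exp y <= 1 + 300 / 299 * y.
Proof.
  intros Hy; eapply Rle_trans; [apply exp_le_inv; lra | ].
  apply Rmult_le_reg_l with (1 - y); [lra | ].
  rewrite Rinv_r by lra; nra.
Qed.

Lemma exp_le_quadratic (y : R) : 0 <= y <= 1 / 100 -> exp y <= 1 + y + 51 / 100 * y ^ 2.
Proof.
  intros Hy.
  assert (H : 1 + 0 + 51 / 100 * 0 ^ 2 - exp 0 <= 1 + y + 51 / 100 * y ^ 2 - exp y).
  { apply (derive_nonneg_le (fun y => 1 + y + 51 / 100 * y ^ 2 - exp y)
      (fun y => 1 + 102 / 100 * y - exp y)); [lra | | | ].
    - intros x _; apply (ex_derive_continuous (V := R_NormedModule)); auto_derive; easy.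
    - intros x _; auto_derive; [easy | field].
    - intros x Hx; cut (exp x <= 1 + 102 / 100 * x); [lra | ].
      eapply Rle_trans; [apply exp_le_inv; lra | ].
      apply Rmult_le_reg_l with (1 - x); [lra | ].
      rewrite Rinv_r by lra; nra. }
  rewrite exp_0 in H; lra.
Qed.

Lemma gauss_decreasing (x y : R) : 0 <= x -> x <= y -> gauss y <= gauss x.
Proof.
  intros Hx Hxy; unfold gauss.
  destruct (Req_dec x y) as [-> | Hne]; [lra | ].
  assert (x * x < y * y) by (apply Rmult_le_0_lt_compat; lra).
  left; apply exp_increasing; lra.
Qed.

Lemma gauss_14_le : gauss (14 / 10) <= 1507 / 10000.
Proof.
  unfold gauss; rewrite exp_Ropp.
  assert (H : 664 / 100 <= exp ((14 / 10) ^ 2)).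
  { replace ((14 / 10) ^ 2) with (INR 28 * (7 / 100)) by (simpl; field).
    rewrite exp_INR_mult; apply Rle_trans with ((107 / 100) ^ 28); [lra | ].
    apply pow_incr; pose proof (exp_ineq1_le (7 / 100)); lra. }
  apply Rle_trans with (/ (664 / 100)); [apply Rinv_le_contravar; lra | lra].
Qed.

(** With y = sqrt t this is exp(-3 t) t^(-k/2), the weight of the bounds on E, E' and E'' for k = 4,
    3, 2. Integration gains a factor 1/6 and raises k by one, up to a term of favourable sign. *)
Definition gauss3_over (k : nat) (y : R) : R := gauss y ^ 3 / y ^ k.

Lemma is_derive_gauss3_over (k : nat) (y : R) :
  0 < y -> is_derive (gauss3_over (S k)) y (- (6 * gauss3_over k y + INR (S k) * gauss3_over (S (S k)) y)).
Proof.
  intros Hy; pose proof (is_derive_gauss y) as Hg.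
  assert (Hi : is_derive (fun y => / y ^ S k) y (- (INR (S k) * y ^ k) / (y ^ S k) ^ 2)).
  { apply is_derive_inv; [ | apply pow_nonzero; lra].
    pose proof (is_derive_pow (fun y => y) (S k) y 1 (is_derive_id (K := R_AbsRing) y)) as Hp.
    apply (is_derive_congr _ _ _ _ _ Hp); [easy | ].
    change (Init.Nat.pred (S k)) with k; generalize (INR (S k)); intros; ring. }
  assert (H3 : is_derive (fun y => gauss y ^ 3) y (3 * gauss y ^ 2 * (- 2 * y * gauss y))).
  { pose proof (is_derive_comp (fun v => v ^ 3) gauss y (3 * gauss y ^ 2) _
      ltac:(auto_derive; [easy | simpl; ring]) Hg) as H.
    apply (is_derive_congr _ _ _ _ _ H); [easy | unfold scal; simpl; unfold mult; simpl; ring]. }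
  pose proof (is_derive_mult _ _ _ _ _ H3 Hi Rmult_comm) as H.
  apply (is_derive_congr _ _ _ _ _ H); [easy | ].
  unfold gauss3_over, plus, mult; simpl pow; simpl plus.
  assert (y ^ k <> 0) by (apply pow_nonzero; lra).
  unfold Hierarchy.mult, Hierarchy.plus; simpl; field; lra.
Qed.

Lemma rapid_gauss3_over (k : nat) : rapid (gauss3_over k).
Proof.
  apply (rapid_le _ gauss rapid_gauss); intros y Hy.
  pose proof (gauss_pos y) as Hg.
  assert (Hg1 : gauss y <= 1).
  { unfold gauss; rewrite <- exp_0; destruct (Req_dec y 0) as [-> | Hne]; [right; f_equal; ring | ].
    left; apply exp_increasing; nra. }
  assert (Hk : 1 <= y ^ k) by (apply pow_R1_Rle; easy).
  assert (Hp : 0 < gauss y ^ 3) by (apply pow_lt; easy).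
  unfold gauss3_over; rewrite !Rabs_right.
  - apply Rmult_le_reg_r with (y ^ k); [lra | ].
    unfold Rdiv; rewrite Rmult_assoc, Rinv_l, Rmult_1_r by lra; simpl; nra.
  - lra.
  - apply Rle_ge, Rlt_le, Rdiv_lt_0_compat; lra.
Qed.

(** * Error on [5/2, oo) *)

Section Outer.

Context (f f1 f2 : R -> R) (x0 a b : R).
Context (Hf : forall x, x0 <= x -> is_derive f x (f1 x))
        (Hf1 : forall x, x0 <= x -> is_derive f1 x (f2 x))
        (Hf2 : forall x, x0 <= x -> is_derive f2 x (- f x * f2 x))
        (P2 : forall x, x0 <= x -> 0 < f2 x) (Pa : 0 < a)
        (Lf : is_lim (fun x => f x - a * x - b) p_infty 0)
        (Lf1 : is_lim (fun x => f1 x - a) p_infty 0).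

Let s := sqrt (a / 2).
Definition zvar (a b x : R) : R := sqrt (a / 2) * (x + b / a).
Let z := zvar a b.

Lemma s_pos : 0 < s.
Proof. apply sqrt_lt_R0; lra. Qed.

Lemma s_sqr : s * s = a / 2.
Proof. apply sqrt_sqrt; lra. Qed.

Lemma is_derive_zvar (x : R) : is_derive z x s.
Proof. unfold z, zvar; fold s; auto_derive; [easy | ring]. Qed.

Lemma zvar_mono (x : R) : x0 <= x -> z x0 <= z x.
Proof. intros Hx; unfold z, zvar; fold s; pose proof s_pos; nra. Qed.

Lemma zvar_eq (x : R) : 2 * s * z x = a * x + b.
Proof.
  unfold z, zvar; fold s; replace (2 * s * (s * (x + b / a))) with (2 * (s * s) * (x + b / a)) by ring.
  rewrite s_sqr; field; lra.
Qed.

Lemma is_derive_comp_zvar (h : R -> R) (x l : R) :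
  is_derive h (z x) l -> is_derive (fun x => h (z x)) x (s * l).
Proof.
  intros Hh; pose proof (is_derive_comp _ _ _ _ _ Hh (is_derive_zvar x)) as H.
  apply (is_derive_congr _ _ _ _ _ H); [easy | unfold scal; simpl; unfold mult; simpl; ring].
Qed.

Lemma is_lim_comp_zvar (h : R -> R) (l : R) :
  is_lim h p_infty l -> is_lim (fun x => h (z x)) p_infty l.
Proof. apply (is_lim_affine h l s (b / a)), s_pos. Qed.

Lemma is_lim_tail_zvar (n : nat) : is_lim (fun x => iter_tail n (z x)) p_infty 0.
Proof. apply is_lim_comp_zvar, rapid_is_lim, rapid_iter_tail. Qed.

(* F'' = 2 a s e^{-z^2} kappa and kappa' = - G kappa.  The functions c G1 and c^2 G2 are the
   terms of order c and c^2 in F0 - a x - b, and H1' = - G1, G2'' = 2 a s e^{-z^2} H1. *)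
Definition kappa (x : R) : R := f2 x * exp (z x ^ 2) / (2 * a * s).
Definition G (x : R) : R := f x - a * x - b.
Definition G1 (x : R) : R := 4 * s * iter_tail 1 (z x).
Definition H1 (x : R) : R := 4 * iter_tail 2 (z x).
Definition G2 (x : R) : R := 2 * s * second_order (z x).

Lemma f2_kappa (x : R) : f2 x = 2 * a * s * gauss (z x) * kappa x.
Proof.
  unfold kappa; pose proof (gauss_inv (z x)) as E; pose proof s_pos.
  transitivity (f2 x * (exp (z x ^ 2) * gauss (z x))); [rewrite E; ring | field; lra].
Qed.

Lemma is_derive_kappa (x : R) : x0 <= x -> is_derive kappa x (- G x * kappa x).
Proof.
  intros Hx.
  assert (He : is_derive (fun x => exp (z x ^ 2)) x (s * (2 * z x * exp (z x ^ 2)))).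
  { apply (is_derive_comp_zvar (fun y => exp (y ^ 2))); auto_derive; [easy | simpl; ring]. }
  pose proof (is_derive_scal _ _ (/ (2 * a * s)) _ (is_derive_mult _ _ _ _ _ (Hf2 x Hx) He Rmult_comm)) as H.
  apply (is_derive_congr _ _ _ _ _ H).
  - intros t; unfold kappa, mult; simpl; unfold Rdiv; ring.
  - pose proof (zvar_eq x) as Ez; unfold G, kappa, plus, mult; simpl.
    replace (f x - a * x - b) with (f x - 2 * s * z x) by lra.
    unfold Rdiv; ring.
Qed.

Lemma kappa_pos (x : R) : x0 <= x -> 0 < kappa x.
Proof.
  intros Hx; unfold kappa; pose proof s_pos; apply Rdiv_lt_0_compat.
  - apply Rmult_lt_0_compat; [apply P2; easy | apply exp_pos].
  - apply Rmult_lt_0_compat; lra.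
Qed.

Lemma is_derive_G (x : R) : x0 <= x -> is_derive G x (f1 x - a).
Proof.
  intros Hx; unfold G.
  apply (is_derive_congr (fun x => f x - (a * x + b)) _ _ (f1 x - a)); [ | intros; ring | easy].
  apply (is_derive_minus (V := R_NormedModule)); [apply Hf; easy | ].
  auto_derive; [easy | ring].
Qed.

Lemma is_derive_G' (x : R) : x0 <= x -> is_derive (fun x => f1 x - a) x (f2 x).
Proof.
  intros Hx.
  apply (is_derive_congr (fun x => minus (f1 x) a) _ _ (minus (f2 x) 0)); [ | easy | unfold minus, plus, opp; simpl; ring].
  apply (is_derive_minus (V := R_NormedModule)); [apply Hf1; easy | apply (is_derive_const (V := R_NormedModule))].
Qed.

Lemma is_derive_G1 (x : R) : is_derive G1 x (- (2 * a * iter_tail 0 (z x))).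
Proof.
  pose proof (is_derive_scal _ _ (4 * s) _ (is_derive_comp_zvar _ _ _ (is_derive_iter_tail 0 (z x)))) as H.
  apply (is_derive_congr _ _ _ _ _ H); [easy | ].
  pose proof s_sqr as E; replace a with (2 * (s * s)) by lra; ring.
Qed.

Lemma is_derive_G1' (x : R) :
  is_derive (fun x => - (2 * a * iter_tail 0 (z x))) x (2 * a * s * gauss (z x)).
Proof.
  pose proof (is_derive_scal _ _ (- (2 * a)) _ (is_derive_comp_zvar _ _ _ (is_derive_gauss_tail (z x)))) as H.
  apply (is_derive_congr _ _ _ _ _ H); [intros; simpl; ring | ring].
Qed.

Lemma is_derive_H1 (x : R) : is_derive H1 x (- G1 x).
Proof.
  pose proof (is_derive_scal _ _ 4 _ (is_derive_comp_zvar _ _ _ (is_derive_iter_tail 1 (z x)))) as H.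
  apply (is_derive_congr _ _ _ _ _ H); [easy | unfold G1; ring].
Qed.

Lemma is_derive_G2 (x : R) : is_derive G2 x (a * second_order1 (z x)).
Proof.
  pose proof (is_derive_scal _ _ (2 * s) _ (is_derive_comp_zvar _ _ _ (is_derive_second_order (z x)))) as H.
  apply (is_derive_congr _ _ _ _ _ H); [easy | ].
  pose proof s_sqr as E; replace a with (2 * (s * s)) by lra; ring.
Qed.

Lemma is_derive_G2' (x : R) :
  is_derive (fun x => a * second_order1 (z x)) x (2 * a * s * gauss (z x) * H1 x).
Proof.
  pose proof (is_derive_scal _ _ a _ (is_derive_comp_zvar _ _ _ (is_derive_second_order1 (z x)))) as H.
  apply (is_derive_congr _ _ _ _ _ H); [easy | unfold H1; ring].
Qed.

Lemma is_lim_G1 : is_lim G1 p_infty 0.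
Proof.
  apply (is_lim_ext (fun x => 4 * s * iter_tail 1 (z x) + 0 * iter_tail 1 (z x))); [intros; unfold G1; ring | ].
  apply is_lim_lin0; apply is_lim_tail_zvar.
Qed.

Lemma is_lim_G1' : is_lim (fun x => - (2 * a * iter_tail 0 (z x))) p_infty 0.
Proof.
  apply (is_lim_ext (fun x => - (2 * a) * iter_tail 0 (z x) + 0 * iter_tail 0 (z x))); [intros; ring | ].
  apply is_lim_lin0; apply is_lim_tail_zvar.
Qed.

Lemma is_lim_H1 : is_lim H1 p_infty 0.
Proof.
  apply (is_lim_ext (fun x => 4 * iter_tail 2 (z x) + 0 * iter_tail 2 (z x))); [intros; unfold H1; ring | ].
  apply is_lim_lin0; apply is_lim_tail_zvar.
Qed.

Lemma is_lim_second_order : is_lim second_order p_infty 0.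
Proof.
  pose proof (rapid_is_lim _ rapid_gauss) as Lg.
  pose proof is_lim_gauss_tail as Lt.
  assert (Lzt : is_lim (fun z => z * gauss_tail z) p_infty 0)
    by (apply rapid_is_lim, rapid_mult_id; exact (rapid_iter_tail 0)).
  assert (L2 : is_lim (fun z => gauss_tail (sqrt 2 * (z + 0))) p_infty 0)
    by (apply is_lim_affine; [apply sqrt_lt_R0; lra | exact Lt]).
  apply (is_lim_ext (fun z => 1 * (3 * (gauss z * gauss_tail z)
    + (- (2 * sqrt 2)) * gauss_tail (sqrt 2 * (z + 0))) + (-2) * (z * gauss_tail z * gauss_tail z))).
  - intros y; unfold second_order; rewrite Rplus_0_r; ring.
  - apply is_lim_lin0; [apply is_lim_lin0; [ | exact L2] | ]; apply is_lim_mult0; easy.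
Qed.

Lemma is_lim_second_order1 : is_lim second_order1 p_infty 0.
Proof.
  pose proof (rapid_is_lim _ rapid_gauss) as Lg.
  pose proof is_lim_gauss_tail as Lt.
  assert (Lzt : is_lim (fun z => z * gauss_tail z) p_infty 0)
    by (apply rapid_is_lim, rapid_mult_id; exact (rapid_iter_tail 0)).
  apply (is_lim_ext (fun z => 1 * (1 * (gauss z * gauss z) + (-2) * (gauss z * (z * gauss_tail z)))
    + (-2) * (gauss_tail z * gauss_tail z))).
  - intros y; unfold second_order1; ring.
  - apply is_lim_lin0; [apply is_lim_lin0 | ]; apply is_lim_mult0; easy.
Qed.

Lemma is_lim_G2 : is_lim G2 p_infty 0.
Proof.
  apply (is_lim_ext (fun x => 2 * s * second_order (z x) + 0 * second_order (z x))); [intros; unfold G2; ring | ].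
  apply is_lim_lin0; apply is_lim_comp_zvar, is_lim_second_order.
Qed.

Lemma is_lim_G2' : is_lim (fun x => a * second_order1 (z x)) p_infty 0.
Proof.
  apply (is_lim_ext (fun x => a * second_order1 (z x) + 0 * second_order1 (z x))); [intros; ring | ].
  apply is_lim_lin0; apply is_lim_comp_zvar, is_lim_second_order1.
Qed.

(* The second derivative of c1 G1 + c2 G2 + d G is 2 a s e^{-z^2} (c1 + c2 H1 + d kappa), and
   the combination tends to 0 with its first derivative. *)
Lemma G_comparison (c1 c2 d x1 : R) :
  x0 <= x1 ->
  (forall x, x1 <= x -> 0 <= c1 + c2 * H1 x + d * kappa x) ->
  forall x, x1 <= x ->
    0 <= c1 * G1 x + c2 * G2 x + d * G x /\
    c1 * - (2 * a * iter_tail 0 (z x)) + c2 * (a * second_order1 (z x)) + d * (f1 x - a) <= 0.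
Proof.
  intros Hx1 Hp.
  apply (convex_decay (fun x => c1 * G1 x + c2 * G2 x + d * G x)
    (fun x => c1 * - (2 * a * iter_tail 0 (z x)) + c2 * (a * second_order1 (z x)) + d * (f1 x - a))
    (fun x => 2 * a * s * gauss (z x) * (c1 + c2 * H1 x + d * kappa x))).
  - intros x Hx.
    pose proof (is_derive_scal _ _ c1 _ (is_derive_G1 x)) as D1.
    pose proof (is_derive_scal _ _ c2 _ (is_derive_G2 x)) as D2.
    pose proof (is_derive_scal _ _ d _ (is_derive_G x ltac:(lra))) as D3.
    exact (is_derive_plus _ _ _ _ _ (is_derive_plus _ _ _ _ _ D1 D2) D3).
  - intros x Hx.
    pose proof (is_derive_scal _ _ c1 _ (is_derive_G1' x)) as D1.
    pose proof (is_derive_scal _ _ c2 _ (is_derive_G2' x)) as D2.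
    pose proof (is_derive_scal _ _ d _ (is_derive_G' x ltac:(lra))) as D3.
    apply (is_derive_congr _ _ _ _ _ (is_derive_plus _ _ _ _ _ (is_derive_plus _ _ _ _ _ D1 D2) D3)); [easy | ].
    rewrite f2_kappa; unfold plus; simpl; ring.
  - intros x Hx; apply Rmult_le_pos; [ | auto].
    pose proof s_pos; pose proof (gauss_pos (z x)).
    apply Rmult_le_pos; [apply Rmult_le_pos; lra | lra].
  - apply (is_lim_ext (fun x => 1 * (c1 * G1 x + c2 * G2 x) + d * G x)); [intros; ring | ].
    apply is_lim_lin0; [apply is_lim_lin0; [apply is_lim_G1 | apply is_lim_G2] | exact Lf].
  - apply (is_lim_ext (fun x => 1 * (c1 * - (2 * a * iter_tail 0 (z x)) + c2 * (a * second_order1 (z x)))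
      + d * (f1 x - a))); [intros; ring | ].
    apply is_lim_lin0; [apply is_lim_lin0; [apply is_lim_G1' | apply is_lim_G2'] | exact Lf1].
Qed.

Lemma G_nonneg (x : R) : x0 <= x -> 0 <= G x /\ f1 x - a <= 0.
Proof.
  intros Hx; destruct (G_comparison 0 0 1 x0 ltac:(lra)) with (x := x) as [H2 H3]; [ | easy | lra].
  intros y Hy; pose proof (kappa_pos y Hy); lra.
Qed.

Lemma kappa_decreasing (x y : R) : x0 <= x -> x <= y -> kappa y <= kappa x.
Proof.
  intros Hx Hxy; cut (- kappa x <= - kappa y); [lra | ].
  apply (derive_nonneg_le (fun x => - kappa x) (fun x => - (- G x * kappa x))); [easy | | | ].
  - intros u Hu; apply (continuous_opp (V := R_NormedModule)).
    apply (is_derive_continuous _ _ _ (is_derive_kappa u ltac:(lra))).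
  - intros u Hu; apply (is_derive_opp (V := R_NormedModule)), is_derive_kappa; lra.
  - intros u Hu; pose proof (kappa_pos u ltac:(lra)); pose proof (G_nonneg u ltac:(lra)); nra.
Qed.

Lemma kappa_limit : exists c, is_lim kappa p_infty (Finite c) /\ forall x, x0 <= x -> c <= kappa x.
Proof.
  destruct (incr_bounded_lim (fun x => - kappa x) x0 0) as [l [Hl Hle]].
  - intros x y Hx Hxy; pose proof (kappa_decreasing x y Hx Hxy); lra.
  - intros x Hx; pose proof (kappa_pos x Hx); lra.
  - exists (- l); split; [ | intros x Hx; specialize (Hle x Hx); lra].
    pose proof (is_lim_opp _ p_infty l Hl) as Ho.
    apply (is_lim_ext (fun x => - - kappa x)); [intros; ring | exact Ho].
Qed.

Lemma H1_nonneg (x : R) : 0 <= H1 x.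
Proof. unfold H1; pose proof (iter_tail_nonneg 2 (z x)); lra. Qed.

(** Beyond x1 one has kappa <= kappa(x1). Together with [G_lower], which uses c <= kappa, this
    encloses both G and F' - a. *)
Lemma G_upper (x1 x : R) :
  x0 <= x1 -> x1 <= x ->
  G x <= kappa x1 * G1 x /\ - (2 * a * (kappa x1 * iter_tail 0 (z x))) <= f1 x - a.
Proof.
  intros Hx1 Hx; destruct (G_comparison (kappa x1) 0 (-1) x1 Hx1) with (x := x) as [H2 H3]; [ | easy | lra].
  intros y Hy; pose proof (kappa_decreasing x1 y Hx1 Hy); lra.
Qed.

Context (c : R) (Lc : is_lim kappa p_infty c).

Lemma c_le_kappa (x : R) : x0 <= x -> c <= kappa x.
Proof.
  apply (derive_nonpos_ge_lim kappa (fun x => - G x * kappa x)); [exact is_derive_kappa | | exact Lc].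
  intros y Hy; pose proof (kappa_pos y Hy); pose proof (G_nonneg y Hy); nra.
Qed.

Lemma G_lower (x : R) :
  x0 <= x -> c * G1 x <= G x /\ f1 x - a <= - (2 * a * (c * iter_tail 0 (z x))).
Proof.
  intros Hx; destruct (G_comparison (- c) 0 1 x0 ltac:(lra)) with (x := x) as [H2 H3]; [ | easy | lra].
  intros y Hy; pose proof (c_le_kappa y Hy); lra.
Qed.

Lemma is_derive_kappa_exp (p p' : R -> R) (x : R) :
  x0 <= x -> is_derive p x (p' x) ->
  is_derive (fun x => kappa x * exp (- p x)) x (kappa x * exp (- p x) * (- G x - p' x)).
Proof.
  intros Hx Hp.
  pose proof (is_derive_comp exp (fun x => opp (p x)) x _ _ (is_derive_exp _) (is_derive_opp _ _ _ Hp)) as He.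
  pose proof (is_derive_mult _ _ _ _ _ (is_derive_kappa x Hx) He Rmult_comm) as H.
  apply (is_derive_congr _ _ _ _ _ H); [easy | ].
  unfold plus, mult, scal, opp; simpl; unfold mult; simpl; ring.
Qed.

Lemma is_lim_kappa_exp (p : R -> R) :
  is_lim p p_infty 0 -> is_lim (fun x => kappa x * exp (- p x)) p_infty c.
Proof.
  intros Hp; replace (Finite c) with (Finite (c * exp (- 0))) by (rewrite Ropp_0, exp_0; f_equal; ring).
  apply (is_lim_mult _ _ p_infty c (exp (- 0))); [exact Lc | | easy].
  apply (is_lim_comp_continuous p (fun y => exp (- y)) p_infty 0); [exact Hp | ].
  apply (ex_derive_continuous (V := R_NormedModule) (fun y => exp (- y))); auto_derive; easy.
Qed.

(** The logarithmic derivative of kappa is -G, so kappa exp(-p) is monotone once -G - p' has a sign,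
    and its limit is c because p tends to 0. Suitable p are built from [H1], whose derivative is
    -[G1]. *)
Lemma kappa_exp_le (p p' : R -> R) (x1 : R) :
  x0 <= x1 -> (forall x, x1 <= x -> is_derive p x (p' x)) -> is_lim p p_infty 0 ->
  (forall x, x1 <= x -> 0 <= - G x - p' x) ->
  forall x, x1 <= x -> kappa x * exp (- p x) <= c.
Proof.
  intros Hx1 Hp Lp Hs.
  apply (derive_nonneg_le_lim _ (fun x => kappa x * exp (- p x) * (- G x - p' x))).
  - intros x Hx; apply is_derive_kappa_exp; [lra | auto].
  - intros x Hx; apply Rmult_le_pos; [ | auto].
    apply Rmult_le_pos; [left; apply kappa_pos; lra | left; apply exp_pos].
  - apply is_lim_kappa_exp, Lp.
Qed.

Lemma kappa_exp_ge (p p' : R -> R) (x1 : R) :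
  x0 <= x1 -> (forall x, x1 <= x -> is_derive p x (p' x)) -> is_lim p p_infty 0 ->
  (forall x, x1 <= x -> - G x - p' x <= 0) ->
  forall x, x1 <= x -> c <= kappa x * exp (- p x).
Proof.
  intros Hx1 Hp Lp Hs.
  apply (derive_nonpos_ge_lim _ (fun x => kappa x * exp (- p x) * (- G x - p' x))).
  - intros x Hx; apply is_derive_kappa_exp; [lra | auto].
  - intros x Hx; specialize (Hs x Hx).
    assert (0 <= kappa x * exp (- p x))
      by (apply Rmult_le_pos; [left; apply kappa_pos; lra | left; apply exp_pos]); nra.
  - apply is_lim_kappa_exp, Lp.
Qed.

Lemma is_derive_scal_H1 (k x : R) : is_derive (fun x => k * H1 x) x (- (k * G1 x)).
Proof.
  pose proof (is_derive_scal _ _ k _ (is_derive_H1 x)) as H.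
  apply (is_derive_congr _ _ _ _ _ H); [easy | ring].
Qed.

Lemma is_lim_scal_H1 (k : R) : is_lim (fun x => k * H1 x) p_infty 0.
Proof.
  apply (is_lim_ext (fun x => k * H1 x + 0 * H1 x)); [intros; ring | ].
  apply is_lim_lin0; apply is_lim_H1.
Qed.

Lemma kappa_lower (x : R) : x0 <= x -> kappa x * exp (- (kappa x0 * H1 x)) <= c.
Proof.
  apply (kappa_exp_le (fun x => kappa x0 * H1 x) (fun x => - (kappa x0 * G1 x))); [lra | | | ].
  - intros y _; apply is_derive_scal_H1.
  - apply is_lim_scal_H1.
  - intros y Hy; pose proof (G_upper x0 y ltac:(lra) Hy); lra.
Qed.

Lemma kappa_upper (x : R) : x0 <= x -> c <= kappa x * exp (- (c * H1 x)).
Proof.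
  apply (kappa_exp_ge (fun x => c * H1 x) (fun x => - (c * G1 x))); [lra | | | ].
  - intros y _; apply is_derive_scal_H1.
  - apply is_lim_scal_H1.
  - intros y Hy; pose proof (G_lower y Hy); lra.
Qed.

Lemma c_pos : 0 < c.
Proof.
  eapply Rlt_le_trans; [ | apply (kappa_lower x0); lra].
  apply Rmult_lt_0_compat; [apply kappa_pos; lra | apply exp_pos].
Qed.

Context (Hz : 14 / 10 <= z x0) (Hk : kappa x0 <= 1 / 4).

Lemma zvar_ge (x : R) : x0 <= x -> 14 / 10 <= z x.
Proof. intros Hx; pose proof (zvar_mono x Hx); lra. Qed.

Lemma H1_le_gauss (x : R) : x0 <= x -> z x * H1 x <= 114 / 1000 * gauss (z x).
Proof. intros Hx; unfold H1; pose proof (tail_ratio (z x) (zvar_ge x Hx)); lra. Qed.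

(** H1 <= 0.114 * 0.1507 / 1.4 < 1/75, and kappa(x0) <= 1/4. *)
Lemma kappa0_H1_small (x : R) : x0 <= x -> 0 <= kappa x0 * H1 x <= 1 / 300.
Proof.
  intros Hx; pose proof (H1_le_gauss x Hx) as H; pose proof (zvar_ge x Hx) as Hzx.
  pose proof (gauss_decreasing (14 / 10) (z x) ltac:(lra) Hzx) as Hg.
  pose proof gauss_14_le; pose proof (H1_nonneg x); pose proof (kappa_pos x0 ltac:(lra)).
  assert (H1 x <= 1 / 75) by nra.
  split; nra.
Qed.

Lemma kappa_le_exp (x : R) : x0 <= x -> kappa x <= c * exp (kappa x0 * H1 x).
Proof.
  intros Hx; pose proof (kappa_lower x Hx) as H; rewrite exp_Ropp in H.
  pose proof (exp_pos (kappa x0 * H1 x)) as He.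
  apply Rmult_le_reg_r with (/ exp (kappa x0 * H1 x)); [apply Rinv_0_lt_compat; easy | ].
  rewrite Rmult_assoc, Rinv_r by lra; lra.
Qed.

(** An upper substitute for c^2, within one percent of it; 300/299 comes from linearising the
    exponential on [0, 1/300]. *)
Let mu := c * kappa x0 * (300 / 299).

Lemma kappa_le_first (x : R) : x0 <= x -> kappa x <= c + mu * H1 x.
Proof.
  intros Hx; pose proof (kappa_le_exp x Hx) as H.
  pose proof (exp_le_linear _ (kappa0_H1_small x Hx)) as He; pose proof c_pos.
  unfold mu; nra.
Qed.

Lemma mu_le : mu <= 101 / 100 * c ^ 2.
Proof.
  pose proof (kappa_le_exp x0 ltac:(lra)) as H; pose proof c_pos.
  pose proof (kappa0_H1_small x0 ltac:(lra)) as Hsm.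
  pose proof (exp_le_linear _ Hsm) as He.
  assert (kappa x0 <= c * (1 + 1 / 299)) by nra.
  unfold mu; simpl; nra.
Qed.

Lemma mu_pos : 0 < mu.
Proof.
  pose proof c_pos; pose proof (kappa_pos x0 ltac:(lra)); unfold mu.
  apply Rmult_lt_0_compat; [apply Rmult_lt_0_compat; easy | lra].
Qed.

(** The comparison is repeated with c + mu H1 as the bound on kappa; its second term produces [G2],
    whose second derivative is 2 a s gauss times [H1]. *)
Lemma G_le_second (x : R) : x0 <= x -> G x <= c * G1 x + mu * G2 x.
Proof.
  intros Hx; destruct (G_comparison c mu (-1) x0 ltac:(lra)) with (x := x) as [H2 _]; [ | easy | lra].
  intros y Hy; pose proof (kappa_le_first y Hy); lra.
Qed.

(** With u_n the iterated tails, the second derivative of H1 G1 / 4 - G2 is 6 a s (u0 u1 - gauss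
    u2), which [tail_log_concave] makes nonnegative. The product form is needed to bound G by -p'
    for an explicit p, namely c H1 + mu H1^2 / 8. *)
Lemma G2_le (x : R) : x0 <= x -> G2 x <= H1 x * G1 x / 4.
Proof.
  intros Hx.
  assert (D1 : forall y, is_derive (fun y => H1 y * G1 y) y
    (- G1 y * G1 y + H1 y * - (2 * a * iter_tail 0 (z y)))).
  { intros y; apply (is_derive_mult _ _ _ _ _ (is_derive_H1 y) (is_derive_G1 y) Rmult_comm). }
  assert (D2 : forall y, is_derive (fun y => - G1 y * G1 y + H1 y * - (2 * a * iter_tail 0 (z y))) y
    (6 * a * iter_tail 0 (z y) * G1 y + H1 y * (2 * a * s * gauss (z y)))).
  { intros y.
    pose proof (is_derive_mult _ _ _ _ _ (is_derive_opp _ _ _ (is_derive_G1 y)) (is_derive_G1 y) Rmult_comm) as D3.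
    pose proof (is_derive_mult _ _ _ _ _ (is_derive_H1 y) (is_derive_G1' y) Rmult_comm) as D4.
    apply (is_derive_congr _ _ _ _ _ (is_derive_plus _ _ _ _ _ D3 D4)); [easy | ].
    unfold plus, mult, opp; simpl; ring. }
  cut (0 <= / 4 * (H1 x * G1 x) - G2 x); [lra | ].
  apply (convex_decay (fun y => / 4 * (H1 y * G1 y) - G2 y)
    (fun y => / 4 * (- G1 y * G1 y + H1 y * - (2 * a * iter_tail 0 (z y))) - a * second_order1 (z y))
    (fun y => / 4 * (6 * a * iter_tail 0 (z y) * G1 y + H1 y * (2 * a * s * gauss (z y)))
      - 2 * a * s * gauss (z y) * H1 y) x0); [ | | | | | easy].
  - intros y _; apply (is_derive_minus (V := R_NormedModule)); [ | apply is_derive_G2].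
    apply (is_derive_scal (fun y => H1 y * G1 y)), D1.
  - intros y _; apply (is_derive_minus (V := R_NormedModule)); [ | apply is_derive_G2'].
    apply (is_derive_scal (fun y => - G1 y * G1 y + H1 y * - (2 * a * iter_tail 0 (z y)))), D2.
  - intros y Hy; pose proof (tail_log_concave (z y) ltac:(pose proof (zvar_ge y Hy); lra)) as T.
    unfold G1, H1; pose proof s_pos.
    assert (Has : 0 < a * s) by (apply Rmult_lt_0_compat; lra).
    apply (Rmult_le_compat_l (6 * (a * s))) in T; lra.
  - apply (is_lim_ext (fun y => / 4 * (H1 y * G1 y) + (-1) * G2 y)); [intros; ring | ].
    apply is_lim_lin0; [apply is_lim_mult0; [apply is_lim_H1 | apply is_lim_G1] | apply is_lim_G2].
  - apply (is_lim_ext (fun y => / 4 * ((-1) * (G1 y * G1 y) + 1 * (H1 y * - (2 * a * iter_tail 0 (z y))))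
      + (-1) * (a * second_order1 (z y)))); [intros; ring | ].
    apply is_lim_lin0; [apply is_lim_lin0; apply is_lim_mult0 | apply is_lim_G2'];
      (apply is_lim_G1 || apply is_lim_H1 || apply is_lim_G1').
Qed.

Lemma kappa_le_second (x : R) : x0 <= x -> kappa x <= c * exp (c * H1 x + mu / 8 * H1 x ^ 2).
Proof.
  intros Hx.
  assert (H : kappa x * exp (- (c * H1 x + mu / 8 * H1 x ^ 2)) <= c).
  { revert x Hx; apply (kappa_exp_le (fun x => c * H1 x + mu / 8 * H1 x ^ 2)
      (fun x => - (c * G1 x) - mu / 4 * H1 x * G1 x)); [lra | | | ].
    - intros y _.
      pose proof (is_derive_scal _ _ (mu / 8) _
        (is_derive_mult _ _ _ _ _ (is_derive_H1 y) (is_derive_H1 y) Rmult_comm)) as D.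
      apply (is_derive_congr _ _ _ _ _ (is_derive_plus _ _ _ _ _ (is_derive_scal_H1 c y) D)).
      + intros t; unfold plus, mult; simpl; ring.
      + unfold plus, mult; simpl; field.
    - apply (is_lim_ext (fun x => 1 * (c * H1 x) + mu / 8 * (H1 x * H1 x))); [intros; ring | ].
      apply is_lim_lin0; [apply is_lim_scal_H1 | apply is_lim_mult0; apply is_lim_H1].
    - intros y Hy; pose proof (G_le_second y Hy); pose proof (G2_le y Hy); pose proof mu_pos; nra. }
  rewrite exp_Ropp in H; pose proof (exp_pos (c * H1 x + mu / 8 * H1 x ^ 2)) as He.
  apply Rmult_le_reg_r with (/ exp (c * H1 x + mu / 8 * H1 x ^ 2)); [apply Rinv_0_lt_compat; easy | ].
  rewrite Rmult_assoc, Rinv_r by lra; lra.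
Qed.

(** Put y = c H1. The lower bound is kappa >= c exp(y) >= c (1 + y). Above, kappa <= c exp(y + w)
    with w <= 101/800 y^2; the coefficient 0.64 covers 1/2 from the exponential and 1/8 from w, with
    the rounding. *)
Lemma kappa_excess (x : R) :
  x0 <= x -> 0 <= kappa x - c - c ^ 2 * H1 x <= 64 / 100 * c ^ 3 * H1 x ^ 2.
Proof.
  intros Hx; pose proof c_pos as Hc; pose proof (H1_nonneg x) as HH.
  pose proof mu_pos as Hm; pose proof mu_le as Hm2.
  assert (Hy : 0 <= c * H1 x <= 1 / 300).
  { pose proof (kappa0_H1_small x Hx); pose proof (c_le_kappa x0 ltac:(lra)); split; nra. }
  split.
  - pose proof (kappa_upper x Hx) as H; rewrite exp_Ropp in H.
    pose proof (exp_pos (c * H1 x)) as He; pose proof (exp_ineq1_le (c * H1 x)).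
    assert (c * exp (c * H1 x) <= kappa x).
    { apply Rmult_le_reg_r with (/ exp (c * H1 x)); [apply Rinv_0_lt_compat; easy | ].
      rewrite Rmult_assoc, Rinv_r by lra; lra. }
    simpl; nra.
  - pose proof (kappa_le_second x Hx) as H.
    set (y := c * H1 x) in *; set (w := mu / 8 * H1 x ^ 2) in *.
    assert (Hw : 0 <= w <= 101 / 800 * y ^ 2).
    { unfold w, y; split; [apply Rmult_le_pos; [lra | apply pow2_ge_0] | ].
      pose proof (pow2_ge_0 (H1 x)); rewrite Rpow_mult_distr; nra. }
    assert (Hw2 : w <= y / 1000) by (simpl in Hw; nra).
    pose proof (exp_le_quadratic (y + w) ltac:(lra)) as He.
    assert (Hexp : exp (y + w) <= 1 + y + 64 / 100 * y ^ 2).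
    { eapply Rle_trans; [exact He | ].
      assert ((y + w) ^ 2 <= (y * (1001 / 1000)) ^ 2) by (apply pow_incr; lra).
      simpl in *; nra. }
    replace (64 / 100 * c ^ 3 * H1 x ^ 2) with (c * (64 / 100 * y ^ 2)) by (unfold y; ring).
    replace (c ^ 2 * H1 x) with (c * y) by (unfold y; ring).
    nra.
Qed.

Definition err0 (x : R) : R := G x - c * G1 x - c ^ 2 * G2 x.
Definition err1 (x : R) : R :=
  f1 x - a + c * (2 * a * iter_tail 0 (z x)) - c ^ 2 * (a * second_order1 (z x)).
Definition err2 (x : R) : R := 2 * a * s * gauss (z x) * (kappa x - c - c ^ 2 * H1 x).

Lemma is_derive_err0 (x : R) : x0 <= x -> is_derive err0 x (err1 x).
Proof.
  intros Hx.
  pose proof (is_derive_scal _ _ c _ (is_derive_G1 x)) as D1.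
  pose proof (is_derive_scal _ _ (c ^ 2) _ (is_derive_G2 x)) as D2.
  pose proof (is_derive_minus _ _ _ _ _ (is_derive_minus _ _ _ _ _ (is_derive_G x Hx) D1) D2) as H.
  apply (is_derive_congr _ _ _ _ _ H); [easy | ].
  unfold err1, minus, plus, opp; simpl; ring.
Qed.

Lemma is_derive_err1 (x : R) : x0 <= x -> is_derive err1 x (err2 x).
Proof.
  intros Hx.
  pose proof (is_derive_scal _ _ c _ (is_derive_G1' x)) as D1.
  pose proof (is_derive_scal _ _ (c ^ 2) _ (is_derive_G2' x)) as D2.
  pose proof (is_derive_minus _ _ _ _ _ (is_derive_minus _ _ _ _ _ (is_derive_G' x Hx) D1) D2) as H.
  apply (is_derive_congr _ _ _ _ _ H).
  - intros t; unfold err1, minus, plus, opp; simpl; ring.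
  - unfold err2; rewrite (f2_kappa x); unfold minus, plus, opp; simpl; ring.
Qed.

Lemma err_signs (x : R) : x0 <= x -> 0 <= err0 x /\ err1 x <= 0 /\ 0 <= err2 x.
Proof.
  intros Hx.
  assert (H2 : forall y, x0 <= y -> 0 <= err2 y).
  { intros y Hy; unfold err2; pose proof s_pos; pose proof (gauss_pos (z y)).
    apply Rmult_le_pos; [apply Rmult_le_pos; [apply Rmult_le_pos; lra | lra] | apply kappa_excess; easy]. }
  destruct (G_comparison (- c) (- c ^ 2) 1 x0 ltac:(lra)) with (x := x) as [H3 H4]; [ | easy | ].
  - intros y Hy; pose proof (kappa_excess y Hy); lra.
  - repeat split; [unfold err0; lra | unfold err1; lra | auto].
Qed.

(** The number 0.01664 rounds up 2 * 0.64 * 0.114^2, from [kappa_excess] and [H1_le_gauss]. *)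
Let A := 1664 / 100000 * (a * s * c ^ 3).

Lemma err2_bound (x : R) : x0 <= x -> err2 x <= A * gauss3_over 2 (z x).
Proof.
  intros Hx; pose proof (kappa_excess x Hx) as [_ Hex]; pose proof (zvar_ge x Hx) as Hzx.
  pose proof (H1_le_gauss x Hx) as HH; pose proof (H1_nonneg x) as HH0.
  pose proof (gauss_pos (z x)) as Hg; pose proof s_pos as Hs; pose proof c_pos as Hc.
  assert (Has : 0 < a * s) by (apply Rmult_lt_0_compat; lra).
  assert (Hsq : (z x * H1 x) ^ 2 <= (114 / 1000 * gauss (z x)) ^ 2)
    by (apply pow_incr; split; [nra | easy]).
  assert (Hc3 : 0 < c ^ 3) by (apply pow_lt; easy).
  assert (Hz2 : 0 < z x ^ 2) by (apply pow_lt; lra).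
  unfold err2, gauss3_over, A.
  apply Rmult_le_reg_r with (z x ^ 2); [easy | ].
  replace (1664 / 100000 * (a * s * c ^ 3) * (gauss (z x) ^ 3 / z x ^ 2) * z x ^ 2)
    with (2 * (a * s) * gauss (z x) * (c ^ 3 * (832 / 100000 * gauss (z x) ^ 2))) by (field; lra).
  replace (2 * a * s * gauss (z x) * (kappa x - c - c ^ 2 * H1 x) * z x ^ 2)
    with (2 * (a * s) * gauss (z x) * ((kappa x - c - c ^ 2 * H1 x) * z x ^ 2)) by ring.
  apply Rmult_le_compat_l; [apply Rmult_le_pos; lra | ].
  apply Rle_trans with (64 / 100 * c ^ 3 * H1 x ^ 2 * z x ^ 2); [apply Rmult_le_compat_r; lra | ].
  replace (64 / 100 * c ^ 3 * H1 x ^ 2 * z x ^ 2) with (c ^ 3 * (64 / 100 * (z x * H1 x) ^ 2)) by ring.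
  apply Rmult_le_compat_l; [lra | ].
  pose proof (pow2_ge_0 (gauss (z x))); rewrite Rpow_mult_distr in Hsq; lra.
Qed.

Lemma is_derive_gauss3_zvar (k : nat) (x : R) :
  x0 <= x -> is_derive (fun x => gauss3_over (S k) (z x)) x
    (s * - (6 * gauss3_over k (z x) + INR (S k) * gauss3_over (S (S k)) (z x))).
Proof.
  intros Hx; apply is_derive_comp_zvar, is_derive_gauss3_over.
  pose proof (zvar_ge x Hx); lra.
Qed.

Lemma gauss3_pos (k : nat) (x : R) : x0 <= x -> 0 < gauss3_over k (z x).
Proof.
  intros Hx; apply Rdiv_lt_0_compat; apply pow_lt; [apply gauss_pos | ].
  pose proof (zvar_ge x Hx); lra.
Qed.

Lemma is_lim_gauss3 (k : nat) : is_lim (fun x => gauss3_over k (z x)) p_infty 0.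
Proof. apply is_lim_comp_zvar, rapid_is_lim, rapid_gauss3_over. Qed.

Lemma is_lim_err1 : is_lim err1 p_infty 0.
Proof.
  apply (is_lim_ext (fun x => 1 * (1 * (f1 x - a) + (- c) * - (2 * a * iter_tail 0 (z x)))
    + (- c ^ 2) * (a * second_order1 (z x)))); [intros; unfold err1; ring | ].
  apply is_lim_lin0; [apply is_lim_lin0; [exact Lf1 | apply is_lim_G1'] | apply is_lim_G2'].
Qed.

Lemma is_lim_err0 : is_lim err0 p_infty 0.
Proof.
  apply (is_lim_ext (fun x => 1 * (1 * G x + (- c) * G1 x) + (- c ^ 2) * G2 x)); [intros; unfold err0; ring | ].
  apply is_lim_lin0; [apply is_lim_lin0; [exact Lf | apply is_lim_G1] | apply is_lim_G2].
Qed.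

Lemma A_pos : 0 < A.
Proof.
  pose proof s_pos; pose proof c_pos; unfold A.
  apply Rmult_lt_0_compat; [lra | ].
  apply Rmult_lt_0_compat; [apply Rmult_lt_0_compat; lra | apply pow_lt; easy].
Qed.

(** The derivative of the majorant is at most -A [gauss3_over 2] <= -err2, so its sum with err1
    decreases to 0. The same argument once more gives the factor 36 s^2 of [err0_bound]. *)
Lemma err1_bound (x : R) : x0 <= x -> - err1 x <= A / (6 * s) * gauss3_over 3 (z x).
Proof.
  intros Hx; pose proof s_pos as Hs; pose proof A_pos as HA.
  cut (0 <= A / (6 * s) * gauss3_over 3 (z x) + err1 x); [lra | ].
  apply (derive_nonpos_ge_lim (fun x => A / (6 * s) * gauss3_over 3 (z x) + err1 x)
    (fun x => A / (6 * s) * (s * - (6 * gauss3_over 2 (z x) + INR 3 * gauss3_over 4 (z x))) + err2 x) x0);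
    [ | | | easy].
  - intros y Hy; apply (is_derive_plus (V := R_NormedModule)); [ | apply is_derive_err1; easy].
    apply (is_derive_scal (fun x => gauss3_over 3 (z x))), is_derive_gauss3_zvar; easy.
  - intros y Hy; pose proof (err2_bound y Hy); pose proof (gauss3_pos 4 y Hy).
    replace (A / (6 * s) * (s * - (6 * gauss3_over 2 (z y) + INR 3 * gauss3_over 4 (z y))))
      with (- (A * gauss3_over 2 (z y)) - A * gauss3_over 4 (z y) / 2) by (simpl; field; lra).
    assert (0 <= A * gauss3_over 4 (z y)) by (apply Rmult_le_pos; lra); lra.
  - apply (is_lim_ext (fun x => A / (6 * s) * gauss3_over 3 (z x) + 1 * err1 x)); [intros; ring | ].
    apply is_lim_lin0; [apply is_lim_gauss3 | apply is_lim_err1].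
Qed.

Lemma err0_bound (x : R) : x0 <= x -> err0 x <= A / (36 * (s * s)) * gauss3_over 4 (z x).
Proof.
  intros Hx; pose proof s_pos as Hs; pose proof A_pos as HA.
  cut (0 <= A / (36 * (s * s)) * gauss3_over 4 (z x) - err0 x); [lra | ].
  apply (derive_nonpos_ge_lim (fun x => A / (36 * (s * s)) * gauss3_over 4 (z x) - err0 x)
    (fun x => A / (36 * (s * s)) * (s * - (6 * gauss3_over 3 (z x) + INR 4 * gauss3_over 5 (z x))) - err1 x) x0);
    [ | | | easy].
  - intros y Hy; apply (is_derive_minus (V := R_NormedModule)); [ | apply is_derive_err0; easy].
    apply (is_derive_scal (fun x => gauss3_over 4 (z x))), is_derive_gauss3_zvar; easy.
  - intros y Hy; pose proof (err1_bound y Hy); pose proof (gauss3_pos 5 y Hy).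
    replace (A / (36 * (s * s)) * (s * - (6 * gauss3_over 3 (z y) + INR 4 * gauss3_over 5 (z y))))
      with (- (A / (6 * s) * gauss3_over 3 (z y)) - A * gauss3_over 5 (z y) / (9 * s)) by (simpl; field; lra).
    assert (0 <= A * gauss3_over 5 (z y) / (9 * s)).
    { apply Rmult_le_pos; [apply Rmult_le_pos; lra | left; apply Rinv_0_lt_compat; lra]. }
    lra.
  - apply (is_lim_ext (fun x => A / (36 * (s * s)) * gauss3_over 4 (z x) + (-1) * err0 x)); [intros; ring | ].
    apply is_lim_lin0; [apply is_lim_gauss3 | apply is_lim_err0].
Qed.

End Outer.

(** * Taylor bounds for exp and linear approximation of the Mills ratio *)

(** [f1] increases through 0 at c, so f has its minimum 0 there. This certifies Taylor bounds on
    both sides of the base point c. *)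
Lemma convex_nonneg (f f1 f2 : R -> R) (p q c : R) :
  p <= c <= q ->
  (forall x, p <= x <= q -> is_derive f x (f1 x)) ->
  (forall x, p <= x <= q -> is_derive f1 x (f2 x)) ->
  (forall x, p <= x <= q -> 0 <= f2 x) ->
  f c = 0 -> f1 c = 0 -> forall x, p <= x <= q -> 0 <= f x.
Proof.
  intros Hc H1 H2 Hp E0 E1.
  assert (M : forall x y, p <= x -> x <= y -> y <= q -> f1 x <= f1 y).
  { intros x y Hx Hxy Hy; apply (derive_nonneg_le f1 f2); [easy | | | ].
    - intros u Hu; apply (is_derive_continuous f1 u (f2 u)), H2; lra.
    - intros u Hu; apply H2; lra.
    - intros u Hu; apply Hp; lra. }
  intros x Hx; destruct (Rle_dec c x) as [Hcx | Hcx].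
  - rewrite <- E0; apply (derive_nonneg_le f f1); [easy | | | ].
    + intros u Hu; apply (is_derive_continuous f u (f1 u)), H1; lra.
    + intros u Hu; apply H1; lra.
    + intros u Hu; rewrite <- E1; apply M; lra.
  - cut (- f x <= - f c); [lra | ].
    apply (derive_nonneg_le (fun x => - f x) (fun x => - f1 x)); [lra | | | ].
    + intros u Hu; apply (continuous_opp (V := R_NormedModule)).
      apply (is_derive_continuous f u (f1 u)), H1; lra.
    + intros u Hu; apply (is_derive_opp (V := R_NormedModule)), H1; lra.
    + intros u Hu; pose proof (M u c ltac:(lra) ltac:(lra) ltac:(lra)); lra.
Qed.

Lemma exp_le_two_terms (x : R) : -1 / 10 <= x <= 1 / 10 -> exp x <= 1 + x + 6 / 10 * x ^ 2.
Proof.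
  intros Hx; cut (0 <= 1 + x + 6 / 10 * x ^ 2 - exp x); [lra | ].
  apply (convex_nonneg (fun x => 1 + x + 6 / 10 * x ^ 2 - exp x) (fun x => 1 + 12 / 10 * x - exp x)
    (fun x => 12 / 10 - exp x) (-1 / 10) (1 / 10) 0); try easy; try lra.
  - intros y _; auto_derive; [easy | field].
  - intros y _; auto_derive; [easy | field].
  - intros y Hy; pose proof (exp_le_inv y ltac:(lra)) as H.
    assert (/ (1 - y) <= / (9 / 10)) by (apply Rinv_le_contravar; lra); lra.
  - rewrite exp_0; ring.
  - rewrite exp_0; ring.
Qed.

(** Differentiating the upper estimate twice gives [exp_le_two_terms]; 1/20 replaces the limiting
    constant 1/24. *)
Lemma exp_taylor3 (x : R) :
  -1 / 10 <= x <= 1 / 10 ->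
  0 <= exp x - (1 + x + x ^ 2 / 2 + x ^ 3 / 6) <= x ^ 4 / 20.
Proof.
  intros Hx; split.
  - apply (convex_nonneg (fun x => exp x - (1 + x + x ^ 2 / 2 + x ^ 3 / 6)) (fun x => exp x - (1 + x + x ^ 2 / 2))
      (fun x => exp x - (1 + x)) (-1 / 10) (1 / 10) 0); try easy; try lra.
    + intros y _; auto_derive; [easy | field].
    + intros y _; auto_derive; [easy | field].
    + intros y _; pose proof (exp_ineq1_le y); lra.
    + rewrite exp_0; field.
    + rewrite exp_0; field.
  - cut (0 <= 1 + x + x ^ 2 / 2 + x ^ 3 / 6 + x ^ 4 / 20 - exp x); [lra | ].
    apply (convex_nonneg (fun x => 1 + x + x ^ 2 / 2 + x ^ 3 / 6 + x ^ 4 / 20 - exp x)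
      (fun x => 1 + x + x ^ 2 / 2 + x ^ 3 / 5 - exp x)
      (fun x => 1 + x + 6 / 10 * x ^ 2 - exp x) (-1 / 10) (1 / 10) 0); try easy; try lra.
    + intros y _; auto_derive; [easy | field].
    + intros y _; auto_derive; [easy | field].
    + intros y Hy; pose proof (exp_le_two_terms y Hy); lra.
    + rewrite exp_0; field.
    + rewrite exp_0; field.
Qed.

Lemma exp_2_bounds : 73889 / 10000 <= exp 2 <= 73892 / 10000.
Proof.
  pose proof (exp_taylor3 (1 / 16) ltac:(lra)) as H.
  replace 2 with (INR 32 * (1 / 16)) by (simpl; field); rewrite exp_INR_mult.
  split.
  - apply Rle_trans with ((10644938 / 10000000) ^ 32); [lra | apply pow_incr; lra].
  - apply Rle_trans with ((10644947 / 10000000) ^ 32); [apply pow_incr; lra | lra].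
Qed.

Definition mills (z : R) : R := exp (z ^ 2) * gauss_tail z.

Lemma is_derive_mills (z : R) : is_derive mills z (2 * z * mills z - 1).
Proof.
  assert (He : is_derive (fun z => exp (z ^ 2)) z (2 * z * exp (z ^ 2)))
    by (auto_derive; [easy | simpl; ring]).
  pose proof (is_derive_mult _ _ _ _ _ He (is_derive_gauss_tail z) Rmult_comm) as H.
  apply (is_derive_congr _ _ _ _ _ H); [easy | ].
  pose proof (gauss_inv z) as E; unfold mills, plus, mult; simpl; simpl in E; lra.
Qed.

Lemma mills_gauss (z : R) : gauss_tail z = gauss z * mills z.
Proof.
  unfold mills; pose proof (gauss_inv z) as E.
  transitivity (exp (z ^ 2) * gauss z * gauss_tail z); [rewrite E; ring | ring].
Qed.

Lemma iter_tail_1_mills (z : R) : iter_tail 1 z = gauss z * ((1 - 2 * z * mills z) / 2).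
Proof. simpl; rewrite mills_gauss; field. Qed.

Lemma iter_tail_2_mills (z : R) :
  iter_tail 2 z = gauss z * (((z ^ 2 + 1 / 2) * mills z - z / 2) / 2).
Proof. simpl; rewrite mills_gauss; field. Qed.

(** At a fixed z the recurrence, with the last tails nonnegative, is a linear system that encloses
    the ratio of [iter_tail 0] to [gauss]: a truncated continued fraction. The centre 1.415 is close
    to the value of [z_approx] at 0. *)
Lemma mills_center : Rabs (mills (1415 / 1000) - 29783 / 100000) <= 1 / 100000.
Proof.
  set (z := 1415 / 1000); pose proof (gauss_pos z) as Hg; pose proof (mills_gauss z) as E.
  change (gauss_tail z) with (iter_tail 0 z) in E.
  pose proof (iter_tail_rec0 z) as E0; pose proof (iter_tail_rec 0 z) as E1.
  pose proof (iter_tail_rec 1 z) as E2; pose proof (iter_tail_rec 2 z) as E3.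
  pose proof (iter_tail_rec 3 z) as E4; pose proof (iter_tail_rec 4 z) as E5.
  pose proof (iter_tail_rec 5 z) as E6; pose proof (iter_tail_rec 6 z) as E7.
  pose proof (iter_tail_rec 7 z) as E8; pose proof (iter_tail_rec 8 z) as E9.
  pose proof (iter_tail_rec 9 z) as E10; pose proof (iter_tail_rec 10 z) as E11;
  pose proof (iter_tail_rec 11 z) as E12.
  pose proof (iter_tail_nonneg 11 z) as N11; pose proof (iter_tail_nonneg 12 z) as N12.
  pose proof (iter_tail_nonneg 13 z) as N13.
  simpl INR in *.
  set (u0 := iter_tail 0 z) in *; set (u1 := iter_tail 1 z) in *; set (u2 := iter_tail 2 z) in *.
  set (u3 := iter_tail 3 z) in *; set (u4 := iter_tail 4 z) in *; set (u5 := iter_tail 5 z) in *.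
  set (u6 := iter_tail 6 z) in *; set (u7 := iter_tail 7 z) in *; set (u8 := iter_tail 8 z) in *.
  set (u9 := iter_tail 9 z) in *; set (u10 := iter_tail 10 z) in *; set (u11 := iter_tail 11 z) in *.
  set (u12 := iter_tail 12 z) in *; set (u13 := iter_tail 13 z) in *.
  clearbody u0 u1 u2 u3 u4 u5 u6 u7 u8 u9 u10 u11 u12 u13.
  set (g := gauss z) in *; set (M := mills z) in *; clearbody g M.
  assert (H : 29782 / 100000 * g <= u0 <= 29784 / 100000 * g) by (unfold z in *; lra).
  rewrite E in H; apply Rabs_le; split; apply Rmult_le_reg_l with g; lra.
Qed.

(** In units of [gauss], 1 - 2 z M is twice [iter_tail 1], and dropping [iter_tail 2] from the
    recurrence gives gauss >= (4 z^2 + 2) [iter_tail 1]. *)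
Lemma mills_defect (z : R) : 0 <= z -> 0 <= 1 - 2 * z * mills z <= / (2 * z ^ 2 + 1).
Proof.
  intros Hz; pose proof (gauss_pos z) as Hg.
  pose proof (iter_tail_nonneg 1 z) as N1; pose proof (iter_tail_nonneg 2 z) as N2.
  pose proof (iter_tail_rec0 z) as E0; pose proof (iter_tail_rec 0 z) as E1; simpl INR in E1.
  rewrite iter_tail_1_mills in N1, E0, E1.
  set (I := 1 - 2 * z * mills z) in *; set (g := gauss z) in *.
  assert (HI : 0 <= I) by (apply Rmult_le_reg_l with g; lra).
  split; [easy | ].
  assert (H2 : 0 <= 2 * z * iter_tail 2 z) by (apply Rmult_le_pos; lra).
  assert (H : g * (I * (2 * z ^ 2 + 1)) <= g * 1) by (rewrite E1 in E0; lra).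
  apply Rmult_le_reg_l in H; [ | easy].
  assert (Hq : 0 < 2 * z ^ 2 + 1) by nra.
  apply Rmult_le_reg_r with (2 * z ^ 2 + 1); [easy | rewrite Rinv_l; lra].
Qed.

(** From M' = 2 z M - 1 the value 0.29783 at 1.415 gives the slope -0.1571411, and |M''| <= 0.4 on
    the interval gives the coefficient 2/10. The last term absorbs the error of the central
    value. *)
Lemma mills_linear (z : R) :
  136 / 100 <= z <= 147 / 100 ->
  Rabs (mills z - (29783 / 100000 - 1571411 / 10000000 * (z - 1415 / 1000)))
    <= 2 / 10 * (z - 1415 / 1000) ^ 2 + 2 / 100000.
Proof.
  intros Hz; set (c := 1415 / 1000) in *.
  pose proof mills_center as Hc; fold c in Hc; apply Rabs_le_between in Hc.
  (* A Lipschitz bound comes first, as M'' = 2 M + 2 z (2 z M - 1) is estimated through the value of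
     M. *)
  assert (D : forall y, 136 / 100 <= y <= 147 / 100 -> Rabs (mills y - mills c) <= 2129 / 10000 * Rabs (y - c)).
  { assert (K : forall p q, 136 / 100 <= p -> p <= q -> q <= 147 / 100 ->
      - (2129 / 10000 * (q - p)) <= mills q - mills p <= 0).
    { intros p q Hp Hpq Hq.
      assert (HI : forall y, p < y < q -> 0 <= 1 - 2 * y * mills y <= 2129 / 10000).
      { intros y Hy; destruct (mills_defect y ltac:(lra)) as [L U]; split; [easy | ].
        assert (/ (2 * y ^ 2 + 1) <= / (46992 / 10000)) by (apply Rinv_le_contravar; nra); lra. }
      split.
      - assert (H : mills p + 2129 / 10000 * p <= mills q + 2129 / 10000 * q).
        { apply (derive_nonneg_le (fun y => mills y + 2129 / 10000 * y)
            (fun y => (2 * y * mills y - 1) + 2129 / 10000)); [easy | | | ].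
          - intros y _; apply is_derive_continuous with ((2 * y * mills y - 1) + 2129 / 10000).
            apply (is_derive_plus (V := R_NormedModule)); [apply is_derive_mills | ].
            auto_derive; [easy | ring].
          - intros y _; apply (is_derive_plus (V := R_NormedModule)); [apply is_derive_mills | ].
            auto_derive; [easy | ring].
          - intros y Hy; specialize (HI y Hy); lra. }
        lra.
      - cut (- mills p <= - mills q); [lra | ].
        apply (derive_nonneg_le (fun y => - mills y) (fun y => - (2 * y * mills y - 1))); [easy | | | ].
        + intros y _; apply (continuous_opp (V := R_NormedModule)).
          apply (is_derive_continuous _ _ _ (is_derive_mills y)).
        + intros y _; apply (is_derive_opp (V := R_NormedModule)), is_derive_mills.
        + intros y Hy; specialize (HI y Hy); lra. }
    intros y Hy; destruct (Rle_dec c y).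
    - pose proof (K c y ltac:(unfold c; lra) ltac:(lra) ltac:(lra)).
      rewrite (Rabs_right (y - c)) by lra; apply Rabs_le; lra.
    - pose proof (K y c ltac:(lra) ltac:(lra) ltac:(unfold c; lra)).
      rewrite (Rabs_left (y - c)) by lra; apply Rabs_le; lra. }
  assert (M2 : forall y, 136 / 100 <= y <= 147 / 100 ->
    - (4 / 10) <= 2 * mills y + 2 * y * (2 * y * mills y - 1) <= 4 / 10).
  { intros y Hy; specialize (D y Hy).
    assert (Rabs (y - c) <= 55 / 1000) by (apply Rabs_le; unfold c; lra).
    assert (Hb : Rabs (mills y - mills c) <= 1171 / 100000) by lra.
    apply Rabs_le_between in Hb.
    assert (Hm : 2861 / 10000 <= mills y <= 3096 / 10000) by lra.
    assert (Hq : 0 <= (y - 136 / 100) * (147 / 100 - y)) by (apply Rmult_le_pos; lra).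
    split; nra. }
  set (Ic := 2 * c * mills c - 1).
  (* Both signs of the Taylor remainder at once, by convexity of the difference to a parabola. *)
  assert (Up : forall sg, sg = 1 \/ sg = -1 ->
    0 <= 2 / 10 * (z - c) ^ 2 - sg * (mills z - (mills c + Ic * (z - c)))).
  { intros sg Hsg.
    apply (convex_nonneg (fun y => 2 / 10 * (y - c) ^ 2 - sg * (mills y - (mills c + Ic * (y - c))))
      (fun y => 4 / 10 * (y - c) - sg * ((2 * y * mills y - 1) - Ic))
      (fun y => 4 / 10 - sg * (2 * mills y + 2 * y * (2 * y * mills y - 1)))
      (136 / 100) (147 / 100) c); try easy; try (unfold c; lra).
    - intros y _.
      assert (D1 : is_derive (fun y => 2 / 10 * (y - c) ^ 2 + sg * (mills c + Ic * (y - c))) y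
        (4 / 10 * (y - c) + sg * Ic)) by (auto_derive; [easy | field]).
      pose proof (is_derive_scal _ _ (- sg) _ (is_derive_mills y)) as D2.
      apply (is_derive_congr _ _ _ _ _ (is_derive_plus _ _ _ _ _ D1 D2)).
      + intros t; unfold plus; simpl; ring.
      + unfold plus; simpl; ring.
    - intros y _.
      assert (D1 : is_derive (fun y => 4 / 10 * (y - c) + sg * (1 + Ic)) y (4 / 10))
        by (auto_derive; [easy | field]).
      assert (D3 : is_derive (fun y => 2 * y) y 2) by (auto_derive; [easy | ring]).
      pose proof (is_derive_scal _ _ (- sg) _ (is_derive_mult _ _ _ _ _ D3 (is_derive_mills y) Rmult_comm)) as D2.
      apply (is_derive_congr _ _ _ _ _ (is_derive_plus _ _ _ _ _ D1 D2)).
      + intros t; unfold plus, mult; simpl; ring.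
      + unfold plus, mult; simpl; ring.
    - intros y Hy; specialize (M2 y Hy); destruct Hsg as [-> | ->]; lra.
    - unfold Ic; ring.
    }
  pose proof (Up 1 (or_introl eq_refl)) as U1; pose proof (Up (-1) (or_intror eq_refl)) as U2.
  assert (HIc : Rabs ((Ic + 1571411 / 10000000) * (z - c)) <= 3 / 100000 * (6 / 100)).
  { rewrite Rabs_mult; apply Rmult_le_compat; try apply Rabs_pos; apply Rabs_le; unfold Ic, c in *; lra. }
  apply Rabs_le_between in HIc; apply Rabs_le; lra.
Qed.

(** * Matching at x = 5/2 *)

(* Cubic approximations, in r = alpha, of sqrt (a / 2), of z = sqrt (a / 2) (5/2 + b/a),
   of z^2 - 2, and of F, F', F'' at x = 5/2. *)
Definition s_approx (r : R) : R :=
  (909723 / 1000000) + (-363222 / 1000000) * r + (94883 / 1000000) * r ^ 2 + (37869 / 1000000) * r ^ 3.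

Definition z_approx (r : R) : R :=
  (1413912 / 1000000) + (221163 / 1000000) * r + (327638 / 1000000) * r ^ 2 + (48824 / 1000000) * r ^ 3.

Definition q_approx (r : R) : R :=
  (-853 / 1000000) + (625410 / 1000000) * r + (975880 / 1000000) * r ^ 2 + (283104 / 1000000) * r ^ 3.

Definition F_approx (r : R) : R :=
  (2581602 / 1000000) + (-630525 / 1000000) * r + (698710 / 1000000) * r ^ 2 + (-201062 / 1000000) * r ^ 3.

Definition F1_approx (r : R) : R :=
  (1623926 / 1000000) + (-1290326 / 1000000) * r + (614140 / 1000000) * r ^ 2 + (-165625 / 1000000) * r ^ 3.

Definition F2_approx (r : R) : R :=
  (95570 / 1000000) + (-122004 / 1000000) * r + (33251 / 1000000) * r ^ 2 + (37448 / 1000000) * r ^ 3.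

Definition y_approx (r : R) : R := 5 / 2 * a0 r + b0 r.
Definition M_approx (r : R) : R :=
  29783 / 100000 - 1571411 / 10000000 * (z_approx r - 1415 / 1000).

(** The powers of r become independent unknowns for [lra]. For r^3 the best linear approximation
    leaves 5.4e-5, a quarter of the crude bound 0.06^3. *)
Lemma power_bounds (r : R) :
  - 3 / 50 <= r <= 3 / 50 ->
  0 <= r ^ 2 <= 36 / 10000 /\
  Rabs (r ^ 3 - 27 / 10000 * r) <= 54 / 1000000 /\
  0 <= r ^ 4 <= 1296 / 100000000 /\ Rabs (r ^ 5) <= 8 / 10000000 /\ 0 <= r ^ 6 <= 5 / 100000000 /\
  Rabs (r ^ 7) <= 3 / 1000000000 /\ 0 <= r ^ 8 <= 2 / 10000000000 /\
  Rabs (r ^ 9) <= 2 / 100000000000 /\ 0 <= r ^ 10 <= 1 / 1000000000000.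
Proof.
  intros Hr.
  assert (Ha : Rabs r <= 3 / 50) by (apply Rabs_le; lra).
  assert (Hk : forall k, Rabs (r ^ k) <= (3 / 50) ^ k).
  { intros k; rewrite <- RPow_abs; apply pow_incr; split; [apply Rabs_pos | easy]. }
  assert (He : forall k, 0 <= r ^ (2 * k)) by (intros k; rewrite pow_mult; apply pow_le, pow2_ge_0).
  pose proof (He 1%nat) as H2; pose proof (He 2%nat) as H4; pose proof (He 3%nat) as H6.
  pose proof (He 4%nat) as H8; pose proof (He 5%nat) as H10.
  change (2 * 1)%nat with 2%nat in H2; change (2 * 2)%nat with 4%nat in H4.
  change (2 * 3)%nat with 6%nat in H6; change (2 * 4)%nat with 8%nat in H8.
  change (2 * 5)%nat with 10%nat in H10.
  pose proof (Hk 2%nat) as K2; pose proof (Hk 4%nat) as K4; pose proof (Hk 5%nat) as K5.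
  pose proof (Hk 6%nat) as K6; pose proof (Hk 7%nat) as K7; pose proof (Hk 8%nat) as K8.
  pose proof (Hk 9%nat) as K9; pose proof (Hk 10%nat) as K10.
  rewrite Rabs_right in K2, K4, K6, K8, K10 by lra.
  repeat split; try lra.
  (* The Chebyshev polynomial T_3 is bounded by 1. *)
  apply Rabs_le.
  assert (E1 : r ^ 3 - 27 / 10000 * r + 54 / 1000000 = (r - 3 / 100) ^ 2 * (r + 6 / 100)) by field.
  assert (E2 : 54 / 1000000 - (r ^ 3 - 27 / 10000 * r) = (r + 3 / 100) ^ 2 * (6 / 100 - r)) by field.
  assert (0 <= (r - 3 / 100) ^ 2 * (r + 6 / 100)) by (apply Rmult_le_pos; [apply pow2_ge_0 | lra]).
  assert (0 <= (r + 3 / 100) ^ 2 * (6 / 100 - r)) by (apply Rmult_le_pos; [apply pow2_ge_0 | lra]).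
  lra.
Qed.

Ltac poly_bound r Hr :=
  let H := fresh in
  pose proof (power_bounds r Hr) as H;
  destruct H as (? & ?K3 & ? & ?K5 & ? & ?K7 & ? & ?K9 & ?);
  repeat match goal with K : Rabs _ <= _ |- _ => apply Rabs_le_between in K end;
  try apply Rabs_le; lra.

Section Approximations.

Context (r : R) (Hr : - 3 / 50 <= r <= 3 / 50).

Lemma s_approx_eq : Rabs (2 * (s_approx r * s_approx r) - a0 r) <= 3 / 1000000.
Proof. unfold s_approx, a0; poly_bound r Hr. Qed.

Lemma z_approx_eq : Rabs (2 * s_approx r * z_approx r - y_approx r) <= 2 / 1000000.
Proof. unfold s_approx, z_approx, y_approx, a0, b0; poly_bound r Hr. Qed.

Lemma q_approx_eq : Rabs (z_approx r ^ 2 - 2 - q_approx r) <= 4 / 1000000.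
Proof. unfold z_approx, q_approx; poly_bound r Hr. Qed.

(** The quotient of c by kappa(5/2) will be shown to lie in [1 - 34/10000, 1 - 18/10000]. Here and
    in [y_residual], 1 - 17/10000 is the middle of [1 - 34/10000, 1]; in [c_residual], 1 - 26/10000
    is the middle of the former interval, and 7.389 stands for e^2. *)
Lemma a_residual :
  Rabs ((1 - 17 / 10000) * (F2_approx r * M_approx r) - s_approx r * (a0 r - F1_approx r)) <= 25 / 1000000.
Proof. unfold F2_approx, M_approx, s_approx, a0, F1_approx, z_approx; poly_bound r Hr. Qed.

Lemma y_residual :
  Rabs ((1 - 17 / 10000) * (F2_approx r * (1 - 2 * z_approx r * M_approx r))
    - a0 r * (F_approx r - y_approx r)) <= 40 / 1000000.
Proof. unfold F2_approx, M_approx, y_approx, a0, b0, F_approx, z_approx; poly_bound r Hr. Qed.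

Lemma c_residual :
  Rabs ((1 - 26 / 10000) * (73890 / 10000) * (F2_approx r * (1 + q_approx r + q_approx r ^ 2 / 2))
    - 2 * (c0 r * a0 r * s_approx r)) <= 3 / 10000.
Proof. unfold F2_approx, c0, a0, s_approx, q_approx; poly_bound r Hr. Qed.

Lemma approx_ranges :
  88 / 100 <= s_approx r <= 94 / 100 /\ 14005 / 10000 <= z_approx r <= 14285 / 10000 /\
  254 / 100 <= F_approx r <= 263 / 100 /\ 154 / 100 <= F1_approx r <= 171 / 100 /\
  88 / 1000 <= F2_approx r <= 1031 / 10000 /\ 157 / 100 <= a0 r <= 174 / 100 /\
  22 / 100 <= c0 r <= 243 / 1000 /\ - 40 / 1000 <= q_approx r <= 41 / 1000 /\
  293 / 1000 <= M_approx r <= 301 / 1000 /\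
  7 / 1000 <= F_approx r - y_approx r <= 11 / 1000 /\ 25 / 1000 <= a0 r - F1_approx r <= 35 / 1000.
Proof.
  unfold s_approx, z_approx, F_approx, F1_approx, F2_approx, a0, c0, q_approx, M_approx, z_approx, y_approx, a0, b0.
  repeat split; poly_bound r Hr.
Qed.

End Approximations.

Lemma Rabs_mult_le (x y X Y : R) : Rabs x <= X -> Rabs y <= Y -> Rabs (x * y) <= X * Y.
Proof. intros; rewrite Rabs_mult; apply Rmult_le_compat; auto using Rabs_pos. Qed.

Lemma Rabs_minus_le (x y : R) : Rabs (x - y) <= Rabs x + Rabs y.
Proof. rewrite <- (Rabs_Ropp y); apply Rabs_triang. Qed.

Ltac abs_lra :=
  repeat match goal with
  | K : Rabs _ <= _ |- _ => apply Rabs_le_between in K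
  end; try apply Rabs_le; lra.

Section Matching.

Context (r : R) (Hr : - 3 / 50 <= r <= 3 / 50).
Context (F F1 F2 a b s z : R).
Let y := 5 / 2 * a + b.
Let A := a - a0 r.
Let Y := y - y_approx r.
Let S := s - s_approx r.
Let Z := z - z_approx r.
Context (HF : Rabs (F - F_approx r) <= 4 / 1000000)
        (HF1 : Rabs (F1 - F1_approx r) <= 5 / 1000000)
        (HF2 : Rabs (F2 - F2_approx r) <= 6 / 1000000)
        (Ha : F1 <= a <= F1 + F2 / F) (Hy : F - F2 / F ^ 2 <= y <= F)
        (Hs : 0 < s) (Hs2 : 2 * (s * s) = a) (Hz : 2 * s * z = y).

Lemma data_ranges :
  253 / 100 <= F <= 264 / 100 /\ 1539 / 1000 <= F1 <= 1711 / 1000 /\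
  879 / 10000 <= F2 <= 1032 / 10000.
Proof. pose proof (approx_ranges r Hr); repeat split; abs_lra. Qed.

Lemma apriori_increments : 0 <= a - F1 <= 41 / 1000 /\ 0 <= F - y <= 17 / 1000.
Proof.
  pose proof data_ranges as (RF & RF1 & RF2).
  assert (Q1 : F2 / F <= 41 / 1000).
  { apply Rmult_le_reg_r with F; [lra | ]; unfold Rdiv; rewrite Rmult_assoc, Rinv_l by lra; lra. }
  assert (Q2 : F2 / F ^ 2 <= 17 / 1000).
  { assert (HF2' : 64 / 10 <= F ^ 2) by nra.
    apply Rmult_le_reg_r with (F ^ 2); [lra | ].
    unfold Rdiv; rewrite Rmult_assoc, Rinv_l by lra; lra. }
  lra.
Qed.

Lemma apriori_AY : Rabs A <= 36 / 1000 /\ Rabs Y <= 12 / 1000.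
Proof.
  pose proof apriori_increments; pose proof (approx_ranges r Hr).
  unfold A, Y; split; abs_lra.
Qed.

Lemma s_range : 875 / 1000 <= s <= 943 / 1000.
Proof.
  pose proof apriori_AY as [HA _]; unfold A in HA; apply Rabs_le_between in HA.
  pose proof (approx_ranges r Hr); split; nra.
Qed.

(** As 2 s^2 = a, a difference of squares shows 2 (s + s_approx) S = A up to the defect of
    [s_approx], and 2 (s + s_approx) >= 3.5. *)
Lemma S_bound : 35 / 10 * Rabs S <= Rabs A + 3 / 1000000.
Proof.
  pose proof s_range; pose proof (approx_ranges r Hr) as (Rs & _).
  pose proof (s_approx_eq r Hr) as Es.
  assert (E : S * (2 * (s + s_approx r)) = A - (2 * (s_approx r * s_approx r) - a0 r))
    by (unfold S, A; rewrite <- Hs2; ring).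
  assert (H1 : Rabs (S * (2 * (s + s_approx r))) = Rabs S * (2 * (s + s_approx r)))
    by (rewrite Rabs_mult; f_equal; apply Rabs_right; lra).
  rewrite E in H1.
  pose proof (Rabs_minus_le A (2 * (s_approx r * s_approx r) - a0 r)) as T.
  pose proof (Rabs_pos S); nra.
Qed.

Lemma Z_bound : 174 / 100 * Rabs Z <= Rabs Y + 2 / 1000000 + 2857 / 1000 * Rabs S.
Proof.
  pose proof s_range; pose proof (approx_ranges r Hr) as (_ & Rz & _).
  pose proof (z_approx_eq r Hr) as Ez.
  assert (E : Z * (2 * s) = Y - (2 * s_approx r * z_approx r - y_approx r) + - (S * (2 * z_approx r)))
    by (unfold Z, Y, S; rewrite <- Hz; ring).
  assert (H1 : Rabs (Z * (2 * s)) = Rabs Z * (2 * s)) by (rewrite Rabs_mult; f_equal; apply Rabs_right; lra).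
  assert (H2 : Rabs (S * (2 * z_approx r)) <= Rabs S * (2857 / 1000))
    by (apply Rabs_mult_le; [lra | apply Rabs_le; lra]).
  rewrite E in H1.
  pose proof (Rabs_triang (Y - (2 * s_approx r * z_approx r - y_approx r)) (- (S * (2 * z_approx r)))) as T.
  pose proof (Rabs_minus_le Y (2 * s_approx r * z_approx r - y_approx r)) as T2.
  rewrite Rabs_Ropp in T.
  pose proof (Rabs_pos Z); nra.
Qed.

Lemma apriori_Z : Rabs Z <= 24 / 1000 /\ 1376 / 1000 <= z <= 14527 / 10000.
Proof.
  pose proof apriori_AY; pose proof S_bound; pose proof Z_bound; pose proof (approx_ranges r Hr).
  assert (HZ : Rabs Z <= 24 / 1000) by lra.
  split; [easy | ]; unfold Z in HZ; abs_lra.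
Qed.

Context (M : R) (HM : M = mills z).

Lemma M_bound : Rabs (M - M_approx r) <= 168 / 1000 * Rabs Z + 64 / 1000000.
Proof.
  pose proof apriori_Z as [HZ Hzr]; pose proof (mills_linear z ltac:(lra)) as L; rewrite <- HM in L.
  pose proof (approx_ranges r Hr) as (_ & Rz & _).
  set (zc := z_approx r - 1415 / 1000).
  assert (Hzc : Rabs zc <= 145 / 10000) by (unfold zc; abs_lra).
  assert (Ed : z - 1415 / 1000 = zc + Z) by (unfold zc, Z; ring).
  assert (Hd : Rabs (z - 1415 / 1000) <= 145 / 10000 + Rabs Z)
    by (rewrite Ed; eapply Rle_trans; [apply Rabs_triang | lra]).
  assert (Hd2 : (z - 1415 / 1000) ^ 2 <= (145 / 10000 + Rabs Z) ^ 2).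
  { rewrite <- (pow2_abs (z - 1415 / 1000)); apply pow_incr; split; [apply Rabs_pos | easy]. }
  pose proof (Rabs_pos Z) as PZ.
  (* |Z| <= 0.024 linearises the square, so that the quadratic remainder is absorbed in the slope
     0.168. *)
  assert (Hd3 : (145 / 10000 + Rabs Z) ^ 2 <= 2105 / 10000000 + 53 / 1000 * Rabs Z) by nra.
  replace (M - M_approx r) with ((M - (29783 / 100000 - 1571411 / 10000000 * (z - 1415 / 1000)))
    + - (1571411 / 10000000) * Z) by (unfold M_approx, Z; ring).
  eapply Rle_trans; [apply Rabs_triang | ].
  rewrite (Rabs_mult (- _)), (Rabs_left (- _)) by lra; lra.
Qed.

Lemma M_range : 288 / 1000 <= M <= 306 / 1000.
Proof.
  pose proof M_bound; pose proof apriori_Z as [HZ _]; pose proof (approx_ranges r Hr).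
  assert (HM' : Rabs (M - M_approx r) <= 5 / 1000) by lra; abs_lra.
Qed.

Lemma defect_range : 0 <= 1 - 2 * z * M <= 22 / 100.
Proof.
  pose proof apriori_Z as [_ Hzr]; pose proof (mills_defect z ltac:(lra)) as [L U].
  rewrite <- HM in L, U; split; [easy | ].
  assert (/ (2 * z ^ 2 + 1) <= / (47 / 10)) by (apply Rinv_le_contravar; nra); lra.
Qed.

(* [w] is e^{z^2} int_z^oo h for h = e^{-z^2} I0(z^2); it enters through kappa H1 = F2 w / (a s). *)
Lemma w_ratio_range :
  182 / 100000 <= F2 * ((z ^ 2 + 1 / 2) * M - z / 2) / (a * s) <= 34 / 10000.
Proof.
  pose proof apriori_Z as [_ Hzr]; pose proof (mills_linear z ltac:(lra)) as L; rewrite <- HM in L.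
  pose proof data_ranges as (_ & _ & RF2); pose proof s_range as Rs.
  pose proof apriori_AY as [HA _]; unfold A in HA; apply Rabs_le_between in HA.
  pose proof (approx_ranges r Hr) as (_ & _ & _ & _ & _ & Ra & _).
  set (d := z - 1415 / 1000) in *; assert (Hd : - 39 / 1000 <= d <= 377 / 10000) by (unfold d; lra).
  assert (Ez : z = d + 1415 / 1000) by (unfold d; ring).
  assert (Hd2 : 0 <= d ^ 2 <= 16 / 10000) by (simpl; split; nra).
  apply Rabs_le_between in L.
  set (w := (z ^ 2 + 1 / 2) * M - z / 2).
  assert (Hw : 343 / 10000 <= w <= 42 / 1000).
  { assert (HM1 : M <= 29785 / 100000 - 1571411 / 10000000 * d + 2 / 10 * d ^ 2) by lra.
    assert (HM2 : 29781 / 100000 - 1571411 / 10000000 * d - 2 / 10 * d ^ 2 <= M) by lra.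
    assert (Hzz : 0 < z ^ 2 + 1 / 2) by nra.
    apply (Rmult_le_compat_l (z ^ 2 + 1 / 2)) in HM1; [ | lra].
    apply (Rmult_le_compat_l (z ^ 2 + 1 / 2)) in HM2; [ | lra].
    assert (Hd3 : Rabs (d ^ 3) <= 7 / 100000).
    { replace (d ^ 3) with (d ^ 2 * d) by ring.
      eapply Rle_trans; [apply (Rabs_mult_le _ _ (16 / 10000) (4 / 100)); apply Rabs_le; lra | lra]. }
    apply Rabs_le_between in Hd3.
    assert (Hd4 : 0 <= d ^ 4 <= 3 / 1000000) by (replace (d ^ 4) with (d ^ 2 * d ^ 2) by ring; split; nra).
    unfold w; rewrite Ez in *; split; lra. }
  assert (Has : 1342 / 1000 <= a * s <= 1653 / 1000).
  { split.
    - apply Rle_trans with (1534 / 1000 * (875 / 1000)); [lra | apply Rmult_le_compat; lra].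
    - assert (Hau : a <= 1752 / 1000).
      { pose proof apriori_increments as [Hi _].
        pose proof (approx_ranges r Hr) as (_ & _ & _ & RF1 & _); abs_lra. }
      apply Rle_trans with (1752 / 1000 * (943 / 1000)); [apply Rmult_le_compat; lra | lra]. }
  split; apply Rmult_le_reg_r with (a * s); try lra;
    replace (F2 * w / (a * s) * (a * s)) with (F2 * w) by (field; split; lra).
  - apply Rle_trans with (879 / 10000 * (343 / 10000)); [lra | apply Rmult_le_compat; lra].
  - apply Rle_trans with (1032 / 10000 * (42 / 1000)); [apply Rmult_le_compat; lra | lra].
Qed.

Context (T1 : (1 - 34 / 10000) * (F2 * M) <= s * (a - F1) <= F2 * M)
        (T2 : (1 - 34 / 10000) * (F2 * (1 - 2 * z * M)) <= a * (F - y) <= F2 * (1 - 2 * z * M)).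

(** The identity [E] writes s_approx A as the residual of the approximating polynomials plus small
    multiples of the deviations. The coefficients of |Z| and |S| are small because F'' and a - F'
    are small at 5/2. *)
Lemma A_inequality :
  88 / 100 * Rabs A <= 95 / 1000000 + 174 / 10000 * Rabs Z + 41 / 1000 * Rabs S.
Proof.
  pose proof M_bound as HMb; pose proof M_range as RM; pose proof data_ranges as (_ & _ & RF2).
  pose proof (approx_ranges r Hr) as (Rs & _ & _ & _ & RF2t & _).
  pose proof apriori_increments as [Hi _]; pose proof (a_residual r Hr) as Res.
  assert (B1 : Rabs (s * (a - F1) - (1 - 17 / 10000) * (F2 * M)) <= 54 / 1000000).
  { assert (0 <= F2 * M <= 1032 / 10000 * (306 / 1000)).
    { split; [apply Rmult_le_pos; lra | apply Rmult_le_compat; lra]. }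
    apply Rabs_le; lra. }
  assert (B2 : Rabs (F2_approx r * (M - M_approx r)) <= 1032 / 10000 * (168 / 1000 * Rabs Z + 64 / 1000000))
    by (apply Rabs_mult_le; [apply Rabs_le; lra | easy]).
  assert (B3 : Rabs ((F2 - F2_approx r) * M) <= 6 / 1000000 * (306 / 1000))
    by (apply Rabs_mult_le; [easy | apply Rabs_le; lra]).
  assert (B4 : Rabs (s_approx r * (F1 - F1_approx r)) <= 94 / 100 * (5 / 1000000))
    by (apply Rabs_mult_le; [apply Rabs_le; lra | easy]).
  assert (B5 : Rabs (S * (a - F1)) <= Rabs S * (41 / 1000))
    by (apply Rabs_mult_le; [lra | apply Rabs_le; lra]).
  assert (E : s_approx r * A =
    ((1 - 17 / 10000) * (F2_approx r * M_approx r) - s_approx r * (a0 r - F1_approx r))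
    + (s * (a - F1) - (1 - 17 / 10000) * (F2 * M))
    + (1 - 17 / 10000) * (F2_approx r * (M - M_approx r) + (F2 - F2_approx r) * M)
    + s_approx r * (F1 - F1_approx r) - S * (a - F1)) by (unfold A, S; ring).
  assert (B : Rabs (s_approx r * A) <= 95 / 1000000 + 174 / 10000 * Rabs Z + 41 / 1000 * Rabs S).
  { rewrite E; pose proof (Rabs_pos Z); pose proof (Rabs_pos S).
    set (u1 := _ - s_approx r * (a0 r - F1_approx r)) in *; set (u2 := s * (a - F1) - _) in *.
    set (u3 := F2_approx r * (M - _)) in *; set (u4 := (F2 - _) * M) in *.
    set (u5 := s_approx r * (F1 - _)) in *; set (u6 := S * (a - F1)) in *.
    set (nZ := Rabs Z) in *; set (nS := Rabs S) in *; clearbody u1 u2 u3 u4 u5 u6 nZ nS.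
    apply Rabs_le_between in Res; apply Rabs_le_between in B1; apply Rabs_le_between in B2.
    apply Rabs_le_between in B3; apply Rabs_le_between in B4; apply Rabs_le_between in B5.
    apply Rabs_le; lra. }
  rewrite Rabs_mult, (Rabs_right (s_approx r)) in B by lra; pose proof (Rabs_pos A); nra.
Qed.

Lemma Y_inequality :
  157 / 100 * Rabs Y <= 112 / 1000000 + 1130 / 10000 * Rabs Z + 17 / 1000 * Rabs A.
Proof.
  pose proof M_bound as HMb; pose proof M_range as RM; pose proof data_ranges as (_ & _ & RF2).
  pose proof (approx_ranges r Hr) as (Rs & Rz & _ & _ & RF2t & Ra & _).
  pose proof apriori_increments as [_ Hi]; pose proof (y_residual r Hr) as Res.
  pose proof defect_range as RI.
  set (I := 1 - 2 * z * M) in *; set (It := 1 - 2 * z_approx r * M_approx r) in *.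
  assert (B1 : Rabs (a * (F - y) - (1 - 17 / 10000) * (F2 * I)) <= 39 / 1000000).
  { assert (0 <= F2 * I <= 1032 / 10000 * (22 / 100)).
    { split; [apply Rmult_le_pos; lra | apply Rmult_le_compat; lra]. }
    apply Rabs_le; lra. }
  assert (BI1 : Rabs (Z * M) <= Rabs Z * (306 / 1000))
    by (apply Rabs_mult_le; [lra | apply Rabs_le; lra]).
  assert (BI2 : Rabs (z_approx r * (M - M_approx r)) <= 14285 / 10000 * (168 / 1000 * Rabs Z + 64 / 1000000))
    by (apply Rabs_mult_le; [apply Rabs_le; lra | easy]).
  assert (EI : I - It = -2 * (Z * M + z_approx r * (M - M_approx r))) by (unfold I, It, Z; ring).
  assert (BI : Rabs (I - It) <= 1093 / 1000 * Rabs Z + 184 / 1000000).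
  { rewrite EI; pose proof (Rabs_pos Z).
    apply Rabs_le_between in BI1; apply Rabs_le_between in BI2; apply Rabs_le; lra. }
  assert (B2 : Rabs (F2_approx r * (I - It)) <= 1032 / 10000 * (1093 / 1000 * Rabs Z + 184 / 1000000))
    by (apply Rabs_mult_le; [apply Rabs_le; lra | easy]).
  assert (B3 : Rabs ((F2 - F2_approx r) * I) <= 6 / 1000000 * (22 / 100))
    by (apply Rabs_mult_le; [easy | apply Rabs_le; lra]).
  assert (B4 : Rabs (a0 r * (F - F_approx r)) <= 174 / 100 * (4 / 1000000))
    by (apply Rabs_mult_le; [apply Rabs_le; lra | easy]).
  assert (B5 : Rabs (A * (F - y)) <= Rabs A * (17 / 1000))
    by (apply Rabs_mult_le; [lra | apply Rabs_le; lra]).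
  assert (E : a0 r * Y =
    - ((1 - 17 / 10000) * (F2_approx r * It) - a0 r * (F_approx r - y_approx r))
    + a0 r * (F - F_approx r) - (a * (F - y) - (1 - 17 / 10000) * (F2 * I))
    - (1 - 17 / 10000) * (F2_approx r * (I - It) + (F2 - F2_approx r) * I)
    + A * (F - y)) by (unfold A, Y; ring).
  assert (B : Rabs (a0 r * Y) <= 112 / 1000000 + 1130 / 10000 * Rabs Z + 17 / 1000 * Rabs A).
  { rewrite E; pose proof (Rabs_pos Z); pose proof (Rabs_pos A).
    set (u1 := _ - a0 r * (F_approx r - y_approx r)) in *; set (u2 := a * (F - y) - _) in *.
    set (u3 := F2_approx r * (I - It)) in *; set (u4 := (F2 - _) * I) in *.
    set (u5 := a0 r * (F - _)) in *; set (u6 := A * (F - y)) in *.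
    set (nZ := Rabs Z) in *; set (nA := Rabs A) in *; clearbody u1 u2 u3 u4 u5 u6 nZ nA.
    apply Rabs_le_between in Res; apply Rabs_le_between in B1; apply Rabs_le_between in B2.
    apply Rabs_le_between in B3; apply Rabs_le_between in B4; apply Rabs_le_between in B5.
    apply Rabs_le; lra. }
  rewrite Rabs_mult, (Rabs_right (a0 r)) in B by lra; pose proof (Rabs_pos Y); nra.
Qed.

(** Four linear inequalities in the four moduli, coupled weakly enough to be solved by
    elimination. *)
Lemma ASYZ_small :
  Rabs A <= 12 / 100000 /\ Rabs Y <= 9 / 100000 /\ Rabs S <= 37 / 1000000 /\ Rabs Z <= 12 / 100000.
Proof.
  pose proof A_inequality; pose proof Y_inequality; pose proof S_bound; pose proof Z_bound.
  pose proof (Rabs_pos A); pose proof (Rabs_pos Y); pose proof (Rabs_pos S); pose proof (Rabs_pos Z).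
  repeat split; lra.
Qed.

Context (c : R)
  (T3 : (1 - 34 / 10000) * (F2 * exp (z ^ 2)) <= 2 * (a * s) * c <= (1 - 18 / 10000) * (F2 * exp (z ^ 2))).

(** Writing z^2 = 2 + v, with v within 3.6e-4 of [q_approx], leaves the constant e^2 and a Taylor
    expansion at 0. *)
Lemma exp_zsq : Rabs (exp (z ^ 2) - 7389 / 1000 * (1 + q_approx r + q_approx r ^ 2 / 2)) <= 32 / 10000.
Proof.
  pose proof ASYZ_small as (_ & _ & _ & HZ); pose proof apriori_Z as [_ Rz].
  pose proof (approx_ranges r Hr) as (_ & Rzt & _ & _ & _ & _ & _ & Rq & _).
  pose proof (q_approx_eq r Hr) as Hq; set (q := q_approx r) in *.
  set (v := z ^ 2 - 2).
  assert (Hv : Rabs (v - q) <= 36 / 100000).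
  { assert (B : Rabs (Z * (z + z_approx r)) <= 12 / 100000 * (29 / 10))
      by (apply Rabs_mult_le; [easy | apply Rabs_le; lra]).
    replace (v - q) with ((z_approx r ^ 2 - 2 - q) + Z * (z + z_approx r)) by (unfold v, Z; ring).
    eapply Rle_trans; [apply Rabs_triang | lra]. }
  apply Rabs_le_between in Hv; assert (Rv : - 42 / 1000 <= v <= 42 / 1000) by lra.
  destruct (exp_taylor3 v ltac:(lra)) as [L U].
  assert (Hv2 : 0 <= v ^ 2 <= 1764 / 1000000) by (simpl; split; nra).
  assert (Hv3 : Rabs (v ^ 3) <= 75 / 1000000).
  { replace (v ^ 3) with (v ^ 2 * v) by ring.
    eapply Rle_trans; [apply (Rabs_mult_le _ _ (1764 / 1000000) (42 / 1000)); apply Rabs_le; lra | lra]. }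
  apply Rabs_le_between in Hv3.
  assert (Hv4 : v ^ 4 <= 4 / 1000000) by (replace (v ^ 4) with (v ^ 2 * v ^ 2) by ring; nra).
  assert (Hvq : Rabs ((v - q) * (1 + (v + q) / 2)) <= 36 / 100000 * (105 / 100))
    by (apply Rabs_mult_le; apply Rabs_le; lra).
  apply Rabs_le_between in Hvq.
  set (Et := 1 + q + q ^ 2 / 2).
  assert (HE : - 393 / 1000000 <= exp v - Et <= 393 / 1000000).
  { assert (Ee : exp v - Et = (exp v - (1 + v + v ^ 2 / 2 + v ^ 3 / 6)) + v ^ 3 / 6 + (v - q) * (1 + (v + q) / 2))
      by (unfold Et; field).
    lra. }
  assert (HEt : 95 / 100 <= Et <= 105 / 100) by (unfold Et; simpl; split; nra).
  pose proof exp_2_bounds as E2.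
  replace (z ^ 2) with (2 + v) by (unfold v; ring); rewrite exp_plus.
  replace (exp 2 * exp v - 7389 / 1000 * Et) with (exp 2 * (exp v - Et) + (exp 2 - 7389 / 1000) * Et) by ring.
  assert (B1 : Rabs (exp 2 * (exp v - Et)) <= 73892 / 10000 * (393 / 1000000))
    by (apply Rabs_mult_le; apply Rabs_le; lra).
  assert (B2 : Rabs ((exp 2 - 7389 / 1000) * Et) <= 2 / 10000 * (105 / 100))
    by (apply Rabs_mult_le; apply Rabs_le; lra).
  eapply Rle_trans; [apply Rabs_triang | lra].
Qed.

(** Only [T3] involves c; with A and S already known to be small, c - c0 is read off without further
    coupling. *)
Lemma C_small : Rabs (c - c0 r) <= 55 / 100000.
Proof.
  pose proof ASYZ_small as (HA & _ & HS & _); pose proof exp_zsq as HE.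
  pose proof data_ranges as (_ & _ & RF2); pose proof s_range as Rs.
  pose proof (approx_ranges r Hr) as (Rst & _ & _ & _ & RF2t & Ra & Rc & Rq & _).
  pose proof (c_residual r Hr) as Res.
  set (Et := 1 + q_approx r + q_approx r ^ 2 / 2) in *; set (Ez := exp (z ^ 2)) in *.
  assert (HEt : 95 / 100 <= Et <= 105 / 100) by (unfold Et; simpl; split; nra).
  assert (REz : 7 <= Ez <= 777 / 100) by abs_lra.
  assert (B1 : Rabs (2 * (a * s) * c - (1 - 26 / 10000) * (F2 * Ez)) <= 65 / 100000).
  { assert (0 <= F2 * Ez <= 1032 / 10000 * (777 / 100)).
    { split; [apply Rmult_le_pos; lra | apply Rmult_le_compat; lra]. }
    apply Rabs_le; lra. }
  assert (B2 : Rabs (F2_approx r * (Ez - 7389 / 1000 * Et)) <= 1032 / 10000 * (32 / 10000))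
    by (apply Rabs_mult_le; [apply Rabs_le; lra | easy]).
  assert (B3 : Rabs ((F2 - F2_approx r) * Ez) <= 6 / 1000000 * (777 / 100))
    by (apply Rabs_mult_le; [easy | apply Rabs_le; lra]).
  assert (B4 : Rabs (s * A) <= 943 / 1000 * (12 / 100000))
    by (apply Rabs_mult_le; [apply Rabs_le; lra | easy]).
  assert (B5 : Rabs (a0 r * S) <= 174 / 100 * (37 / 1000000))
    by (apply Rabs_mult_le; [apply Rabs_le; lra | easy]).
  assert (B6 : Rabs (c0 r * (s * A + a0 r * S)) <= 243 / 1000 * (18 / 100000)).
  { apply Rabs_mult_le; [apply Rabs_le; lra | ].
    eapply Rle_trans; [apply Rabs_triang | lra]. }
  assert (E : 2 * (a * s) * (c - c0 r) =
    (2 * (a * s) * c - (1 - 26 / 10000) * (F2 * Ez))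
    + (1 - 26 / 10000) * (F2_approx r * (Ez - 7389 / 1000 * Et) + (F2 - F2_approx r) * Ez)
    + ((1 - 26 / 10000) * (73890 / 10000) * (F2_approx r * Et) - 2 * (c0 r * a0 r * s_approx r))
    - 2 * (c0 r * (s * A + a0 r * S))) by (unfold A, S; field).
  assert (B : Rabs (2 * (a * s) * (c - c0 r)) <= 145 / 100000).
  { rewrite E.
    set (u1 := _ - _ * (F2 * Ez)) in *; set (u2 := F2_approx r * (Ez - _)) in *.
    set (u3 := (F2 - _) * Ez) in *; set (u4 := _ - 2 * (c0 r * a0 r * s_approx r)) in *.
    set (u5 := c0 r * (s * A + _)) in *; clearbody u1 u2 u3 u4 u5.
    apply Rabs_le_between in B1; apply Rabs_le_between in B2; apply Rabs_le_between in B3.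
    apply Rabs_le_between in Res; apply Rabs_le_between in B6; apply Rabs_le; lra. }
  assert (Has : 27 / 10 <= 2 * (a * s)).
  { assert (1569 / 1000 <= a) by (unfold A in HA; abs_lra).
    assert (1569 / 1000 * (875 / 1000) <= a * s) by (apply Rmult_le_compat; lra); lra. }
  rewrite Rabs_mult, (Rabs_right (2 * (a * s))) in B by lra.
  pose proof (Rabs_pos (c - c0 r)); nra.
Qed.

Lemma matching_in_S : S_set r a b c.
Proof.
  pose proof ASYZ_small as (HA & HY & _ & _); pose proof C_small as HC.
  assert (EB : b - b0 r = Y - 5 / 2 * A) by (unfold Y, A, y, y_approx; field).
  assert (HB : Rabs (b - b0 r) <= 39 / 100000) by (rewrite EB; abs_lra).
  unfold S_set, rho0; fold A.
  assert (Q : forall u v, Rabs u <= v -> u ^ 2 <= v ^ 2)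
    by (intros u v Huv; rewrite <- (pow2_abs u); apply pow_incr; split; [apply Rabs_pos | easy]).
  apply Q in HA; apply Q in HB; apply Q in HC.
  rewrite <- (sqrt_pow2 (5 / 10 ^ 4)) by lra.
  apply sqrt_le_1_alt; lra.
Qed.

End Matching.

(** * Translation of the estimates to F0 and E, and the values at 5/2 *)

Lemma inner_derivatives (F : R -> R -> R) (alpha : R) (f f1 f2 : R -> R) :
  smooth_solution alpha f f1 f2 -> (forall x, 0 <= x -> f x = F alpha x) ->
  forall x, inner_range x ->
    E_inner F alpha x = f x - Fhat alpha x - rounding 0 alpha x /\
    Derive_on inner_range (E_inner F alpha) x = f1 x - Fhat1 alpha x - rounding 1 alpha x /\
    Derive_on inner_range (Derive_on inner_range (E_inner F alpha)) x
      = f2 x - Fhat2 alpha x - rounding 2 alpha x.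
Proof.
  intros S Ef.
  assert (E : forall x, inner_range x -> E_inner F alpha x = f x - Fhat alpha x - rounding 0 alpha x).
  { intros x Hx; unfold E_inner; rewrite <- Ef by apply Hx; rewrite F0_inner_rounding.
    unfold rounding; simpl; ring. }
  assert (D1 : forall x, inner_range x ->
    Derive_on inner_range (E_inner F alpha) x = f1 x - Fhat1 alpha x - rounding 1 alpha x).
  { intros x Hx.
    apply (Derive_on_eq _ _ (fun x => f x - Fhat alpha x - rounding 0 alpha x)); auto.
    - intros d Hd; apply inner_range_accumulation; easy.
    - apply (is_derive_minus (V := R_NormedModule)); [ | apply is_derive_rounding].
      apply (is_derive_minus (V := R_NormedModule)); [apply S | apply is_derive_Fhat]. }
  intros x Hx; repeat split; auto.
  apply (Derive_on_eq _ _ (fun x => f1 x - Fhat1 alpha x - rounding 1 alpha x)); auto.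
  - intros d Hd; apply inner_range_accumulation; easy.
  - apply (is_derive_minus (V := R_NormedModule)); [ | apply is_derive_rounding].
    apply (is_derive_minus (V := R_NormedModule)); [apply S | apply is_derive_Fhat1].
Qed.

Lemma sup_norm_le (g : R -> R -> R) (c : R) :
  (forall alpha x, alpha_range alpha -> inner_range x -> Rabs (g alpha x) <= c) ->
  Rbar_le (sup_norm g) c.
Proof.
  intros H; apply (proj2 (Lub_Rbar_correct _)).
  intros v (alpha & x & Ha & Hx & ->); apply H; easy.
Qed.

Lemma inner_bounds_hold (F : R -> R -> R) :
  (forall alpha, alpha_range alpha -> is_solution alpha (F alpha)) -> inner_bounds F.
Proof.
  intros HF.
  assert (K : forall alpha x, alpha_range alpha -> inner_range x ->
    Rabs (E_inner F alpha x) <= 7.50 / 10 ^ 6 /\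
    Rabs (Derive_on inner_range (E_inner F alpha) x) <= 3.75 / 10 ^ 6 /\
    Rabs (Derive_on inner_range (Derive_on inner_range (E_inner F alpha)) x) <= 4.90 / 10 ^ 6).
  { intros alpha x Ha Hx; destruct (solution_extension _ _ (HF alpha Ha)) as (f & f1 & f2 & S & Ef).
    destruct (inner_derivatives F alpha f f1 f2 S Ef x Hx) as (-> & -> & ->).
    destruct (inner_error alpha f f1 f2 Ha S x Hx) as (B2 & B1 & B0).
    destruct (rounding_bound alpha x Ha Hx) as (D0 & D1 & D2).
    repeat split; (eapply Rle_trans; [apply Rabs_minus_le | lra]). }
  unfold inner_bounds; repeat split; apply sup_norm_le; intros alpha x Ha Hx; apply (K alpha x Ha Hx).
Qed.

Lemma Rpower_sqr (z p : R) : 0 < z -> Rpower (z ^ 2) p = Rpower z (2 * p).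
Proof.
  intros Hz; rewrite <- Rpower_mult; f_equal.
  replace 2 with (INR 2) by (simpl; ring); symmetry; apply Rpower_pow; easy.
Qed.

Lemma Rpower_neg_INR (z : R) (k : nat) (p : R) :
  0 < z -> 2 * p = - INR k -> Rpower (z ^ 2) p = / z ^ k.
Proof. intros Hz E; rewrite Rpower_sqr, E, Rpower_Ropp, Rpower_pow by easy; easy. Qed.

Lemma t_of_zvar (a b x : R) : 0 < a -> t_of a b x = zvar a b x ^ 2.
Proof. intros Ha; unfold t_of, zvar; rewrite Rpow_mult_distr, pow2_sqrt; lra. Qed.

Lemma exp_neg3_zvar (z : R) : exp (- 3 * z ^ 2) = gauss z ^ 3.
Proof.
  unfold gauss; rewrite <- exp_INR_mult; f_equal; simpl; ring.
Qed.

Lemma F0_outer_eq (a b c x : R) :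
  0 < a -> 0 < zvar a b x ->
  F0_outer a b c x = a * x + b + c * G1 a b x + c ^ 2 * G2 a b x.
Proof.
  intros Ha Hz; unfold F0_outer; rewrite t_of_zvar by easy.
  set (z := zvar a b x) in *; set (s := sqrt (a / 2)).
  assert (Es : sqrt (a / (2 * z ^ 2)) = s / z).
  { replace (a / (2 * z ^ 2)) with (a / 2 / z ^ 2) by (field; lra).
    rewrite sqrt_div_alt by (apply pow_lt; easy); rewrite sqrt_pow2 by lra; easy. }
  rewrite Es; replace (s / z * q0 c (z ^ 2)) with (2 * s * (q0 c (z ^ 2) / (2 * z))) by (field; lra).
  rewrite q0_eq by easy; unfold G1, G2; fold s z; ring.
Qed.

Lemma is_lim_squeeze0 (f g : R -> R) (x0 : R) :
  (forall x, x0 <= x -> Rabs (f x) <= g x) -> is_lim g p_infty 0 -> is_lim f p_infty 0.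
Proof.
  intros Hfg Hg; apply eventually_is_lim_infty; intros eps He.
  destruct (is_lim_infty_eventually g 0 eps Hg He) as [X HX].
  exists (Rmax X x0); intros x Hx; pose proof (Rmax_l X x0); pose proof (Rmax_r X x0).
  specialize (HX x ltac:(lra)); specialize (Hfg x ltac:(lra)).
  rewrite Rminus_0_r in *; apply Rabs_def2 in HX; lra.
Qed.

(** The difference of the values at x + 1 and x is the constant p. *)
Lemma linear_lim0 (p q : R) : is_lim (fun x => p * x + q) p_infty 0 -> p = 0 /\ q = 0.
Proof.
  intros H.
  assert (Hd : is_lim (fun x => 1 * (p * (1 * (x + 1)) + q) + (-1) * (p * x + q)) p_infty 0).
  { apply is_lim_lin0; [ | exact H].
    apply (is_lim_affine (fun x => p * x + q) 0 1 1); [lra | exact H]. }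
  assert (Ep : p = 0).
  { apply (is_lim_ext _ (fun _ => p)) in Hd; [ | intros; ring].
    apply is_lim_unique in Hd; rewrite Lim_const in Hd; injection Hd; easy. }
  split; [easy | ]; subst p.
  apply (is_lim_ext _ (fun _ => q)) in H; [ | intros; ring].
  apply is_lim_unique in H; rewrite Lim_const in H; injection H; easy.
Qed.

Lemma peval_1 {A : Type} (add : A -> A -> A) (nil0 : A) (ev : A -> R) (l : list A) :
  (forall x y, ev (add x y) = ev x + ev y) -> ev nil0 = 0 ->
  peval ev l 1 = ev (fold_right add nil0 l).
Proof.
  intros Hadd H0; induction l as [ | x l IH]; simpl; [easy | rewrite Hadd, IH; ring].
Qed.

(** At x = 5/2, that is y = 1, a polynomial is the sum of its coefficients; what remains is a
    quintic in beta to compare with a cubic in alpha. *)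
Lemma Fhat_end (r : R) :
  alpha_range r ->
  Rabs (Fhat r (5 / 2) - F_approx r) <= 15 / 10000000 /\
  Rabs (Fhat1 r (5 / 2) - F1_approx r) <= 15 / 10000000 /\
  Rabs (Fhat2 r (5 / 2) - F2_approx r) <= 15 / 10000000.
Proof.
  intros Hr; unfold alpha_range in Hr.
  unfold Fhat, Fhat1, Fhat2, eval2; replace (y_of (5 / 2)) with 1 by (unfold y_of; field).
  rewrite !(peval_1 Zadd2 []) by (apply eval1_add || easy); rewrite Dscale_eq.
  unfold eval1, F_approx, F1_approx, F2_approx, beta_of.
  repeat split; (match goal with |- context [peval IZR ?l _] => let v := eval vm_compute in l in change l with v end);
    cbn [peval]; poly_bound r Hr.
Qed.

(** * Existence and uniqueness of the triple *)

Section Asymptotics.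

Context (F : R -> R -> R) (alpha : R) (Halpha : alpha_range alpha) (f f1 f2 : R -> R)
  (S : smooth_solution alpha f f1 f2) (Ef : forall x, 0 <= x -> f x = F alpha x).

Lemma outer_f (x : R) : 5 / 2 <= x -> is_derive f x (f1 x).
Proof. intros; apply S. Qed.

Lemma outer_f1 (x : R) : 5 / 2 <= x -> is_derive f1 x (f2 x).
Proof. intros; apply S. Qed.

Lemma outer_f2 (x : R) : 5 / 2 <= x -> is_derive f2 x (- f x * f2 x).
Proof. intros; apply S; lra. Qed.

Lemma outer_f2_pos (x : R) : 5 / 2 <= x -> 0 < f2 x.
Proof. intros; apply (smooth_solution_pos _ _ _ _ S); lra. Qed.

Lemma end_values :
  Rabs (f (5 / 2) - F_approx alpha) <= 4 / 1000000 /\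
  Rabs (f1 (5 / 2) - F1_approx alpha) <= 5 / 1000000 /\
  Rabs (f2 (5 / 2) - F2_approx alpha) <= 6 / 1000000.
Proof.
  destruct (inner_error alpha f f1 f2 Halpha S (5 / 2)) as (B2 & B1 & B0); [unfold inner_range; lra | ].
  destruct (Fhat_end alpha Halpha) as (D0 & D1 & D2).
  repeat split; abs_lra.
Qed.

Lemma derivatives_outer (a b c x : R) :
  0 < a -> (forall x, 5 / 2 <= x -> 0 < zvar a b x) -> outer_range x ->
  E_outer F a b c alpha x = err0 f a b c x /\
  Derive_on outer_range (E_outer F a b c alpha) x = err1 f1 a b c x /\
  Derive_on outer_range (Derive_on outer_range (E_outer F a b c alpha)) x = err2 f2 a b c x.
Proof.
  intros Pa Pz Hx.
  assert (Q0 : forall x, outer_range x -> E_outer F a b c alpha x = err0 f a b c x).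
  { intros y Hy; unfold outer_range in Hy; unfold E_outer; rewrite <- Ef by lra.
    rewrite F0_outer_eq by auto; unfold err0, G; ring. }
  assert (Q1 : forall x, outer_range x ->
    Derive_on outer_range (E_outer F a b c alpha) x = err1 f1 a b c x).
  { intros y Hy; apply (Derive_on_eq _ _ (err0 f a b c)); auto.
    - intros d Hd; apply outer_range_accumulation; easy.
    - apply (is_derive_err0 f f1 (5 / 2)); auto using outer_f. }
  repeat split; auto.
  apply (Derive_on_eq _ _ (err1 f1 a b c)); auto.
  - intros d Hd; apply outer_range_accumulation; easy.
  - apply (is_derive_err1 f1 f2 (5 / 2)); auto using outer_f1.
Qed.

Lemma outer_weights (a b x : R) (k : nat) (p : R) :
  0 < a -> 0 < zvar a b x -> 2 * p = - INR k ->
  Rpower (t_of a b x) p * exp (- 3 * t_of a b x) = gauss3_over k (zvar a b x).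
Proof.
  intros Pa Pz Ep; rewrite t_of_zvar, (Rpower_neg_INR _ k) by easy.
  unfold gauss3_over; rewrite exp_neg3_zvar; unfold Rdiv; ring.
Qed.

Lemma S_set_bounds (a b c : R) :
  S_set alpha a b c ->
  Rabs (a - a0 alpha) <= 5 / 10000 /\ Rabs (b - b0 alpha) <= 1 / 1000 /\ Rabs (c - c0 alpha) <= 1 / 1000.
Proof.
  unfold S_set, rho0; intros HS.
  set (u := a - a0 alpha) in *; set (v := b - b0 alpha) in *; set (w := c - c0 alpha) in *.
  pose proof (pow2_ge_0 u); pose proof (pow2_ge_0 v); pose proof (pow2_ge_0 w).
  assert (H3 : u ^ 2 + 1 / 4 * v ^ 2 + 1 / 4 * w ^ 2 <= (5 / 10 ^ 4) ^ 2).
  { rewrite <- (pow2_sqrt (u ^ 2 + 1 / 4 * v ^ 2 + 1 / 4 * w ^ 2)) by lra.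
    apply pow_incr; split; [apply sqrt_pos | exact HS]. }
  assert (Q : forall t m, 0 <= m -> t ^ 2 <= m ^ 2 -> Rabs t <= m).
  { intros t m Hm Ht; apply Rabs_le; split; nra. }
  repeat split; apply Q; lra.
Qed.

(** 5/2 a + b is close to [y_approx], which exceeds 2.5. Positivity of z is what allows sqrt t to be
    replaced by z. *)
Lemma S_set_positive (a b c : R) :
  S_set alpha a b c -> 0 < a /\ forall x, 5 / 2 <= x -> 0 < zvar a b x.
Proof.
  intros HS; destruct (S_set_bounds a b c HS) as (Ha & Hb & _).
  pose proof (approx_ranges alpha Halpha) as (_ & _ & RF & _ & _ & Ra & _ & _ & _ & Ry & _).
  unfold y_approx in Ry; apply Rabs_le_between in Ha; apply Rabs_le_between in Hb.
  assert (Pa : 0 < a) by lra; split; [easy | ].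
  intros x Hx; unfold zvar; apply Rmult_lt_0_compat; [apply sqrt_lt_R0; lra | ].
  apply Rmult_lt_reg_l with a; [easy | ].
  replace (a * (x + b / a)) with (a * x + b) by (field; lra); nra.
Qed.

Lemma good_triple :
  exists a b c : R,
    is_lim (fun x => f x - a * x - b) p_infty 0 /\ is_lim (kappa f2 a b) p_infty c /\
    S_set alpha a b c /\ outer_bounds F alpha a b c.
Proof.
  destruct end_values as (V0 & V1 & V2).
  destruct (data_ranges alpha Halpha _ _ _ V0 V1 V2) as (R0 & R1 & R2).
  destruct (asymptote_exists f f1 f2 (5 / 2) outer_f outer_f1 outer_f2 ltac:(lra)) as
    (a & b & Lf & Lf1 & Ha & Hy).
  { intros x Hx; apply (smooth_solution_pos _ _ _ _ S); lra. }
  { exact outer_f2_pos. }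
  assert (Pa : 0 < a) by lra.
  rewrite (Rmult_comm a (5 / 2)) in Hy.
  destruct (kappa_limit f f1 f2 (5 / 2) a b outer_f outer_f1 outer_f2 outer_f2_pos Pa Lf Lf1)
    as [c [Lc _]].
  exists a, b, c; split; [easy | split; [easy | ]].
  set (s := sqrt (a / 2)); set (z := zvar a b (5 / 2)).
  pose proof (s_pos a Pa) as Ps; fold s in Ps.
  pose proof (s_sqr a Pa) as Es; fold s in Es; assert (Es2 : 2 * (s * s) = a) by lra.
  pose proof (zvar_eq a b Pa (5 / 2)) as Ez; fold s z in Ez; rewrite (Rmult_comm a (5 / 2)) in Ez.
  set (M := mills z); assert (EM : M = mills z) by easy.
  destruct (w_ratio_range alpha Halpha _ _ _ a b s z V0 V1 V2 Ha Hy Ps Es2 Ez M EM) as [Wl Wu].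
  destruct (M_range alpha Halpha _ _ _ a b s z V0 V1 V2 Ha Hy Ps Es2 Ez M EM) as [Ml Mu].
  destruct (defect_range alpha Halpha _ _ _ a b s z V0 V1 V2 Ha Hy Ps Es2 Ez M EM) as [Il Iu].
  set (k := kappa f2 a b (5 / 2)).
  pose proof (kappa_pos f2 (5 / 2) a b outer_f2_pos Pa (5 / 2) (Rle_refl _)) as Pk; fold k in Pk.
  pose proof (gauss_pos z) as Pg.
  pose proof (f2_kappa f2 a b Pa (5 / 2)) as EF2; fold s z k in EF2.
  assert (EH : H1 a b (5 / 2) = 2 * gauss z * ((z ^ 2 + 1 / 2) * M - z / 2))
    by (unfold H1; fold z; rewrite iter_tail_2_mills; fold M; field).
  assert (EkH : k * H1 a b (5 / 2) = f2 (5 / 2) * ((z ^ 2 + 1 / 2) * M - z / 2) / (a * s))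
    by (rewrite EH, EF2; field; lra).
  pose proof (kappa_lower f f1 f2 (5 / 2) a b outer_f outer_f1 outer_f2 outer_f2_pos Pa Lf Lf1 c Lc
    (5 / 2) (Rle_refl _)) as KL; fold k in KL.
  pose proof (kappa_upper f f1 f2 (5 / 2) a b outer_f outer_f1 outer_f2 outer_f2_pos Pa Lf Lf1 c Lc
    (5 / 2) (Rle_refl _)) as KU; fold k in KU.
  pose proof (c_pos f f1 f2 (5 / 2) a b outer_f outer_f1 outer_f2 outer_f2_pos Pa Lf Lf1 c Lc) as Pc.
  (* From k exp(- k H1) <= c and exp(-u) >= 1 - u, with u = k H1 <= 34/10000 by [w_ratio_range]. *)
  assert (Cl : (1 - 34 / 10000) * k <= c).
  { rewrite EkH in KL; pose proof (exp_ineq1_le (- (f2 (5 / 2) * ((z ^ 2 + 1 / 2) * M - z / 2) / (a * s)))).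
    nra. }
  (* From c <= k exp(- c H1), where c H1 >= (1 - 34/10000) k H1 and k H1 >= 182/100000. *)
  assert (Cu : c <= (1 - 18 / 10000) * k).
  { assert (HcH : 1812 / 1000000 <= c * H1 a b (5 / 2)).
    { assert (HH : 0 <= H1 a b (5 / 2)) by (apply H1_nonneg).
      apply Rle_trans with ((1 - 34 / 10000) * (k * H1 a b (5 / 2))); [lra | ].
      rewrite <- Rmult_assoc; apply Rmult_le_compat_r; lra. }
    assert (He : exp (- (c * H1 a b (5 / 2))) <= / (1 + 1812 / 1000000)).
    { rewrite exp_Ropp; apply Rinv_le_contravar; [lra | ].
      pose proof (exp_ineq1_le (c * H1 a b (5 / 2))); lra. }
    assert (/ (1 + 1812 / 1000000) <= 1 - 18 / 10000) by lra.
    nra. }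
  (* The bounds on F' - a at 5/2, multiplied by s; as F'' = 2 a s gauss kappa, the coefficient kappa
     turns into F'' M. *)
  assert (T1 : (1 - 34 / 10000) * (f2 (5 / 2) * M) <= s * (a - f1 (5 / 2)) <= f2 (5 / 2) * M).
  { destruct (G_upper f f1 f2 (5 / 2) a b outer_f outer_f1 outer_f2 outer_f2_pos Pa Lf Lf1
      (5 / 2) (5 / 2) (Rle_refl _) (Rle_refl _)) as [_ Gu].
    destruct (G_lower f f1 f2 (5 / 2) a b outer_f outer_f1 outer_f2 outer_f2_pos Pa Lf Lf1 c Lc
      (5 / 2) (Rle_refl _)) as [_ Gl].
    fold z k in Gu, Gl; simpl iter_tail in Gu, Gl; rewrite mills_gauss in Gu, Gl; fold M in Gu, Gl.
    assert (Pas : 0 < 2 * a * (gauss z * M)) by (apply Rmult_lt_0_compat; [lra | apply Rmult_lt_0_compat; lra]).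
    assert (E : f2 (5 / 2) * M = s * (2 * a * (gauss z * M) * k)) by (rewrite EF2; ring).
    rewrite E; split.
    - replace ((1 - 34 / 10000) * (s * (2 * a * (gauss z * M) * k)))
        with (s * (2 * a * (gauss z * M) * ((1 - 34 / 10000) * k))) by ring.
      apply Rmult_le_compat_l; [lra | ].
      apply (Rmult_le_compat_l _ _ _ (Rlt_le _ _ Pas)) in Cl; lra.
    - apply Rmult_le_compat_l; lra. }
  assert (T2 : (1 - 34 / 10000) * (f2 (5 / 2) * (1 - 2 * z * M))
    <= a * (f (5 / 2) - (5 / 2 * a + b)) <= f2 (5 / 2) * (1 - 2 * z * M)).
  { destruct (G_upper f f1 f2 (5 / 2) a b outer_f outer_f1 outer_f2 outer_f2_pos Pa Lf Lf1
      (5 / 2) (5 / 2) (Rle_refl _) (Rle_refl _)) as [Gu _].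
    destruct (G_lower f f1 f2 (5 / 2) a b outer_f outer_f1 outer_f2 outer_f2_pos Pa Lf Lf1 c Lc
      (5 / 2) (Rle_refl _)) as [Gl _].
    unfold G1, G in Gu, Gl; fold s z k in Gu, Gl; rewrite iter_tail_1_mills in Gu, Gl; fold M in Gu, Gl.
    set (I := 1 - 2 * z * M) in *.
    assert (Pas : 0 <= 2 * s * (gauss z * I)) by (apply Rmult_le_pos; [lra | apply Rmult_le_pos; lra]).
    assert (E : f2 (5 / 2) * I = a * (2 * s * (gauss z * I) * k)) by (rewrite EF2; ring).
    rewrite E; split.
    - replace ((1 - 34 / 10000) * (a * (2 * s * (gauss z * I) * k)))
        with (a * (2 * s * (gauss z * I) * ((1 - 34 / 10000) * k))) by ring.
      apply Rmult_le_compat_l; [lra | ].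
      apply (Rmult_le_compat_l _ _ _ Pas) in Cl; lra.
    - apply Rmult_le_compat_l; lra. }
  assert (T3 : (1 - 34 / 10000) * (f2 (5 / 2) * exp (z ^ 2)) <= 2 * (a * s) * c
    <= (1 - 18 / 10000) * (f2 (5 / 2) * exp (z ^ 2))).
  { assert (Pas : 0 < 2 * (a * s)) by (apply Rmult_lt_0_compat; [lra | apply Rmult_lt_0_compat; lra]).
    assert (E : f2 (5 / 2) * exp (z ^ 2) = 2 * (a * s) * k).
    { rewrite EF2; pose proof (gauss_inv z) as Eg.
      transitivity (2 * (a * s) * k * (exp (z ^ 2) * gauss z)); [ring | rewrite Eg; ring]. }
    rewrite E; apply (Rmult_le_compat_l _ _ _ (Rlt_le _ _ Pas)) in Cl.
    apply (Rmult_le_compat_l _ _ _ (Rlt_le _ _ Pas)) in Cu; lra. }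
  pose proof (matching_in_S alpha Halpha _ _ _ a b s z V0 V1 V2 Ha Hy Ps Es2 Ez M EM T1 T2 c T3) as HS.
  split; [exact HS | ].
  destruct (ASYZ_small alpha Halpha _ _ _ a b s z V0 V1 V2 Ha Hy Ps Es2 Ez M EM T1 T2)
    as (HA & _ & HSs & HZ).
  pose proof (C_small alpha Halpha _ _ _ a b s z V0 V1 V2 Ha Hy Ps Es2 Ez M EM T1 T2 c T3) as HC.
  pose proof (approx_ranges alpha Halpha) as (Rs & Rz & _ & _ & _ & Ra & Rc & _).
  apply Rabs_le_between in HA; apply Rabs_le_between in HSs; apply Rabs_le_between in HZ.
  apply Rabs_le_between in HC.
  assert (Hz0 : 14 / 10 <= z) by lra.
  assert (Hk4 : k <= 1 / 4) by lra.
  destruct (S_set_positive a b c HS) as [_ Pz].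
  assert (C3 : 0 < c ^ 3 <= 14457 / 1000000).
  { split; [apply pow_lt; easy | ].
    (* c <= c0 + 55/100000 <= 0.243 + 0.00055. *)
    apply Rle_trans with ((24355 / 100000) ^ 3); [apply pow_incr; lra | lra]. }
  assert (Hsc : 0 < s * c ^ 3 <= 94004 / 100000 * (14457 / 1000000)).
  { split; [apply Rmult_lt_0_compat; lra | apply Rmult_le_compat; lra]. }
  unfold outer_bounds; cbv zeta; intros x Hx.
  destruct (derivatives_outer a b c x Pa Pz Hx) as (Q0 & Q1 & Q2).
  rewrite Q0, Q1, Q2; clear Q0 Q1 Q2.
  rewrite !Rmult_assoc.
  rewrite (outer_weights a b x 4 (- 2)), (outer_weights a b x 3 (- 3 / 2)),
    (outer_weights a b x 2 (- 1)) by (auto || (simpl; field)).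
  destruct (err_signs f f1 f2 (5 / 2) a b outer_f outer_f1 outer_f2 outer_f2_pos Pa Lf Lf1 c Lc
    Hz0 Hk4 x Hx) as (S0 & S1 & S2).
  pose proof (err0_bound f f1 f2 (5 / 2) a b outer_f outer_f1 outer_f2 outer_f2_pos Pa Lf Lf1 c Lc
    Hz0 Hk4 x Hx) as B0.
  pose proof (err1_bound f f1 f2 (5 / 2) a b outer_f outer_f1 outer_f2 outer_f2_pos Pa Lf Lf1 c Lc
    Hz0 Hk4 x Hx) as B1.
  pose proof (err2_bound f f1 f2 (5 / 2) a b outer_f outer_f1 outer_f2 outer_f2_pos Pa Lf Lf1 c Lc
    Hz0 Hk4 x Hx) as B2.
  fold s in B0, B1, B2.
  rewrite (Rabs_right (err0 _ _ _ _ _)) by lra; rewrite (Rabs_left1 (err1 _ _ _ _ _)) by lra.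
  rewrite (Rabs_right (err2 _ _ _ _ _)) by lra.
  assert (W : forall j, 0 < gauss3_over j (zvar a b x)).
  { intros j; apply Rdiv_lt_0_compat; apply pow_lt; [apply gauss_pos | apply Pz; exact Hx]. }
  repeat split.
  - eapply Rle_trans; [exact B0 | apply Rmult_le_compat_r; [left; apply W | ]].
    replace (1664 / 100000 * (a * s * c ^ 3) / (36 * (s * s))) with (1664 / 1800000 * (s * c ^ 3))
      by (rewrite <- Es2; field; lra).
    lra.
  - eapply Rle_trans; [exact B1 | apply Rmult_le_compat_r; [left; apply W | ]].
    replace (1664 / 100000 * (a * s * c ^ 3) / (6 * s)) with (1664 / 600000 * (a * c ^ 3)) by (field; lra).
    assert (a * c ^ 3 <= 17402 / 10000 * (14457 / 1000000)) by (apply Rmult_le_compat; lra); lra.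
  - eapply Rle_trans; [exact B2 | apply Rmult_le_compat_r; [left; apply W | ]].
    rewrite Rmult_assoc.
    assert (a * (s * c ^ 3) <= 17402 / 10000 * (94004 / 100000 * (14457 / 1000000)))
      by (apply Rmult_le_compat; lra); lra.
Qed.

(** Two asymptotes differ by a linear function that tends to 0, which gives a' and b'. For c' the
    bound on E'' is divided by 2 a s gauss: its weight contains gauss^3, so kappa - c' - c'^2 H1
    still tends to 0. *)
Lemma triple_unique (a b c a' b' c' : R) :
  is_lim (fun x => f x - a * x - b) p_infty 0 -> is_lim (kappa f2 a b) p_infty c ->
  S_set alpha a' b' c' -> outer_bounds F alpha a' b' c' -> (a, b, c) = (a', b', c').
Proof.
  intros Lf Lc HS HB; destruct (S_set_positive a' b' c' HS) as [Pa Pz].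
  assert (LE : is_lim (err0 f a' b' c') p_infty 0).
  { apply (is_lim_squeeze0 _ (fun x => 1.76 / 10 ^ 5 * gauss3_over 4 (zvar a' b' x)
      + 0 * gauss3_over 4 (zvar a' b' x)) (5 / 2)).
    - intros x Hx; destruct (HB x Hx) as [B _].
      destruct (derivatives_outer a' b' c' x Pa Pz Hx) as (<- & _ & _).
      rewrite Rmult_assoc, (outer_weights a' b' x 4 (- 2)) in B by (auto || (simpl; field)); lra.
    - apply is_lim_lin0; apply is_lim_comp_zvar; auto; apply rapid_is_lim, rapid_gauss3_over. }
  assert (LG : is_lim (fun x => f x - a' * x - b') p_infty 0).
  { apply (is_lim_ext (fun x => 1 * (1 * err0 f a' b' c' x + c' * G1 a' b' x) + c' ^ 2 * G2 a' b' x)).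
    - intros x; unfold err0, G; ring.
    - apply is_lim_lin0; [apply is_lim_lin0; [exact LE | apply is_lim_G1; easy] | apply is_lim_G2; easy]. }
  destruct (linear_lim0 (a' - a) (b' - b)) as [Ea Eb].
  { apply (is_lim_ext (fun x => 1 * (f x - a * x - b) + (-1) * (f x - a' * x - b'))); [intros; ring | ].
    apply is_lim_lin0; easy. }
  assert (a' = a) by lra; assert (b' = b) by lra; subst a' b'.
  assert (Ec : is_lim (fun x => kappa f2 a b x - c' - c' ^ 2 * H1 a b x) p_infty 0).
  { pose proof (s_pos a Pa) as Ps; set (s := sqrt (a / 2)) in *.
    set (k := 5.50 / 10 ^ 4); set (K := k / (2 * a * s)).
    (* Beyond 2 / s - b / a one has z >= 2, so that gauss^3 / z^2 <= gauss^2. *)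
    apply (is_lim_squeeze0 _ (fun x => K * gauss (zvar a b x) + 0 * gauss (zvar a b x)) (Rmax (5 / 2) (2 / s - b / a))).
    - intros x Hx; pose proof (Rmax_l (5 / 2) (2 / s - b / a)); pose proof (Rmax_r (5 / 2) (2 / s - b / a)).
      assert (Hx' : outer_range x) by (unfold outer_range; lra).
      destruct (HB x Hx') as (_ & _ & B).
      destruct (derivatives_outer a b c' x Pa Pz Hx') as (_ & _ & E); rewrite E in B.
      rewrite Rmult_assoc, (outer_weights a b x 2 (- 1)) in B by (auto || (simpl; field)).
      unfold err2 in B; fold s in B.
      assert (Hz2 : 2 <= zvar a b x).
      { unfold zvar; fold s; replace 2 with (s * (2 / s)) by (field; lra).
        apply Rmult_le_compat_l; lra. }
      set (z := zvar a b x) in *; pose proof (gauss_pos z) as Pg.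
      set (v := kappa f2 a b x - c' - c' ^ 2 * H1 a b x) in *.
      assert (Pas : 0 < 2 * a * s) by (apply Rmult_lt_0_compat; lra).
      rewrite Rabs_mult, (Rabs_right (2 * a * s * gauss z)) in B
        by (apply Rle_ge, Rmult_le_pos; lra).
      assert (Hg3 : gauss3_over 2 z <= gauss z * gauss z).
      { assert (Hg1 : gauss z <= 1).
        { unfold gauss; rewrite <- exp_0; left; apply exp_increasing; nra. }
        assert (Hzz : 1 <= z ^ 2) by nra.
        unfold gauss3_over; apply Rmult_le_reg_r with (z ^ 2); [lra | ].
        replace (gauss z ^ 3 / z ^ 2 * z ^ 2) with (gauss z * gauss z * gauss z) by (field; lra).
        apply Rmult_le_compat_l; [apply Rmult_le_pos; lra | lra]. }
      assert (B' : 2 * a * s * gauss z * Rabs v <= k * (gauss z * gauss z)) by (unfold k; lra).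
      unfold K; apply Rmult_le_reg_l with (2 * a * s * gauss z); [apply Rmult_lt_0_compat; lra | ].
      clearbody k; replace (2 * a * s * gauss z * (k / (2 * a * s) * gauss z + 0 * gauss z))
        with (k * (gauss z * gauss z)) by (field; lra).
      exact B'.
    - apply is_lim_lin0; apply is_lim_comp_zvar; auto; apply rapid_is_lim, rapid_gauss. }
  assert (Lc' : is_lim (fun _ : R => c - c') p_infty 0).
  { assert (Lk : is_lim (fun x => kappa f2 a b x - c) p_infty 0).
    { replace (Finite 0) with (Finite (c - c)) by (f_equal; ring).
      apply (is_lim_minus _ _ p_infty c c); [exact Lc | apply is_lim_const | easy]. }
    apply (is_lim_ext (fun x => 1 * (1 * (kappa f2 a b x - c' - c' ^ 2 * H1 a b x)
      + (-1) * (kappa f2 a b x - c)) + c' ^ 2 * H1 a b x)); [intros; ring | ].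
    apply is_lim_lin0; [apply is_lim_lin0; easy | apply is_lim_H1; easy]. }
  apply is_lim_unique in Lc'; rewrite Lim_const in Lc'; injection Lc' as Lc'.
  replace c' with c by lra; easy.
Qed.

End Asymptotics.

Theorem theorem2 :
  (forall alpha : R, alpha_range alpha ->
     exists F : R -> R, is_solution alpha F /\
       forall G : R -> R, is_solution alpha G ->
         forall x : R, 0 <= x -> G x = F x) /\
  (forall F : R -> R -> R,
     (forall alpha : R, alpha_range alpha -> is_solution alpha (F alpha)) ->
     forall alpha : R, alpha_range alpha ->
       exists! abc : R * R * R,
         let '(a, b, c) := abc in
         S_set alpha a b c /\
         inner_bounds F /\
         outer_bounds F alpha a b c).
Proof.
  split.
  - intros alpha _; apply solution_exists_unique.
  - intros F HF alpha Ha.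
    destruct (solution_extension _ _ (HF alpha Ha)) as (f & f1 & f2 & S & Ef).
    destruct (good_triple F alpha Ha f f1 f2 S Ef) as (a & b & c & Lf & Lc & HS & HB).
    exists (a, b, c); split.
    + exact (conj HS (conj (inner_bounds_hold F HF) HB)).
    + intros [[a' b'] c'] (HS' & _ & HB').
      apply (triple_unique F alpha Ha f f1 f2 S Ef); easy.
Qed.
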